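(* Let $\alpha\in(0,1)$ be a constant. For the Erdős–Rényi random graph $\mathcal{G}_n(\alpha)$ with average closure coefficient $\overline{\mathcal{H}}_n$, we have, as $n\to\infty$, \[\frac{\overline{\mathcal{H}}_n-\mathbb{E}[\overline{\mathcal{H}}_n]}{\sigma_n}\Rightarrow \mathcal{N}(0,1),\] where $\sigma_n>0$, $\sigma_n^2=\sigma_{1n}^2+\sigma_{2n}^2$ (with $\sigma_{1n}^2,\sigma_{2n}^2$ as defined in the context), $\sigma_{1n}^2=\frac{6}{n^{3-\alpha}}(1+o(1))$ and $\sigma_{2n}^2=\frac{2}{n^{2+\alpha}}(1+o(1))$. Hence \[\sigma_n^2=\begin{cases}\frac{6}{n^{3-\alpha}}(1+o(1)), & \text{if }\alpha>\frac12,\\[2pt] \frac{8}{n^2\sqrt n}(1+o(1)), & \text{if }\alpha=\frac12,\\[2pt] \frac{2}{n^{2+\alpha}}(1+o(1)), & \text{if }\alpha<\frac12.\end{cases}\]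
   Context: $\mathcal{G}_n(\alpha)$ is the random undirected graph on node set $[n]=\{1,\dots,n\}$ with symmetric adjacency matrix $A$ ($A_{ij}=A_{ji}\in\{0,1\}$, $A_{ii}=0$), where the $A_{ij}$ ($1\le i<j\le n$) are independent with $\mathbb{P}(A_{ij}=1)=p_n=n^{-\alpha}$. Average closure coefficient: \[\overline{\mathcal{H}}_n=\frac1n\sum_{i=1}^n\frac{\sum_{j\ne k}A_{ij}A_{jk}A_{ki}}{\sum_{j\neq k}A_{ij}A_{jk}},\] where for each $i$ the inner sums are over $j,k\in[n]\setminus\{i\}$ with $j\ne k$ (so the denominator is the number of 2-paths starting at node $i$), and any summand with denominator zero is set to be zero. The quantities $\sigma_{1n}^2,\sigma_{2n}^2$ are the following, with $w_{ij}=1$ for $i\neq j$ and $w_{ii}=0$, all indices ranging over $[n]$: \[\sigma_{1n}^2=\frac{4}{n^2}\sum_{i<j<k}\left(\frac{1}{\nu_i}+\frac{1}{\nu_j}+\frac{1}{\nu_k}\right)^2p_nw_{ij}(1-p_nw_{ij})\,p_nw_{jk}(1-p_nw_{jk})\,p_nw_{ki}(1-p_nw_{ki}),\] \[\sigma_{2n}^2=\frac{1}{n^2}\sum_{i<j}\bigl(2b_{ij}+2c_{ij}+2c_{ji}-(a_i+a_j)-(e_{ij}+e_{ji})\bigr)^2p_nw_{ij}(1-p_nw_{ij}),\] \[\nu_i=\sum_{j,k}p_n^2w_{ij}w_{jk},\quad b_{ij}=\sum_{k}\frac{p_nw_{ik}\,p_nw_{jk}}{\nu_k},\quad c_{ij}=\sum_{k}\frac{p_nw_{ik}\,p_nw_{jk}}{\nu_i},\]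 \[a_s=\sum_{i,j,k}\frac{p_nw_{ij}\,p_nw_{jk}\,p_nw_{ki}\,p_nw_{is}}{\nu_i^2},\quad e_{is}=\sum_{j,k,t}\frac{p_nw_{ij}\,p_nw_{jk}\,p_nw_{ki}\,p_nw_{st}}{\nu_i^2}.\] $\Rightarrow$ denotes convergence in distribution, $\mathcal{N}(0,1)$ is the standard normal distribution, and $o(1)$ denotes a quantity tending to $0$ as $n\to\infty$. *)

(* Defs.v *)
From HB Require Import structures.
From mathcomp Require Import all_boot all_order all_algebra.
From mathcomp Require Import all_classical all_reals all_analysis.
From mathcomp Require Import measurable_realfun.

Set Implicit Arguments.
Unset Strict Implicit.
Unset Printing Implicit Defensive.

Import Order.TTheory GRing.Theory Num.Theory.
Import numFieldNormedType.Exports.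

Local Open Scope classical_set_scope.
Local Open Scope ring_scope.

Section Probability.
Context {R : realType}.

Definition mutually_independent d d' (T : measurableType d)
    (T' : measurableType d') (P : probability T R) (I : finType) (S : {set I})
    (X : I -> {RV P >-> T'}) : Prop :=
  forall (J : {set I}) (B : I -> set T'),
    J \subset S -> (forall i, measurable (B i)) ->
    P (\bigcap_(i in [set` J]) (X i @^-1` B i)) =
      (\prod_(i in J) P (X i @^-1` B i))%E.

(* The n-th variable may live on its own probability space. *)
Definition cvg_in_distribution (d : nat -> measure_display)
    (T : forall n, measurableType (d n)) (P : forall n, probability (T n) R)
    (X : forall n, {RV (P n) >-> R})
    (mu : probability (measurableTypeR R) R) : Prop :=
  forall x : R, {for x, continuous (fun y : R => mu `]-oo, y]%classic)} ->
    cdf (X n) x @[n --> \oo] --> mu `]-oo, x]%classic.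

Definition standardize d (T : measurableType d) (P : probability T R)
    (X : {RV P >-> R}) (s : R) : T -> R :=
  fun t => (X t - fine ('E_P[X])%E) / s.

Arguments standardize {d T} P X s.

Lemma measurable_standardize d (T : measurableType d) (P : probability T R)
    (X : {RV P >-> R}) (s : R) : measurable_fun setT (standardize P X s).
Proof.
by apply: measurable_funM => //; exact: measurable_funB.
Qed.

HB.instance Definition _ d (T : measurableType d) (P : probability T R)
    (X : {RV P >-> R}) (s : R) :=
  isMeasurableFun.Build _ _ _ _ (standardize P X s)
    (measurable_standardize X s).

(* f n = g n (1 + o(1)), for all large n only. *)
Definition eq_1o1 (f g : nat -> R) : Prop :=
  exists2 e : nat -> R, e n @[n --> \oo] --> 0 &
    \forall n \near \oo, f n = g n * (1 + e n).

End Probability.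

Arguments mutually_independent {R d d' T T'} P {I} S X.
Arguments cvg_in_distribution {R d T} P X mu.
Arguments standardize {R d T} P X s.

Section RandomGraph.
Context {R : realType}.

(* The summand is 0 when its denominator is, as x / 0 = 0. *)
Definition avg_closure n (A : 'I_n -> 'I_n -> bool) : R :=
  n%:R^-1 * \sum_(i < n)
    (\sum_(j < n | j != i) \sum_(k < n | (k != i) && (k != j))
        (A i j)%:R * (A j k)%:R * (A k i)%:R) /
    (\sum_(j < n | j != i) \sum_(k < n | (k != i) && (k != j))
        (A i j)%:R * (A j k)%:R).

Definition is_erdos_renyi n d (T : measurableType d) (P : probability T R)
    (p : R) (A : 'I_n -> 'I_n -> {RV P >-> bool}) : Prop :=
  [/\ forall i j t, A i j t = A j i t,
      forall i t, A i i t = false,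
      forall i j : 'I_n, (i < j)%N -> P (A i j @^-1` [set true]) = p%:E &
      mutually_independent P [set ij : 'I_n * 'I_n | (ij.1 < ij.2)%N]
        (fun ij => A ij.1 ij.2)].

Definition avg_closure_rv n d (T : measurableType d) (P : probability T R)
    (A : 'I_n -> 'I_n -> {RV P >-> bool}) : T -> R :=
  fun t => avg_closure (fun i j => A i j t).

Arguments avg_closure_rv {n d T} P A.

Lemma measurable_avg_closure_rv n d (T : measurableType d)
    (P : probability T R) (A : 'I_n -> 'I_n -> {RV P >-> bool}) :
  measurable_fun setT (avg_closure_rv P A).
Proof.
pose F (a : {ffun 'I_n * 'I_n -> bool}) : R :=
  avg_closure (fun i j => a (i, j)).
have -> : avg_closure_rv P A = (fun t => \sum_a F a *
    \prod_(ij : 'I_n * 'I_n) (A ij.1 ij.2 t == a ij)%:R).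
  apply/funext => t; pose a0 := [ffun ij : 'I_n * 'I_n => A ij.1 ij.2 t].
  rewrite (bigD1 a0)//= [X in _ + X]big1 ?addr0.
    rewrite big1 ?mulr1; last by move=> ij _; rewrite ffunE eqxx.
    by rewrite /F /avg_closure_rv; congr avg_closure; apply/funext => i;
      apply/funext => j; rewrite ffunE.
  move=> a aa0; have [[ij aij]|aE] := pselect (exists ij, A ij.1 ij.2 t != a ij).
    by rewrite [X in _ * X](bigD1 ij)//= (negbTE aij) mul0r mulr0.
  case/eqP: aa0; apply/ffunP => ij; rewrite ffunE; apply/eqP.
  by rewrite eq_sym; apply/negPn/negP => h; apply: aE; exists ij.
apply: measurable_sum => a; apply: measurable_funM => //.
apply: measurable_prod => ij _.
exact: (measurableT_comp (f := fun b : bool => (b == a ij)%:R : R)).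
Qed.

HB.instance Definition _ n d (T : measurableType d) (P : probability T R)
    (A : 'I_n -> 'I_n -> {RV P >-> bool}) :=
  isMeasurableFun.Build _ _ _ _ (avg_closure_rv P A)
    (measurable_avg_closure_rv A).

Definition edge_prob (alpha : R) (n : nat) : R := n%:R `^ (- alpha).

End RandomGraph.

Arguments is_erdos_renyi {R n d T} P p A.
Arguments avg_closure_rv {R n d T} P A.

Section Variance.
Context {R : realType} (n : nat) (p : R).
Implicit Types i j k s t : 'I_n.

Definition wt i j : R := (i != j)%:R.

(* The terms with k = i are included. *)
Definition nu i : R := \sum_j \sum_k p ^+ 2 * wt i j * wt j k.

Definition coef_b i j : R := \sum_k (p * wt i k) * (p * wt j k) / nu k.

Definition coef_c i j : R := \sum_k (p * wt i k) * (p * wt j k) / nu i.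

Definition coef_a s : R :=
  \sum_i \sum_j \sum_k
    (p * wt i j) * (p * wt j k) * (p * wt k i) * (p * wt i s) / nu i ^+ 2.

Definition coef_e i s : R :=
  \sum_j \sum_k \sum_t
    (p * wt i j) * (p * wt j k) * (p * wt k i) * (p * wt s t) / nu i ^+ 2.

Definition bern_var i j : R := p * wt i j * (1 - p * wt i j).

Definition sigma1_sq : R :=
  4 / n%:R ^+ 2 *
  \sum_(i < n) \sum_(j < n | (i < j)%N) \sum_(k < n | (j < k)%N)
    ((nu i)^-1 + (nu j)^-1 + (nu k)^-1) ^+ 2 *
    bern_var i j * bern_var j k * bern_var k i.

Definition sigma2_sq : R :=
  (n%:R ^+ 2)^-1 *
  \sum_(i < n) \sum_(j < n | (i < j)%N)
    (2 * coef_b i j + 2 * coef_c i j + 2 * coef_c j i -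
      (coef_a i + coef_a j) - (coef_e i j + coef_e j i)) ^+ 2 *
    bern_var i j.

Definition sigma : R := Num.sqrt (sigma1_sq + sigma2_sq).

End Variance.

(* Main.v *)
Require Import Defs.
From HB Require Import structures.
From mathcomp Require Import all_boot all_order all_algebra.
From mathcomp Require Import all_classical all_reals all_analysis.
From mathcomp Require Import measurable_realfun.
From mathcomp Require Import ring lra zify.
Set Implicit Arguments.
Unset Strict Implicit.
Unset Printing Implicit Defensive.
Import Order.TTheory GRing.Theory Num.Theory.
Import numFieldNormedType.Exports.
Local Open Scope classical_set_scope.
Local Open Scope ring_scope.

(** The closure coefficient is an average of ratios N_i / D_i, where D_i counts
    the 2-paths that start at i and N_i those that close up to a triangle. Both
    counts concentrate around nu = (n - 1) (n - 2) p^2 and p nu. Replacing the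
    denominators by nu makes the average linear in N_i - p D_i
    (ratio_linearization, closure_approxE), and summing over i gives, in terms of
    the centred adjacency matrix y, a sum k1 * (edges) + k3 * (triangles), a sum
    over centred 2-paths, and an error that is quadratic in fluctuations
    (centered_expansion). The linear statistic lead of edges and triangles has
    variance 6 / (n^3 p) + 2 p / n^2 up to factors tending to 1: the first part
    comes from the triangles, the second from the edges, and they are equal in
    order when n p^2 is bounded above and below, that is for alpha = 1/2. These
    are also the leading terms of sigma1_sq and sigma2_sq (sigma1_sqE,
    sigma2_sqE), which gives the statements on the variance.

    Everything else is negligible at the scale sigma. The Efron-Stein inequality
    (efron_stein_graph) bounds the variance of the remainder (var_remainder),
    given that degrees are of order n p and codegrees of smaller order. Graphs
    without these properties have a probability smaller than every power of n
    (EG_irregular), so crude bounds suffice for them; truncating the denominators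
    keeps all quantities defined and polynomially bounded there.

    The linear statistic L is asymptotically Gaussian by Stein's method. Each
    summand y_uv of L is multiplied by a function of the other edges, so
    integrating by parts bit by bit (lead_ibp) gives
    E[L f(L / s)] = E[Gamma f'(L / s)] / s up to third-order terms, where Gamma is
    a quadratic function of centred codegrees (stein_lead). The mean of Gamma is
    close to sigma^2 (cvg_mean_gamma), its variance is small (var_gamma), and so is
    the third-order sum (third_order_le). For a test function that decreases
    linearly from 1 to 0, Stein's equation has a solution with bounded and
    Lipschitz derivative, by the Mills ratio bounds (stein_equation); hence the
    expectations of such ramps converge (cvg_ramp). Indicators of rays lie between
    two ramps, which gives convergence of the distribution functions
    (cvg_EG_std_closure).

    All this happens in the finite space of bit arrays with a product weight,
    where expectations are finite sums; independence of the edges identifies it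
    with the law of the given random graph (prob_sample). *)

(** * Expectation over independent bits and the Efron-Stein inequality *)

Section BernoulliProduct.
Context {R : realFieldType} {I : finType} (p : I -> R).
Hypothesis p01 : forall i, 0 <= p i <= 1.
Local Notation cfg := {ffun I -> bool}.
Implicit Types (f g : cfg -> R) (a : cfg) (e : I).

Definition wgt a : R := \prod_i (if a i then p i else 1 - p i).
Definition Ex f : R := \sum_a wgt a * f a.
Definition upd a e b : cfg := [ffun i => if i == e then b else a i].
(** Conditional expectation given the bits other than e. *)
Definition avg e f : cfg -> R :=
  fun a => p e * f (upd a e true) + (1 - p e) * f (upd a e false).
(** Discrete derivative in the direction of the bit e. *)
Definition flip_diff e f : cfg -> R := fun a => f (upd a e true) - f (upd a e false).

Lemma updE a e b i : upd a e b i = if i == e then b else a i.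
Proof. by rewrite ffunE. Qed.

Lemma upd_upd a e b c : upd (upd a e b) e c = upd a e c.
Proof. by apply/ffunP => i; rewrite !ffunE; case: eqP. Qed.

Lemma updC a e e' b c : e != e' ->
  upd (upd a e b) e' c = upd (upd a e' c) e b.
Proof.
move=> /negPf ne; apply/ffunP => i; rewrite !ffunE.
by case: (eqVneq i e') => // ->; rewrite eq_sym ne.
Qed.

Lemma upd_id a e : upd a e (a e) = a.
Proof. by apply/ffunP => i; rewrite ffunE; case: eqP => // ->. Qed.

Lemma wgt_ge0 a : 0 <= wgt a.
Proof.
by apply: prodr_ge0 => i _; case/andP: (p01 i) => p0 p1; case: (a i);
  rewrite ?subr_ge0.
Qed.

Lemma wgt_sum : \sum_a wgt a = 1.
Proof.
rewrite /wgt -(bigA_distr_bigA (fun i b => if b then p i else 1 - p i)).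
by rewrite big1 // => i _; rewrite big_bool /= addrC subrK.
Qed.

Lemma eq_Ex f g : f =1 g -> Ex f = Ex g.
Proof. by move=> fg; apply: eq_bigr => a _; rewrite fg. Qed.

Lemma ExD f g : Ex (fun a => f a + g a) = Ex f + Ex g.
Proof. by rewrite -big_split /=; apply: eq_bigr => a _; rewrite mulrDr. Qed.

Lemma ExZ c f : Ex (fun a => c * f a) = c * Ex f.
Proof. by rewrite mulr_sumr; apply: eq_bigr => a _; rewrite mulrCA. Qed.

Lemma ExN f : Ex (fun a => - f a) = - Ex f.
Proof. by rewrite -sumrN; apply: eq_bigr => a _; rewrite mulrN. Qed.

Lemma ExB f g : Ex (fun a => f a - g a) = Ex f - Ex g.
Proof. by rewrite ExD ExN. Qed.

Lemma Ex_cst c : Ex (fun=> c) = c.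
Proof. by rewrite /Ex -mulr_suml wgt_sum mul1r. Qed.

Lemma Ex_sum (J : Type) (s : seq J) (P : pred J) (F : J -> cfg -> R) :
  Ex (fun a => \sum_(j <- s | P j) F j a) = \sum_(j <- s | P j) Ex (F j).
Proof.
rewrite /Ex exchange_big /=; apply: eq_bigr => a _; by rewrite mulr_sumr.
Qed.

Lemma le_Ex f g : (forall a, f a <= g a) -> Ex f <= Ex g.
Proof. by move=> fg; apply: ler_sum => a _; rewrite ler_wpM2l ?wgt_ge0. Qed.

Lemma Ex_ge0 f : (forall a, 0 <= f a) -> 0 <= Ex f.
Proof. by move=> f0; apply: sumr_ge0 => a _; rewrite mulr_ge0 ?wgt_ge0. Qed.

Lemma ler_norm_Ex f : `|Ex f| <= Ex (fun a => `|f a|).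
Proof.
apply: le_trans (ler_norm_sum _ _ _) _; apply: ler_sum => a _.
by rewrite normrM (ger0_norm (wgt_ge0 a)).
Qed.

Lemma Ex_sqrB f c :
  Ex (fun a => (f a - c) ^+ 2) = Ex (fun a => f a ^+ 2) - 2 * c * Ex f + c ^+ 2.
Proof.
rewrite -ExZ -ExB -[X in _ + X]Ex_cst -ExD; apply: eq_Ex => a; ring.
Qed.

Lemma Ex_sqr_le f : Ex f ^+ 2 <= Ex (fun a => f a ^+ 2).
Proof.
have : 0 <= Ex (fun a => (f a - Ex f) ^+ 2) by apply: Ex_ge0 => a; exact: sqr_ge0.
rewrite Ex_sqrB; nra.
Qed.

Lemma wgt_upd a e b :
  wgt (upd a e b) = (if b then p e else 1 - p e) *
    \prod_(i | i != e) (if a i then p i else 1 - p i).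
Proof.
rewrite /wgt (bigD1 e) //= updE eqxx; congr (_ * _).
by apply: eq_bigr => i /negPf ie; rewrite updE ie.
Qed.

Lemma Ex_avg e f : Ex (avg e f) = Ex f.
Proof.
(* flipping the bit e pairs the two values of every other configuration *)
pose fl a := upd a e (~~ a e).
have flK : involutive fl.
  by move=> a; rewrite /fl updE eqxx upd_upd negbK upd_id.
have half g : \sum_a g a = \sum_(a : cfg | a e) (g a + g (upd a e false)).
  rewrite (bigID (fun a : cfg => a e)) /= big_split /=; congr (_ + _).
  rewrite (reindex_inj (inv_inj flK)) /=.
  apply: eq_big => [a|a]; first by rewrite /fl updE eqxx negbK.
  by rewrite /fl updE eqxx negbK => ->.
rewrite /Ex !half; apply: eq_bigr => a ae.
have <- : upd a e true = a by rewrite -ae upd_id.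
by rewrite /avg !upd_upd !wgt_upd; ring.
Qed.

Lemma Ex_mul_avg e f : Ex (fun a => (a e)%:R * f a) =
  p e * Ex (fun a => f (upd a e true)).
Proof.
rewrite -(Ex_avg e) -ExZ; apply: eq_Ex => a.
by rewrite /avg !updE eqxx mul1r mul0r mulr0 addr0.
Qed.

Lemma Ex_mulN_avg e f : Ex (fun a => (1 - (a e)%:R) * f a) =
  (1 - p e) * Ex (fun a => f (upd a e false)).
Proof.
rewrite -(Ex_avg e) -ExZ; apply: eq_Ex => a.
by rewrite /avg !updE eqxx /=; ring.
Qed.

(** Integration by parts for a Bernoulli bit, E[(X - p) g(X)] = p (1 - p) (g(1) -
    g(0)), with the other bits averaged out. It plays the part of E[W f(W)] =
    E[f'(W)] for a Gaussian W. *)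
Lemma Ex_ibp e f : Ex (fun a => ((a e)%:R - p e) * f a) =
  p e * (1 - p e) * Ex (flip_diff e f).
Proof.
rewrite -(Ex_avg e) -ExZ; apply: eq_Ex => a.
by rewrite /avg /flip_diff !updE eqxx /=; ring.
Qed.

(** Averaging out one bit after the other leads from f to its mean; the Efron-Stein
    inequality sums what the steps lose. *)
Fixpoint avgs (s : seq I) f := if s is e :: s' then avg e (avgs s' f) else f.

Lemma Ex_avgs s f : Ex (avgs s f) = Ex f.
Proof. by elim: s => //= e s IH; rewrite Ex_avg. Qed.

Lemma avgs_upd s f a e b : e \in s -> avgs s f (upd a e b) = avgs s f a.
Proof.
elim: s a => //= e' s IH a; rewrite inE.
case: (eqVneq e e') => [-> _|ne /= es]; rewrite /avg ?upd_upd //.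
by rewrite !(updC _ _ _ ne) !IH.
Qed.

(** Once every bit is averaged out the function is constant, and averaging
    preserves the mean. *)
Lemma avgs_enum f a : avgs (enum I) f a = Ex f.
Proof.
rewrite -(Ex_avgs (enum I)) -[LHS]Ex_cst; apply: eq_Ex => a'.
have -> : a' = foldr (fun e x => upd x e (a' e)) a (enum I).
  apply/ffunP => i.
  suff -> : forall s, foldr (fun e x => upd x e (a' e)) a s i =
      if i \in s then a' i else a i by rewrite mem_enum.
  elim=> //= e s IH; rewrite updE inE IH; by case: eqP => [->|].
suff H : forall s, {subset s <= enum I} -> avgs (enum I) f a =
  avgs (enum I) f (foldr (fun e x => upd x e (a' e)) a s) by exact: H.
elim=> //= e s IH sub.
rewrite avgs_upd ?sub ?mem_head // -IH // => i si.
by rewrite sub // inE si orbT.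
Qed.

Lemma flip_diff_avgs s f e : e \notin s -> flip_diff e (avgs s f) =1 avgs s (flip_diff e f).
Proof.
elim: s => //= e' s IH; rewrite inE negb_or => /andP[ne es] a.
rewrite /flip_diff /avg !(updC _ _ _ ne) -!(IH es) /flip_diff; ring.
Qed.

Lemma avg_sqr_le e f a : avg e f a ^+ 2 <= avg e (fun a => f a ^+ 2) a.
Proof.
rewrite /avg; case/andP: (p01 e) => p0 p1.
set x := f _; set y := f _.
(* the gap is the variance p e (1 - p e) (x - y) ^ 2 of a two-point variable *)
have := mulr_ge0 (mulr_ge0 p0 (_ : 0 <= 1 - p e)) (sqr_ge0 (x - y)).
rewrite subr_ge0 => /(_ p1); nra.
Qed.

Lemma Ex_avgs_sqr_le s f : Ex (fun a => avgs s f a ^+ 2) <= Ex (fun a => f a ^+ 2).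
Proof.
elim: s => //= e s IH; apply: le_trans IH.
rewrite -[leRHS](Ex_avg e); apply: le_Ex => a; exact: avg_sqr_le.
Qed.

(** Averaging out a further bit e from the function g obtained so far lowers the
    second moment by p e (1 - p e) times that of flip_diff e g. As averaging
    commutes with flip_diff e and contracts second moments, g can be replaced by f
    in this loss. *)
Lemma efron_stein_seq s f : uniq s ->
  Ex (fun a => f a ^+ 2) - Ex (fun a => avgs s f a ^+ 2) <=
  \sum_(e <- s) p e * (1 - p e) * Ex (fun a => flip_diff e f a ^+ 2).
Proof.
elim: s => [_|e s IH /= /andP[es us]] /=; first by rewrite subrr big_nil.
rewrite big_cons; have := IH us; rewrite !lerBlDr => h.
apply: le_trans h _; rewrite [X in _ <= X + _]addrC -addrA lerD2l.
set g := avgs s f.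
have -> : Ex (fun a => g a ^+ 2) = Ex (fun a => avg e g a ^+ 2) +
    p e * (1 - p e) * Ex (fun a => flip_diff e g a ^+ 2).
  rewrite -[LHS](Ex_avg e) -ExZ -ExD; apply: eq_Ex => a.
  by rewrite /avg /flip_diff; ring.
rewrite [leLHS]addrC lerD2r ler_wpM2l //.
  by case/andP: (p01 e) => p0 p1; rewrite mulr_ge0 ?subr_ge0.
under eq_Ex do rewrite flip_diff_avgs //.
exact: Ex_avgs_sqr_le.
Qed.

(** The variance is at most the sum over the bits of the mean conditional
    variances. *)
Theorem efron_stein f :
  Ex (fun a => (f a - Ex f) ^+ 2) <=
  \sum_e p e * (1 - p e) * Ex (fun a => flip_diff e f a ^+ 2).
Proof.
have := efron_stein_seq f (enum_uniq I); rewrite big_enum /=; apply: le_trans.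
under [X in _ <= _ - X]eq_Ex do rewrite avgs_enum.
by rewrite Ex_sqrB Ex_cst; nra.
Qed.

End BernoulliProduct.

(** * The random graph as an array of bits *)

Section RandomGraph.
Context {R : realFieldType} {n : nat} (p : R).
Implicit Types (u v i j k : 'I_n).

(** An edge is stored at the pair of its ends in increasing order (edge_key). The
    other bits are never read by adj, and edge_p makes them almost surely false. *)
Definition graph := {ffun 'I_n * 'I_n -> bool}.
Implicit Types (a : graph) (f g : graph -> R).

Definition edge_key u v : 'I_n * 'I_n := if (u < v)%N then (u, v) else (v, u).
Definition edge_p (e : 'I_n * 'I_n) : R := if (e.1 < e.2)%N then p else 0.
Definition adj a u v : bool := (u != v) && a (edge_key u v).
Definition xe a u v : R := (adj a u v)%:R.
Definition ye a u v : R := xe a u v - p * (u != v)%:R.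
Definition set_edge a u v b : graph := upd a (edge_key u v) b.
Definition EG f := Ex edge_p f.
Definition del u v f : graph -> R := fun a =>
  f (set_edge a u v true) - f (set_edge a u v false).
(** The increment of the adjacency matrix when the edge u v appears. *)
Definition unit_edge u v i j : R :=
  (i == u)%:R * (j == v)%:R + (i == v)%:R * (j == u)%:R.
Definition ignores u v f := forall a b, f (set_edge a u v b) = f a.

Lemma edge_keyC u v : edge_key u v = edge_key v u.
Proof. by rewrite /edge_key; case: ltngtP => // /val_inj ->. Qed.

Lemma eq_edge_key u v i j :
  (edge_key i j == edge_key u v) = ((i == u) && (j == v)) || ((i == v) && (j == u)).
Proof.
rewrite /edge_key; case: (ltnP i j) => ij; case: (ltnP u v) => uv;
  rewrite xpair_eqE -!val_eqE /=; lia.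
Qed.

Lemma edge_p_edge_key u v : u != v -> edge_p (edge_key u v) = p.
Proof.
rewrite /edge_p /edge_key -val_eqE /=; by case: (ltngtP u v) => uv //= _;
  rewrite uv.
Qed.

Lemma xeC a u v : xe a u v = xe a v u.
Proof. by rewrite /xe /adj edge_keyC eq_sym. Qed.

Lemma yeC a u v : ye a u v = ye a v u.
Proof. by rewrite /ye xeC eq_sym. Qed.

Lemma xe_diag a u : xe a u u = 0.
Proof. by rewrite /xe /adj eqxx. Qed.

Lemma ye_diag a u : ye a u u = 0.
Proof. by rewrite /ye xe_diag eqxx mulr0 subrr. Qed.

Lemma xe_ge0 a u v : 0 <= xe a u v. Proof. exact: ler0n. Qed.

Lemma xe_le1 a u v : xe a u v <= 1. Proof. by rewrite /xe; case: adj. Qed.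

Lemma set_edgeC a u v b : set_edge a u v b = set_edge a v u b.
Proof. by rewrite /set_edge edge_keyC. Qed.

Lemma set_set_edge a u v b c : set_edge (set_edge a u v b) u v c = set_edge a u v c.
Proof. exact: upd_upd. Qed.

Lemma xe_set_same a u v b : u != v -> xe (set_edge a u v b) u v = b%:R.
Proof. by move=> uv; rewrite /xe /adj /set_edge uv updE eqxx. Qed.

Lemma xe_set_neq a u v b i j :
  ~~ (((i == u) && (j == v)) || ((i == v) && (j == u))) ->
  xe (set_edge a u v b) i j = xe a i j.
Proof. by rewrite -eq_edge_key /xe /adj /set_edge updE => /negPf ->. Qed.

Lemma ye_set_neq a u v b i j :
  ~~ (((i == u) && (j == v)) || ((i == v) && (j == u))) ->
  ye (set_edge a u v b) i j = ye a i j.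
Proof. by move=> h; rewrite /ye xe_set_neq. Qed.

Lemma unit_edgeE u v i j : u != v -> unit_edge u v i j =
  (((i == u) && (j == v)) || ((i == v) && (j == u)))%:R.
Proof.
move=> uv; have : ~~ ((i == u) && (i == v)).
  by apply: contra uv => /andP[/eqP <- /eqP <-].
rewrite /unit_edge; case: (i == u); case: (i == v); case: (j == v);
  by case: (j == u) => //= _; rewrite ?mulr1 ?mulr0 ?addr0 ?add0r.
Qed.

Lemma xe_set1 a u v i j : u != v -> xe (set_edge a u v true) i j =
  xe (set_edge a u v false) i j + unit_edge u v i j.
Proof.
move=> uv; rewrite unit_edgeE // -eq_edge_key /xe /adj /set_edge !updE.
case: (eqVneq (edge_key i j) (edge_key u v)) => [e|_] /=; last by rewrite addr0.
have -> : i != j; last by rewrite add0r.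
by apply: contraTneq uv => ij; move: e => /eqP; rewrite ij eq_edge_key =>
  /orP[]/andP[/eqP <- /eqP <-]; rewrite eqxx.
Qed.

Lemma ye_set1 a u v i j : u != v -> ye (set_edge a u v true) i j =
  ye (set_edge a u v false) i j + unit_edge u v i j.
Proof. by move=> uv; rewrite /ye xe_set1 // addrAC. Qed.

Lemma xe_set0_le a u v i j : xe (set_edge a u v false) i j <= xe a i j.
Proof.
rewrite /xe /adj /set_edge updE; by case: (edge_key i j == edge_key u v); rewrite ?andbF.
Qed.

Hypothesis p01 : 0 <= p <= 1.

Lemma edge_p01 e : 0 <= edge_p e <= 1.
Proof. by rewrite /edge_p; case: ifP => // _; rewrite lexx ler01. Qed.

Lemma ye_norm_le1 a u v : `|ye a u v| <= 1.
Proof.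
move: p01 => /andP[p0 p1]; rewrite /ye /xe /adj; case: eqP => _ /=;
  first by rewrite mulr0 subr0 normr0.
by case: (a _); rewrite /= ?mulr1n ?mulr0n mulr1 ler_norml; apply/andP; split; lra.
Qed.

Lemma ye_norm_le a u v : `|ye a u v| <= xe a u v + p.
Proof.
move: p01 => /andP[p0 p1]; rewrite /ye (le_trans (ler_normB _ _))//.
rewrite (ger0_norm (xe_ge0 _ _ _)) lerD2l normrM (ger0_norm p0).
by case: eqP => _; rewrite ?normr1 ?normr0 ?mulr1 ?mulr0.
Qed.

Lemma EG_xe u v f : u != v ->
  EG (fun a => xe a u v * f a) = p * EG (fun a => f (set_edge a u v true)).
Proof.
move=> uv; rewrite /EG; have := Ex_mul_avg edge_p (edge_key u v) f; rewrite (edge_p_edge_key uv) => <-.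
by apply: eq_Ex => a; rewrite /xe /adj uv.
Qed.

Lemma EG_xeN u v f : u != v -> EG (fun a => (1 - xe a u v) * f a) =
  (1 - p) * EG (fun a => f (set_edge a u v false)).
Proof.
move=> uv; rewrite /EG; have := Ex_mulN_avg edge_p (edge_key u v) f; rewrite (edge_p_edge_key uv) => <-.
by apply: eq_Ex => a; rewrite /xe /adj uv.
Qed.

Lemma EG_ye u v f : u != v ->
  EG (fun a => ye a u v * f a) = p * (1 - p) * EG (del u v f).
Proof.
move=> uv; rewrite /EG; have := Ex_ibp edge_p (edge_key u v) f; rewrite (edge_p_edge_key uv) => <-.
by apply: eq_Ex => a; rewrite /ye /xe /adj uv mulr1.
Qed.

Lemma EG_xe_ignores u v f : u != v -> ignores u v f ->
  EG (fun a => xe a u v * f a) = p * EG f.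
Proof. by move=> uv h; rewrite EG_xe //; congr (_ * _); apply: eq_Ex => a. Qed.

Lemma EG_ye_ignores u v f : u != v -> ignores u v f ->
  EG (fun a => ye a u v * f a) = 0.
Proof.
move=> uv h; rewrite EG_ye // -[RHS](mulr0 (p * (1 - p))); congr (_ * _).
rewrite -(Ex_cst edge_p 0); apply: eq_Ex => a.
by rewrite /del !h subrr.
Qed.

Lemma EG_ye_sqr_ignores u v f : u != v -> ignores u v f ->
  EG (fun a => ye a u v ^+ 2 * f a) = p * (1 - p) * EG f.
Proof.
move=> uv h.
rewrite -[LHS]/(EG (fun a => ye a u v ^+ 2 * f a)).
have -> : EG (fun a => ye a u v ^+ 2 * f a) =
    EG (fun a => ye a u v * (ye a u v * f a)).
  by apply: eq_Ex => a; rewrite mulrA.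
rewrite EG_ye //; congr (_ * _); apply: eq_Ex => a.
by rewrite /del !h /ye !xe_set_same // uv /=; ring.
Qed.

(** The sum runs over ordered pairs, so that every edge counts twice; this and
    dropping 1 - p <= 1 only cost constants and keep the sums symmetric. *)
Lemma efron_stein_graph f :
  EG (fun a => (f a - EG f) ^+ 2) <=
  p * \sum_u \sum_(v | u != v) EG (fun a => del u v f a ^+ 2).
Proof.
apply: le_trans (efron_stein edge_p01 f) _.
rewrite pair_big_dep mulr_sumr /=.
move: (p01) => /andP[p0 p1].
rewrite [leRHS]big_mkcond /=; apply: ler_sum => -[u v] _ /=.
rewrite {1 2}/edge_p /= -val_eqE /=; case: (ltngtP u v) => uv /=; rewrite ?mul0r //;
  last first.
  by rewrite mulr_ge0 // Ex_ge0 // => [e|a]; [exact: edge_p01|exact: sqr_ge0].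
rewrite -mulrA ler_wpM2l // /EG.
have -> : del u v f = flip_diff (u, v) f.
  by apply: boolp.funext => a; rewrite /del /set_edge /edge_key uv.
set z := Ex _ _; have : 0 <= z.
  by apply: (Ex_ge0 edge_p01) => a; exact: sqr_ge0.
nra.
Qed.

End RandomGraph.

(** * Counts of 2-paths and triangles, raw and centred *)

Section GraphStatistics.
Context {R : realFieldType} {n : nat} (p : R).
Implicit Types (u v i j k : 'I_n) (a : @graph n).
Local Notation x0 a u v := (xe (R := R) (set_edge a u v false)).
Local Notation y0 a u v := (ye p (set_edge a u v false)).
Local Notation E := (unit_edge (R := R)).

Definition deg a v : R := \sum_k xe a v k.
(** The codegree, or number of common neighbours. *)
Definition cod a u v : R := \sum_k xe a u k * xe a k v.
Definition paths a i : R := \sum_j \sum_k xe a i j * xe a j k * (i != k)%:R.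
Definition closed_paths a i : R := \sum_j \sum_k xe a i j * xe a j k * xe a k i.
Definition y_edges a : R := \sum_i \sum_j ye p a i j.
Definition y_paths a : R := \sum_i \sum_j \sum_k ye p a i j * ye p a j k * (i != k)%:R.
Definition y_triangles a : R := \sum_i \sum_j \sum_k ye p a i j * ye p a j k * ye p a k i.
Definition y_cod a u v : R := \sum_k ye p a u k * ye p a k v.
(** A centred degree of v, without the pair u v. *)
Definition y_deg_but a u v : R := \sum_k ye p a v k * (u != k)%:R.

Lemma sum_delta u (F : 'I_n -> R) : \sum_j (j == u)%:R * F j = F u.
Proof.
rewrite (bigD1 u) //= eqxx mul1r big1 ?addr0 // => j /negPf ->.
by rewrite mul0r.
Qed.

Lemma sum_delta2 i (F : 'I_n -> 'I_n -> R) :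
  \sum_u \sum_v (u == i)%:R * F u v = \sum_v F i v.
Proof.
under eq_bigr do rewrite -mulr_sumr.
by rewrite (sum_delta i (fun u => \sum_v F u v)).
Qed.

Lemma unit_edgeC u v i j : E u v i j = E u v j i.
Proof. by rewrite /unit_edge addrC mulrC [X in _ + X]mulrC. Qed.

Lemma sum_unit_edge u v i (F : 'I_n -> R) :
  \sum_j E u v i j * F j = (i == u)%:R * F v + (i == v)%:R * F u.
Proof.
rewrite -(sum_delta v F) -(sum_delta u F) !mulr_sumr -big_split /=.
by apply: eq_bigr => j _; rewrite /unit_edge mulrDl !mulrA.
Qed.

Lemma sum_unit_edgel u v j (F : 'I_n -> R) :
  \sum_i F i * E u v i j = (j == u)%:R * F v + (j == v)%:R * F u.
Proof.
by rewrite -sum_unit_edge; apply: eq_bigr => i _; rewrite mulrC unit_edgeC.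
Qed.

Lemma unit_edge_xe0 a u v i j : u != v -> E u v i j * x0 a u v i j = 0.
Proof.
move=> uv; rewrite unit_edgeE //.
case: (boolP (_ || _)) => [|_]; last by rewrite mul0r.
case/orP => /andP[/eqP -> /eqP ->]; last rewrite xeC;
  by rewrite xe_set_same // mulr0.
Qed.

(** Two consecutive steps along the same edge lead back to the start. *)
Lemma unit_edge_step u v i j k : u != v -> i != k -> E u v i j * E u v j k = 0.
Proof.
move=> uv ik; rewrite !unit_edgeE //.
case: (boolP ((i == u) && _ || _)) => [b1|_]; last by rewrite mul0r.
case: (boolP ((j == u) && _ || _)) => [c1|_]; last by rewrite mulr0.
by move: uv ik; case/orP: b1 => /andP[/eqP -> /eqP e];
  case/orP: c1 => /andP[/eqP e' /eqP ->]; rewrite -?e -?e' ?eqxx //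
  -?e' e ?eqxx.
Qed.

Lemma unit_edge_diag u v i : u != v -> E u v i i = 0.
Proof.
move=> uv; rewrite unit_edgeE //; case: (eqVneq i u) => [->|] /=;
  by rewrite ?(negPf uv) ?andbF.
Qed.

Lemma unit_edge_cycle u v i j k (z : 'I_n -> 'I_n -> R) : u != v ->
  (forall i, z i i = 0) -> E u v i j * E u v j k * z k i = 0.
Proof.
move=> uv z0; case: (eqVneq i k) => [->|ik]; first by rewrite z0 mulr0.
by rewrite unit_edge_step // mul0r.
Qed.

Lemma codC a u v : cod a u v = cod a v u.
Proof. by apply: eq_bigr => k _; rewrite mulrC xeC [xe _ u k]xeC. Qed.

(** A 2-path with distinct ends uses the edge u v at most once (unit_edge_step), so
    the increment is linear in unit_edge. *)
Lemma paths_set1 a u v i : u != v ->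
  paths (set_edge a u v true) i = paths (set_edge a u v false) i +
  ((i == u)%:R * deg (set_edge a u v false) v +
   (i == v)%:R * deg (set_edge a u v false) u + x0 a u v i u + x0 a u v i v).
Proof.
move=> uv; apply/eqP; rewrite addrC -subr_eq; apply/eqP.
rewrite -addrA -sum_unit_edge.
have -> : x0 a u v i u + x0 a u v i v =
    \sum_j x0 a u v i j * \sum_k E u v j k * 1.
  under eq_bigr do rewrite sum_unit_edge !mulr1 mulrDr mulrC [X in _ + X]mulrC.
  by rewrite big_split /= !sum_delta addrC.
rewrite -!sumrB -big_split /=; apply: eq_bigr => j _.
rewrite !mulr_sumr -!sumrB -big_split /=; apply: eq_bigr => k _.
rewrite !xe_set1 // mulr1.
have expand (A e B e' : R) : (A + e) * (B + e') - A * B = e * B + A * e' + e * e'.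
  by ring.
have h1 := unit_edge_xe0 a i j uv; have h2 := unit_edge_xe0 a j k uv.
case: (eqVneq i k) => [ik|ik] /=; last first.
  have h3 := unit_edge_step j uv ik.
  by rewrite !mulr1 expand h3 addr0.
rewrite -ik [xe _ j i]xeC h1 (unit_edgeC u v j i) [x0 a u v i j * E _ _ _ _]mulrC h1.
by rewrite !mulr0 subrr addr0.
Qed.

(** A triangle uses the edge u v at most once, so only the terms linear in
    unit_edge survive in the expanded product. *)
Lemma closed_paths_set1 a u v i : u != v ->
  closed_paths (set_edge a u v true) i = closed_paths (set_edge a u v false) i +
  2 * (((i == u)%:R + (i == v)%:R) * cod (set_edge a u v false) u v +
       x0 a u v i u * x0 a u v i v).
Proof.
move=> uv; apply/eqP; rewrite addrC -subr_eq; apply/eqP.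
have -> : closed_paths (set_edge a u v true) i - closed_paths (set_edge a u v false) i =
   \sum_j E u v i j * (\sum_k x0 a u v j k * x0 a u v k i) +
   \sum_j x0 a u v i j * (\sum_k E u v j k * x0 a u v k i) +
   \sum_k (\sum_j x0 a u v i j * x0 a u v j k) * E u v k i.
  under [X in _ + _ + X]eq_bigr do rewrite mulr_suml.
  rewrite [X in _ + _ + X]exchange_big /= -sumrB -!big_split /=.
  apply: eq_bigr => j _; rewrite !mulr_sumr -sumrB -!big_split /=.
  apply: eq_bigr => k _; rewrite !xe_set1 //.
  have xd l : x0 a u v l l = 0 by exact: xe_diag.
  have h1 := unit_edge_cycle i j k uv xd.
  have h2 := unit_edge_cycle j k i uv xd.
  have h3 := unit_edge_cycle k i j uv xd.
  have h4 := unit_edge_cycle i j k uv (fun l => unit_edge_diag l uv).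
  have expand (A B C e f g : R) : (A + e) * (B + f) * (C + g) - A * B * C =
    e * (B * C) + A * (f * C) + A * B * g +
    (e * f * C + f * g * A + g * e * B + e * f * g) by ring.
  by rewrite expand h1 h2 h3 h4 !addr0.
rewrite sum_unit_edge sum_unit_edgel.
have -> : \sum_j x0 a u v i j * (\sum_k E u v j k * x0 a u v k i) =
    2 * (x0 a u v i u * x0 a u v i v).
  under eq_bigr do rewrite sum_unit_edge mulrDr mulrCA [X in _ + X]mulrCA.
  rewrite big_split /= !sum_delta [xe _ v i]xeC [xe _ u i]xeC.
  by rewrite [X in _ + X]mulrC mulr_natl mulr2n.
have co w t : (i == w)%:R * (\sum_k x0 a u v t k * x0 a u v k i) =
    (i == w)%:R * cod (set_edge a u v false) t w.
  by case: (eqVneq i w) => [->|_] //; rewrite !mul0r.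
have co' w t : (i == w)%:R * (\sum_k x0 a u v i k * x0 a u v k t) =
    (i == w)%:R * cod (set_edge a u v false) w t.
  by case: (eqVneq i w) => [->|_] //; rewrite !mul0r.
rewrite !co !co' [cod _ v u]codC.
move: (cod _ _ _) (x0 _ _ _ _ _ * _) => c d; ring.
Qed.

Lemma sum2_unit_edge u v (F : 'I_n -> 'I_n -> R) :
  \sum_i \sum_j E u v i j * F i j = F u v + F v u.
Proof.
under eq_bigr do rewrite sum_unit_edge.
by rewrite big_split /= !sum_delta.
Qed.

Lemma y_edges_del u v a : u != v ->
  y_edges (set_edge a u v true) - y_edges (set_edge a u v false) = 2.
Proof.
move=> uv; rewrite -sumrB.
transitivity (\sum_i \sum_j E u v i j * 1).
  apply: eq_bigr => i _; rewrite -sumrB; apply: eq_bigr => j _.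
  by rewrite ye_set1 // addrAC subrr add0r mulr1.
by rewrite (sum2_unit_edge u v (fun _ _ => 1)) /=; ring.
Qed.

Lemma y_paths_del u v a : u != v ->
  y_paths (set_edge a u v true) - y_paths (set_edge a u v false) =
  2 * (y_deg_but (set_edge a u v false) u v + y_deg_but (set_edge a u v false) v u).
Proof.
move=> uv; set b := set_edge a u v false.
transitivity (\sum_i \sum_j E u v i j * (\sum_k ye p b j k * (i != k)%:R) +
  \sum_j \sum_k E u v j k * (\sum_i ye p b i j * (i != k)%:R)).
  have -> : \sum_j \sum_k E u v j k * (\sum_i ye p b i j * (i != k)%:R) =
     \sum_i \sum_j \sum_k E u v j k * (ye p b i j * (i != k)%:R).
    rewrite [RHS]exchange_big /=; apply: eq_bigr => j _.
    by rewrite [RHS]exchange_big /=; apply: eq_bigr => k _; rewrite mulr_sumr.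
  rewrite -sumrB -big_split /=; apply: eq_bigr => i _.
  rewrite -sumrB -big_split /=; apply: eq_bigr => j _.
  rewrite mulr_sumr -sumrB -big_split /=; apply: eq_bigr => k _.
  rewrite !ye_set1 // -/b; case: (eqVneq i k) => [_|ik].
    by rewrite !mulr0 subrr addr0.
  have expand (A B e f : R) : (A + e) * (B + f) - A * B = e * B + f * A + e * f.
    by ring.
  by rewrite !mulr1 expand (unit_edge_step j uv ik) addr0.
rewrite !sum2_unit_edge /y_deg_but.
have yc i j : \sum_k ye p b k j * (k != i)%:R = \sum_k ye p b j k * (i != k)%:R.
  by apply: eq_bigr => k _; rewrite yeC eq_sym.
rewrite !yc; ring.
Qed.

Lemma sum_cycle (A B C : 'I_n -> 'I_n -> R) :
  \sum_i \sum_j \sum_k A i j * B j k * C k i =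
  \sum_i \sum_j \sum_k B i j * C j k * A k i.
Proof.
rewrite exchange_big /=; apply: eq_bigr => j _.
rewrite exchange_big /=; apply: eq_bigr => k _.
by apply: eq_bigr => i _; rewrite mulrAC mulrC mulrA [RHS]mulrAC.
Qed.

Lemma y_codC a u v : y_cod a u v = y_cod a v u.
Proof. by apply: eq_bigr => k _; rewrite mulrC yeC [ye _ _ u k]yeC. Qed.

(** By cyclic symmetry the three terms linear in unit_edge coincide. *)
Lemma y_triangles_del u v a : u != v ->
  y_triangles (set_edge a u v true) - y_triangles (set_edge a u v false) =
  6 * y_cod (set_edge a u v false) u v.
Proof.
move=> uv; set b := set_edge a u v false.
pose T (A B C : 'I_n -> 'I_n -> R) := \sum_i \sum_j \sum_k A i j * B j k * C k i.
have TE : T (E u v) (ye p b) (ye p b) = 2 * y_cod b u v.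
  transitivity (\sum_i \sum_j E u v i j * y_cod b j i).
    apply: eq_bigr => i _; apply: eq_bigr => j _; rewrite mulr_sumr.
    by apply: eq_bigr => k _; rewrite mulrA.
  by rewrite sum2_unit_edge [y_cod b v u]y_codC mulr_natl mulr2n.
transitivity (T (E u v) (ye p b) (ye p b) + T (ye p b) (E u v) (ye p b) +
    T (ye p b) (ye p b) (E u v)); last first.
  have cyc A B C : T A B C = T B C A by exact: sum_cycle.
  rewrite [T (ye p b) (E u v) _]cyc [T (ye p b) (ye p b) _]cyc.
  rewrite [T (ye p b) (E u v) _]cyc TE; move: (y_cod _ _ _) => c; ring.
rewrite /T -sumrB -!big_split /=; apply: eq_bigr => i _.
rewrite -sumrB -!big_split /=; apply: eq_bigr => j _.
rewrite -sumrB -!big_split /=; apply: eq_bigr => k _; rewrite !ye_set1 // -/b.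
have yd l : ye p b l l = 0 by exact: ye_diag.
have h1 := unit_edge_cycle i j k uv yd.
have h2 := unit_edge_cycle j k i uv yd.
have h3 := unit_edge_cycle k i j uv yd.
have h4 := unit_edge_cycle i j k uv (fun l => unit_edge_diag l uv).
have expand (A B C e f g : R) : (A + e) * (B + f) * (C + g) - A * B * C =
    e * B * C + A * f * C + A * B * g +
    (e * f * C + f * g * A + g * e * B + e * f * g) by ring.
by rewrite expand h1 h2 h3 h4 !addr0.
Qed.

Lemma y_cod_del i j u v a : i != j -> u != v ->
  y_cod (set_edge a u v true) i j - y_cod (set_edge a u v false) i j =
  (i == u)%:R * y0 a u v v j + (i == v)%:R * y0 a u v u j +
  ((j == u)%:R * y0 a u v i v + (j == v)%:R * y0 a u v i u).
Proof.
move=> ij uv.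
rewrite -(sum_unit_edge u v i (fun k => y0 a u v k j)).
rewrite -(sum_unit_edgel u v j (fun k => y0 a u v i k)) -sumrB -big_split /=.
apply: eq_bigr => k _; rewrite !ye_set1 //.
have expand (A B e f : R) : (A + e) * (B + f) - A * B = e * B + A * f + e * f.
  by ring.
by rewrite expand (unit_edge_step k uv ij) addr0.
Qed.

Lemma y_cod_ignores u v : u != v -> ignores u v (fun a => y_cod a u v).
Proof.
move=> uv a b; apply: eq_bigr => k _.
case: (eqVneq k u) => [->|ku]; first by rewrite !ye_diag !mul0r.
case: (eqVneq k v) => [->|kv]; first by rewrite !ye_diag !mulr0.
by rewrite !ye_set_neq // ?(negPf ku) ?(negPf kv) ?andbF //=
  ?(negPf uv) ?andbF // orbF andbC (negPf kv).
Qed.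

Lemma deg_set0_le a u v w : deg (set_edge a u v false) w <= deg a w.
Proof. by apply: ler_sum => k _; exact: xe_set0_le. Qed.

Lemma cod_set0_le a u v i j : cod (set_edge a u v false) i j <= cod a i j.
Proof.
by apply: ler_sum => k _; apply: ler_pM; rewrite ?xe_ge0 ?xe_set0_le.
Qed.

Lemma sum_ones_neq i j : i != j ->
  \sum_k (i != k)%:R * (k != j)%:R = n%:R - 2 :> R.
Proof.
move=> ij.
have -> : \sum_k (i != k)%:R * (k != j)%:R = \sum_(k < n) 1 -
    \sum_k (k == i)%:R * 1 - \sum_k (k == j)%:R * 1 :> R.
  rewrite -!sumrB; apply: eq_bigr => k _; rewrite !mulr1.
  rewrite [i == k]eq_sym; case: (eqVneq k i) => [->|_] /=.
    by rewrite (negPf ij) mul0r subrr subr0.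
  by case: (k == j); rewrite /= ?mulr0 ?mulr1 ?subr0 ?subrr.
by rewrite !sum_delta sumr_const card_ord -mulr_natl mulr1; ring.
Qed.

(** The left side is the sum of x_ij x_jk y_ki, where y is the centred adjacency
    matrix. Expand x = y + p J with J the matrix of ones off the diagonal: the two
    quadratic terms each give p * y_paths, and the linear term sees the n - 2
    choices of the third node. No constant term remains, because one factor is
    centred already. *)
Lemma centered_expansion a :
  \sum_i closed_paths a i - p * \sum_i paths a i =
  y_triangles a + 2 * p * y_paths a + p ^+ 2 * (n%:R - 2) * y_edges a.
Proof.
pose J i j : R := (i != j)%:R.
pose T (A B C : 'I_n -> 'I_n -> R) := \sum_i \sum_j \sum_k A i j * B j k * C k i.
have cyc A B C : T A B C = T B C A by exact: sum_cycle.
have JC i j : J i j = J j i by rewrite /J eq_sym.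
have yp : y_paths a = T J (ye p a) (ye p a).
  rewrite cyc; apply: eq_bigr => i _; apply: eq_bigr => j _.
  by apply: eq_bigr => k _; rewrite -/(J i k) JC.
have ye1 : (n%:R - 2) * y_edges a = T J J (ye p a).
  rewrite -cyc /y_edges mulr_sumr; apply: eq_bigr => i _.
  rewrite mulr_sumr; apply: eq_bigr => j _.
  case: (eqVneq i j) => [->|ij].
    by rewrite ye_diag mulr0 big1 // => k _; rewrite !mul0r.
  under eq_bigr do rewrite -mulrA.
  by rewrite -mulr_sumr mulrC sum_ones_neq // eq_sym.
have -> : \sum_i closed_paths a i - p * \sum_i paths a i = T (xe a) (xe a) (ye p a).
  rewrite mulr_sumr -sumrB; apply: eq_bigr => i _.
  rewrite mulr_sumr -sumrB; apply: eq_bigr => j _.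
  rewrite mulr_sumr -sumrB; apply: eq_bigr => k _.
  rewrite /ye eq_sym; move: (xe a i j) (xe a j k) (xe a k i) (_ != _)%:R => x y z t.
  by ring.
have -> : T (xe a) (xe a) (ye p a) = y_triangles a + p * T (ye p a) J (ye p a) +
    p * T J (ye p a) (ye p a) + p ^+ 2 * T J J (ye p a).
  rewrite !mulr_sumr -!big_split; apply: eq_bigr => i _ /=.
  rewrite !mulr_sumr -!big_split; apply: eq_bigr => j _ /=.
  rewrite !mulr_sumr -!big_split; apply: eq_bigr => k _ /=.
  have xE l m : xe a l m = ye p a l m + p * J l m by rewrite /ye subrK.
  rewrite !xE; move: (ye _ _ _ _) (ye _ _ _ _) (ye _ _ _ _) (J _ _) (J _ _) => x y z s t.
  by ring.
rewrite -ye1 -yp cyc -yp; move: (y_triangles a) (y_paths a) (y_edges a) => x y z.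
by ring.
Qed.

End GraphStatistics.

(** * Linearization of a ratio of counts *)

Section RatioLinearization.
Context {R : realFieldType}.
Implicit Types (p nu N D u v : R).

(** Keeping the number of 2-paths away from 0 makes its inverse Lipschitz on all
    graphs; on regular graphs the truncation is not active. *)
Definition trunc nu D : R := Num.max D (nu / 32).
(** A product of two fluctuations, those of the inverse count and of N - p D; this
    is why the linearization error is of second order. *)
Definition lin_err p nu N D : R :=
  (nu^-1 - (trunc nu D)^-1) * (N - p * trunc nu D).

Lemma ratio_linearization p nu N D : 0 < nu ->
  N / trunc nu D = (N - p * trunc nu D) / nu + p - lin_err p nu N D.
Proof.
move=> nu0; have T0 : 0 < trunc nu D by rewrite lt_max divr_gt0 ?orbT.
by rewrite /lin_err; field; rewrite !gt_eqF.
Qed.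

Lemma trunc_ge nu D : nu / 32 <= trunc nu D.
Proof. by rewrite le_max lexx orbT. Qed.

Lemma trunc_gt0 nu D : 0 < nu -> 0 < trunc nu D.
Proof. by move=> nu0; rewrite lt_max divr_gt0 ?orbT. Qed.

Lemma trunc_dist nu D : 0 < nu -> `|trunc nu D - nu| <= `|D - nu|.
Proof.
move=> nu0; rewrite /trunc; case: (lerP D (nu / 32)) => // h.
by rewrite !ler0_norm; lra.
Qed.

Lemma trunc_incr nu D u : 0 <= u ->
  0 <= trunc nu (D + u) - trunc nu D <= u.
Proof.
move=> u0; rewrite /trunc; case: (lerP D _) => h; case: (lerP (D + u) _) => h';
  apply/andP; split; lra.
Qed.

Lemma inv_trunc_le nu D : 0 < nu -> (trunc nu D)^-1 <= 32 / nu.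
Proof.
move=> nu0; rewrite -[leRHS]invrK lef_pV2 ?posrE ?trunc_gt0 // ?invr_gt0 ?divr_gt0 //.
by rewrite invf_div trunc_ge.
Qed.

(** When the counts move, the two factors of lin_err change in turn, and the factor
    that stays is bounded by deviations from the means nu and p nu, before or after
    the move. *)
Lemma lin_err_incr p nu N D u v : 0 < nu -> 0 <= p -> 0 <= u -> 0 <= v ->
  `|lin_err p nu (N + v) (D + u) - lin_err p nu N D| <=
  32 ^+ 2 / nu ^+ 2 * (`|D - nu| * v +
    (p * (`|D - nu| * u) +
     u * (`|N + v - p * nu| + p * `|D + u - nu|))).
Proof.
move=> nu0 p0 u0 v0.
have T0 := trunc_gt0 D nu0; have T1 := trunc_gt0 (D + u) nu0.
have /andP[d0 du] := trunc_incr nu D u0.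
have e0 := trunc_dist D nu0; have e1 := trunc_dist (D + u) nu0.
have i0 := inv_trunc_le D nu0; have i1 := inv_trunc_le (D + u) nu0.
rewrite /lin_err; move: (trunc nu D) (trunc nu (D + u)) T0 T1 d0 du e0 e1 i0 i1.
move=> S T S0 T0 d0 du e0 e1 i0 i1.
have nuV : 0 <= nu^-1 by rewrite invr_ge0 ltW.
have -> : (nu^-1 - T^-1) * (N + v - p * T) - (nu^-1 - S^-1) * (N - p * S) =
  (S - nu) * (nu^-1 * S^-1) * (v - p * (T - S)) +
  (T - S) * (S^-1 * T^-1) * (N + v - p * nu + p * (nu - T)).
  by field; rewrite !gt_eqF.
have A1 : `|(S - nu) * (nu^-1 * S^-1)| <= 32 / nu ^+ 2 * `|D - nu|.
  rewrite normrM mulrC (ger0_norm (mulr_ge0 nuV (ltW _))) ?invr_gt0 //.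
  apply: ler_pM => //; first by rewrite mulr_ge0 ?invr_ge0 ?ltW.
  have -> : 32 / nu ^+ 2 = nu^-1 * (32 / nu) by field; rewrite gt_eqF.
  by rewrite ler_wpM2l.
have A2 : `|(T - S) * (S^-1 * T^-1)| <= 32 ^+ 2 / nu ^+ 2 * u.
  rewrite normrM (ger0_norm d0) ger0_norm ?mulr_ge0 ?invr_ge0 ?(ltW S0) ?(ltW T0) //.
  rewrite mulrC; apply: ler_pM => //; first by rewrite mulr_ge0 ?invr_ge0 ?ltW.
  have -> : 32 ^+ 2 / nu ^+ 2 = 32 / nu * (32 / nu) by field; rewrite gt_eqF.
  by apply: ler_pM => //; rewrite invr_ge0 ltW.
have A3 : `|v - p * (T - S)| <= v + p * u.
  apply: le_trans (ler_normB _ _) _.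
  by rewrite (ger0_norm v0) lerD2l normrM !ger0_norm // ler_wpM2l.
have A4 : `|N + v - p * nu + p * (nu - T)| <= `|N + v - p * nu| + p * `|D + u - nu|.
  apply: le_trans (ler_normD _ _) _; rewrite lerD2l normrM (ger0_norm p0).
  by rewrite ler_wpM2l // distrC.
apply: le_trans (ler_normD _ _) _.
have B1 : 32 / nu ^+ 2 * `|D - nu| * (v + p * u) <=
   32 ^+ 2 / nu ^+ 2 * (`|D - nu| * v + p * (`|D - nu| * u)).
  have -> : 32 ^+ 2 / nu ^+ 2 * (`|D - nu| * v + p * (`|D - nu| * u)) =
     32 * (32 / nu ^+ 2 * `|D - nu| * (v + p * u)) by ring.
  rewrite ler_peMl ?ler1n // !mulr_ge0 ?addr_ge0 ?mulr_ge0 //.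
  by rewrite invr_ge0 sqr_ge0.
rewrite [X in _ <= _ * X]addrA [leRHS]mulrDr; apply: lerD.
  by apply: le_trans B1; rewrite normrM; apply: ler_pM.
by rewrite normrM [leRHS]mulrA; apply: ler_pM.
Qed.

(** Weighted Cauchy-Schwarz inequality. *)
Lemma sqr_sum_le (I : finType) (w z : I -> R) : (forall i, 0 <= w i) ->
  (\sum_i w i * z i) ^+ 2 <= (\sum_i w i) * \sum_i w i * z i ^+ 2.
Proof.
move=> w0.
(* the gap is half of the sum of w i * w j * (z i - z j) ^ 2 over i and j *)
have : 0 <= \sum_i \sum_j w i * w j * (z i - z j) ^+ 2.
  apply: sumr_ge0 => i _; apply: sumr_ge0 => j _.
  by rewrite mulr_ge0 ?sqr_ge0 ?mulr_ge0.
have -> : \sum_i \sum_j w i * w j * (z i - z j) ^+ 2 =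
    2 * ((\sum_i w i) * \sum_i w i * z i ^+ 2) - 2 * (\sum_i w i * z i) ^+ 2.
  set A := \sum_i w i; set B := \sum_i w i * z i ^+ 2; set C := \sum_i w i * z i.
  have -> : 2 * (A * B) - 2 * C ^+ 2 = A * B + B * A - (C * C + C * C) by ring.
  rewrite /A /B /C !big_distrlr /= -!big_split -sumrB; apply: eq_bigr => i _ /=.
  rewrite -!big_split -sumrB; apply: eq_bigr => j _ /=.
  by move: (w i) (w j) (z i) (z j) => a b c d; ring.
by rewrite subr_ge0 ler_pM2l // ltr0n.
Qed.

End RatioLinearization.

(** * Effect of one edge on the counts *)

Section EdgeIncrements.
Context {R : realFieldType} {n : nat} (p : R).
Implicit Types (u v i j k : 'I_n) (a : @graph n) (M K : R).
Local Notation x0 a u v := (xe (R := R) (set_edge a u v false)).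
Local Notation deg := (deg (R := R)).
Local Notation cod := (cod (R := R)).
Local Notation paths := (paths (R := R)).
Local Notation closed_paths := (closed_paths (R := R)).

(** The increments of paths_set1 and closed_paths_set1, which depend on the graph
    only outside the edge u v. *)
Definition paths_incr u v a i : R :=
  (i == u)%:R * deg (set_edge a u v false) v +
  (i == v)%:R * deg (set_edge a u v false) u + x0 a u v i u + x0 a u v i v.

Definition closed_incr u v a i : R :=
  2 * (((i == u)%:R + (i == v)%:R) * cod (set_edge a u v false) u v +
       x0 a u v i u * x0 a u v i v).

(** The mean number of 2-paths from a node (EG_paths). *)
Definition paths_mean : R := (n%:R - 1) * (n%:R - 2) * p ^+ 2.
Local Notation nu := paths_mean.

Definition lin_errs a : R :=
  \sum_i lin_err p nu (closed_paths a i) (paths a i).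

(** The bounds on degrees and codegrees that control all increments. They are used
    with the typical sizes M and K on regular graphs, and with n for both on all
    graphs (sparse_n). *)
Definition sparse M K a : Prop :=
  (forall u, deg a u <= M) /\ (forall u v, u != v -> cod a u v <= K).

Lemma deg_ge0 a u : 0 <= deg a u.
Proof. by apply: sumr_ge0 => k _; exact: xe_ge0. Qed.

Lemma cod_ge0 a u v : 0 <= cod a u v.
Proof. by apply: sumr_ge0 => k _; rewrite mulr_ge0 ?xe_ge0. Qed.

Lemma paths_incr_ge0 u v a i : 0 <= paths_incr u v a i.
Proof. by rewrite !addr_ge0 ?mulr_ge0 ?deg_ge0 ?xe_ge0 // ler0n. Qed.

Lemma closed_incr_ge0 u v a i : 0 <= closed_incr u v a i.
Proof.
by rewrite mulr_ge0 ?addr_ge0 ?mulr_ge0 ?addr_ge0 ?cod_ge0 ?xe_ge0 // ler0n.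
Qed.

Lemma paths_incr_set u v a b i : paths_incr u v (set_edge a u v b) i = paths_incr u v a i.
Proof. by rewrite /paths_incr set_set_edge. Qed.

Lemma closed_incr_set u v a b i :
  closed_incr u v (set_edge a u v b) i = closed_incr u v a i.
Proof. by rewrite /closed_incr set_set_edge. Qed.

Lemma sum_xer a v : \sum_i xe a i v = deg a v.
Proof. by apply: eq_bigr => i _; rewrite xeC. Qed.

Lemma sum_paths_incr u v a : \sum_i paths_incr u v a i =
  2 * (deg (set_edge a u v false) u + deg (set_edge a u v false) v).
Proof.
rewrite !big_split /= !sum_xer (sum_delta u (fun=> deg _ v)).
by rewrite (sum_delta v (fun=> deg _ u)); ring.
Qed.

Lemma sum_closed_incr u v a : \sum_i closed_incr u v a i =
  6 * cod (set_edge a u v false) u v.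
Proof.
rewrite -mulr_sumr big_split /=.
under eq_bigr do rewrite mulrDl.
rewrite big_split /= (sum_delta u (fun=> cod _ u v)) (sum_delta v (fun=> cod _ u v)).
have -> : \sum_i x0 a u v i u * x0 a u v i v = cod (set_edge a u v false) u v.
  by apply: eq_bigr => i _; rewrite xeC.
by move: (cod _ _ _) => c; ring.
Qed.

Section Sparse.
Context (M K : R) (a : @graph n).
Hypothesis aMK : sparse M K a.
Let degM u : deg a u <= M. Proof. exact: (proj1 aMK). Qed.
Let deg0M u v w : deg (set_edge a u v false) w <= M.
Proof. exact: le_trans (deg_set0_le _ _ _ _) (degM _). Qed.
Let M0 (u : 'I_n) : 0 <= M. Proof. exact: le_trans (deg_ge0 a u) (degM u). Qed.

Lemma sum_paths_incr_le u v : \sum_i paths_incr u v a i <= 4 * M.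
Proof. by rewrite sum_paths_incr; have := deg0M u v u; have := deg0M u v v; lra. Qed.

Lemma sum_closed_incr_le u v : u != v -> \sum_i closed_incr u v a i <= 6 * K.
Proof.
move=> uv; rewrite sum_closed_incr ler_pM2l ?ltr0n //.
exact: le_trans (cod_set0_le _ _ _ _ _) (proj2 aMK _ _ uv).
Qed.

Lemma paths_incr_le u v i : paths_incr u v a i <= 4 * M.
Proof.
apply: le_trans (sum_paths_incr_le u v); rewrite (bigD1 i) //= lerDl.
by apply: sumr_ge0 => j _; exact: paths_incr_ge0.
Qed.

Lemma closed_incr_le u v i : u != v -> closed_incr u v a i <= 6 * K.
Proof.
move=> uv; apply: le_trans (sum_closed_incr_le uv); rewrite (bigD1 i) //= lerDl.
by apply: sumr_ge0 => j _; exact: closed_incr_ge0.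
Qed.

Lemma sum_neq_le (F : 'I_n -> 'I_n -> R) : (forall u v, 0 <= F u v) ->
  \sum_u \sum_(v | u != v) F u v <= \sum_u \sum_v F u v.
Proof.
move=> F0; apply: ler_sum => u _; rewrite [leRHS](bigID (fun v => u != v)) /= lerDl.
exact: sumr_ge0.
Qed.

Lemma paths_incr_le_full u v i : paths_incr u v a i <=
  (i == u)%:R * deg a v + (i == v)%:R * deg a u + xe a i u + xe a i v.
Proof. by rewrite !lerD ?ler_wpM2l ?ler0n ?deg_set0_le ?xe_set0_le. Qed.

Lemma sum_deg_le : \sum_u deg a u <= n%:R * M.
Proof.
apply: le_trans (ler_sum _ (fun u _ => degM u)) _.
by rewrite sumr_const card_ord mulr_natl.
Qed.

Lemma sum2_delta i (F : 'I_n -> 'I_n -> R) :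
  \sum_u \sum_v (i == u)%:R * F u v = \sum_v F i v.
Proof.
under eq_bigr do rewrite -mulr_sumr eq_sym.
by rewrite (sum_delta i (fun u => \sum_v F u v)).
Qed.

Lemma sum_edges_paths_incr i :
  \sum_u \sum_(v | u != v) paths_incr u v a i <= 4 * (n%:R * M).
Proof.
apply: le_trans (sum_neq_le _) _ => [u v|]; first exact: paths_incr_ge0.
apply: (@le_trans _ _ (\sum_u \sum_v ((i == u)%:R * deg a v + (i == v)%:R * deg a u
   + xe a i u + xe a i v))).
  by apply: ler_sum => u _; apply: ler_sum => v _; exact: paths_incr_le_full.
under eq_bigr do rewrite !big_split /=.
rewrite !big_split /= sum2_delta [X in _ + X + _ + _]exchange_big /= sum2_delta.
under [X in _ + X + _]eq_bigr do rewrite sumr_const card_ord.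
rewrite sumr_const card_ord sumrMnl -/(deg a i) -[deg a i *+ n]mulr_natl.
have := sum_deg_le; have := ler_wpM2l (ler0n R n) (degM i); lra.
Qed.

(** Compared with sum_edges_paths_incr, keeping only the edges that are present
    replaces the factor n by M, which is of order n p. *)
Lemma sum_xe_paths_incr i :
  \sum_u \sum_(v | u != v) xe a u v * paths_incr u v a i <= 4 * M ^+ 2.
Proof.
have xM (w : 'I_n) (F : 'I_n -> R) : (forall v, 0 <= F v <= M) ->
    \sum_v xe a w v * F v <= M ^+ 2.
  move=> FM; apply: (@le_trans _ _ (\sum_v xe a w v * M)).
    by apply: ler_sum => v _; rewrite ler_wpM2l ?xe_ge0 //; case/andP: (FM v).
  by rewrite -mulr_suml expr2 ler_wpM2r ?(M0 w) // degM.
apply: le_trans (sum_neq_le _) _ => [u v|]; first by rewrite mulr_ge0 ?xe_ge0 ?paths_incr_ge0.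
apply: (@le_trans _ _ (\sum_u \sum_v ((i == u)%:R * (xe a u v * deg a v) +
    (i == v)%:R * (xe a u v * deg a u)
   + xe a i u * xe a u v + xe a i v * xe a u v))).
  apply: ler_sum => u _; apply: ler_sum => v _.
  apply: le_trans (ler_wpM2l (xe_ge0 _ _ _) (paths_incr_le_full u v i)) _.
  move: (xe a u v) (xe a i u) (xe a i v) (deg a u) (deg a v) => x y z d e.
  move: (i == u)%:R (i == v)%:R => s t; rewrite le_eqVlt; apply/orP; left.
  by apply/eqP; ring.
under eq_bigr do rewrite !big_split /=.
rewrite !big_split /= sum2_delta [X in _ + X + _ + _]exchange_big /= sum2_delta.
rewrite [X in _ + X]exchange_big /=.
under [X in _ + X + _]eq_bigr do rewrite -mulr_sumr.
under [X in _ + X]eq_bigr do rewrite -mulr_sumr sum_xer.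
under [X in _ + X + _ + _]eq_bigr do rewrite xeC.
have h := xM i _ (fun v => introT andP (conj (deg_ge0 a v) (degM v))).
have -> : \sum_i0 xe a i i0 * \sum_i1 xe a i0 i1 = \sum_v xe a i v * deg a v by [].
lra.
Qed.

Lemma sum_edges_closed_incr i :
  \sum_u \sum_(v | u != v) closed_incr u v a i <= 6 * M ^+ 2.
Proof.
apply: le_trans (sum_neq_le _) _ => [u v|]; first exact: closed_incr_ge0.
have h : \sum_v cod a i v <= M ^+ 2.
  rewrite exchange_big /=; under eq_bigr do rewrite -mulr_sumr.
  apply: (@le_trans _ _ (\sum_k xe a i k * M)).
    by apply: ler_sum => k _; rewrite ler_wpM2l ?xe_ge0 //; exact: degM.
  by rewrite -mulr_suml expr2 ler_wpM2r ?(M0 i) // degM.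
have h' : \sum_u xe a i u * \sum_v xe a i v <= M ^+ 2.
  by rewrite -mulr_suml expr2; apply: ler_pM; rewrite ?deg_ge0 ?degM.
apply: (@le_trans _ _ (\sum_u \sum_v (2 * ((i == u)%:R * cod a u v) +
    2 * ((i == v)%:R * cod a u v) + 2 * (xe a i u * xe a i v)))).
  apply: ler_sum => u _; apply: ler_sum => v _.
  rewrite -!mulrDr ler_pM2l ?ltr0n // -mulrDl lerD //.
    by rewrite ler_wpM2l ?addr_ge0 ?ler0n ?cod_set0_le.
  by rewrite ler_pM ?xe_ge0 ?xe_set0_le.
under eq_bigr do rewrite !big_split /= -!mulr_sumr.
rewrite !big_split /= -!mulr_sumr.
rewrite [X in _ + 2 * X + _]exchange_big /=.
under eq_bigr do rewrite mulr_sumr.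
rewrite sum2_delta [X in _ + 2 * X + _]sum2_delta.
under [X in _ + 2 * X + _]eq_bigr do rewrite codC.
lra.
Qed.

End Sparse.
End EdgeIncrements.

(** * Means and variances of the counts *)

Section CountVariance.
Context {R : realFieldType} {n : nat} (p : R).
Hypothesis p01 : 0 <= p <= 1.
Implicit Types (u v i j k : 'I_n) (a : @graph n) (M K : R).
Local Notation deg := (deg (R := R)).
Local Notation cod := (cod (R := R)).
Local Notation paths := (paths (R := R)).
Local Notation closed_paths := (closed_paths (R := R)).
Local Notation nu := (@paths_mean R n p).
Local Notation EG := (@EG R n p).

Lemma le_EG (f g : @graph n -> R) : (forall a, f a <= g a) -> EG f <= EG g.
Proof. by apply: le_Ex; exact: edge_p01. Qed.

Lemma EG_ge0 (f : @graph n -> R) : (forall a, 0 <= f a) -> 0 <= EG f.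
Proof. by apply: Ex_ge0; exact: edge_p01. Qed.

(** Graphs that are not good are paid for by a worst-case bound times their small
    probability. *)
Lemma le_EG_outside (good : pred (@graph n)) (F G : @graph n -> R) C : 0 <= C ->
  (forall a, good a -> F a <= G a) -> (forall a, F a <= C) ->
  (forall a, 0 <= G a) ->
  EG F <= EG G + C * EG (fun a => (~~ good a)%:R).
Proof.
move=> C0 FG FC G0; rewrite /EG -ExZ -ExD; apply: le_EG => a.
case: (boolP (good a)) => [/FG h|_]; first by rewrite mulr0 addr0.
by rewrite mulr1; apply: le_trans (FC a) _; rewrite lerDr.
Qed.

Lemma EG_xx i j k : i != k ->
  EG (fun a => xe a i j * xe a j k) = p ^+ 2 * ((i != j)%:R * (j != k)%:R).
Proof.
move=> ik; case: (eqVneq i j) => [->|ij] /=.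
  rewrite mul0r mulr0 -[RHS](Ex_cst (edge_p (n := n) p)).
  by apply: eq_Ex => a; rewrite xe_diag mul0r.
case: (eqVneq j k) => [->|jk] /=.
  rewrite !mulr0 -[RHS](Ex_cst (edge_p (n := n) p)).
  by apply: eq_Ex => a; rewrite xe_diag mulr0.
rewrite EG_xe_ignores //; last first.
  move=> a b; apply: xe_set_neq.
  by rewrite eq_sym (negPf ij) eq_sym (negPf jk) /= eq_sym (negPf ik) andbF.
have -> : EG (fun a => xe a j k) = EG (fun a => xe a j k * 1).
  by apply: eq_Ex => a; rewrite mulr1.
by rewrite EG_xe_ignores // /EG Ex_cst; ring.
Qed.

Lemma EG_xxx i j k :
  EG (fun a => xe a i j * xe a j k * xe a k i) =
  p ^+ 3 * ((i != j)%:R * (j != k)%:R * (i != k)%:R).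
Proof.
case: (eqVneq i k) => [->|ik] /=.
  rewrite !mulr0 -[RHS](Ex_cst (edge_p (n := n) p)).
  by apply: eq_Ex => a; rewrite xe_diag mulr0.
have -> : EG (fun a => xe a i j * xe a j k * xe a k i) =
    EG (fun a => xe a k i * (xe a i j * xe a j k)).
  by apply: eq_Ex => a; rewrite mulrC.
case: (eqVneq i j) => [->|ij] /=.
  rewrite !mul0r mulr0 -[RHS](Ex_cst (edge_p (n := n) p)).
  by apply: eq_Ex => a; rewrite xe_diag mul0r mulr0.
case: (eqVneq j k) => [->|jk] /=.
  rewrite mulr0 mul0r mulr0 -[RHS](Ex_cst (edge_p (n := n) p)).
  by apply: eq_Ex => a; rewrite xe_diag !mulr0.
rewrite EG_xe_ignores 1?eq_sym //; last first.
  by move=> a b; rewrite !xe_set_neq //;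
    rewrite ?(negPf ij) ?(negPf ik) ?(negPf jk) ?(eq_sym j) ?(negPf ij) ?(negPf ik) ?andbF.
by rewrite EG_xx // ij jk /=; ring.
Qed.

Lemma sum_ones_neq1 i : \sum_j (i != j)%:R = n%:R - 1 :> R.
Proof.
have -> : \sum_j (i != j)%:R = \sum_(j < n) 1 - \sum_j (j == i)%:R * 1 :> R.
  rewrite -sumrB; apply: eq_bigr => j _; rewrite mulr1 eq_sym.
  by case: (j == i); rewrite /= ?subr0 ?subrr.
by rewrite sum_delta sumr_const card_ord -mulr_natl mulr1.
Qed.

Lemma sum_ones_neq2 i :
  \sum_j \sum_k (i != j)%:R * (j != k)%:R * (i != k)%:R = (n%:R - 1) * (n%:R - 2) :> R.
Proof.
rewrite -(sum_ones_neq1 i) mulr_suml; apply: eq_bigr => j _.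
case: (eqVneq i j) => [->|ij] /=.
  by rewrite mul0r big1 // => k _; rewrite !mul0r.
rewrite mul1r -(sum_ones_neq ij); apply: eq_bigr => k _.
by rewrite mul1r [k == j]eq_sym mulrC.
Qed.

Lemma EG_paths i : EG (paths^~ i) = nu.
Proof.
rewrite /EG Ex_sum /paths_mean -(sum_ones_neq2 i) mulr_suml; apply: eq_bigr => j _.
rewrite Ex_sum mulr_suml; apply: eq_bigr => k _.
case: (eqVneq i k) => [ik|ik] /=.
  rewrite !mulr0 mul0r -[RHS](Ex_cst (edge_p (n := n) p)).
  by apply: eq_Ex => a; rewrite mulr0.
rewrite mulr1 mulrC -EG_xx //; apply: eq_Ex => a; by rewrite mulr1.
Qed.

Lemma EG_closed_paths i : EG (closed_paths^~ i) = p * nu.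
Proof.
rewrite /EG Ex_sum /paths_mean -(sum_ones_neq2 i) mulr_suml mulr_sumr; apply: eq_bigr => j _.
rewrite Ex_sum mulr_suml mulr_sumr; apply: eq_bigr => k _.
by rewrite [LHS]EG_xxx; ring.
Qed.

Lemma deg_le_n a u : deg a u <= n%:R.
Proof.
have -> : n%:R = \sum_(k < n) 1 :> R by rewrite sumr_const card_ord.
by apply: ler_sum => k _; exact: xe_le1.
Qed.

Lemma cod_le_deg a u v : cod a u v <= deg a u.
Proof. by apply: ler_sum => k _; rewrite ler_piMr ?xe_ge0 ?xe_le1. Qed.

Lemma sparse_n a : sparse (n%:R : R) n%:R a.
Proof.
split=> [u|u v _]; first exact: deg_le_n.
exact: le_trans (cod_le_deg _ _ _) (deg_le_n _ _).
Qed.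

Lemma paths_del u v a i : u != v -> del u v (paths^~ i) a = paths_incr (R:=R) u v a i.
Proof. by move=> uv; rewrite /del paths_set1 // addrAC subrr add0r. Qed.

Lemma closed_paths_del u v a i : u != v ->
  del u v (closed_paths^~ i) a = closed_incr (R:=R) u v a i.
Proof. by move=> uv; rewrite /del closed_paths_set1 // addrAC subrr add0r. Qed.

Section Good.
Context (M K : R) (good : pred (@graph n)).
Hypothesis goodP : forall a, good a -> sparse M K a.
Let bad_prob := EG (fun a => (~~ good a)%:R).

Lemma sum_paths_del_sqr_le M' K' a i : sparse M' K' a ->
  \sum_u \sum_(v | u != v) del u v (paths^~ i) a ^+ 2 <= 16 * n%:R * M' ^+ 2.
Proof.
move=> sp; apply: (@le_trans _ _
   (4 * M' * \sum_u \sum_(v | u != v) paths_incr (R:=R) u v a i)).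
  rewrite mulr_sumr; apply: ler_sum => u _; rewrite mulr_sumr; apply: ler_sum => v uv.
  rewrite paths_del // expr2 ler_wpM2r ?paths_incr_ge0 //.
  exact: paths_incr_le sp _ _ _.
have h := sum_edges_paths_incr sp i.
have M0 : 0 <= 4 * M'.
  exact: le_trans (paths_incr_ge0 _ _ _ _ ) (paths_incr_le sp i i i).
apply: le_trans (ler_wpM2l M0 h) _; rewrite le_eqVlt; apply/orP; left.
by apply/eqP; ring.
Qed.

Lemma sum_closed_del_sqr_le M' K' a i : sparse M' K' a -> 0 <= K' ->
  \sum_u \sum_(v | u != v) del u v (closed_paths^~ i) a ^+ 2 <= 36 * K' * M' ^+ 2.
Proof.
move=> sp K0; apply: (@le_trans _ _
   (6 * K' * \sum_u \sum_(v | u != v) closed_incr (R:=R) u v a i)).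
  rewrite mulr_sumr; apply: ler_sum => u _; rewrite mulr_sumr; apply: ler_sum => v uv.
  rewrite closed_paths_del // expr2 ler_wpM2r ?closed_incr_ge0 //.
  exact: closed_incr_le sp _ _ _ uv.
have h := sum_edges_closed_incr sp i.
apply: le_trans (ler_wpM2l (mulr_ge0 (ler0n _ 6) K0) h) _.
by rewrite le_eqVlt; apply/orP; left; apply/eqP; ring.
Qed.

Lemma efron_stein_outside (f : @graph n -> R) C C' : 0 <= C -> 0 <= C' ->
  (forall a, good a -> \sum_u \sum_(v | u != v) del u v f a ^+ 2 <= C) ->
  (forall a, \sum_u \sum_(v | u != v) del u v f a ^+ 2 <= C') ->
  EG (fun a => (f a - EG f) ^+ 2) <= p * (C + C' * bad_prob).
Proof.
move=> C0 C'0 h h'; apply: le_trans (efron_stein_graph p01 f) _.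
case/andP: (p01) => p0 _; apply: ler_wpM2l => //.
have <- : EG (fun a => \sum_u \sum_(v | u != v) del u v f a ^+ 2) =
    \sum_u \sum_(v | u != v) EG (fun a => del u v f a ^+ 2).
  by rewrite /EG Ex_sum; apply: eq_bigr => u _; rewrite Ex_sum.
apply: le_trans (le_EG_outside C'0 h h' _) _ => //.
by rewrite /EG Ex_cst.
Qed.

Lemma var_paths i : EG (fun a => (paths a i - nu) ^+ 2) <=
  p * (16 * n%:R * M ^+ 2 + 16 * n%:R ^+ 3 * bad_prob).
Proof.
rewrite -{1}(EG_paths i); apply: efron_stein_outside => [| |a ga|a].
- by rewrite mulr_ge0 ?sqr_ge0 // mulr_ge0 ?ler0n.
- by rewrite mulr_ge0 ?exprn_ge0.
- exact: sum_paths_del_sqr_le (goodP ga).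
apply: le_trans (sum_paths_del_sqr_le _ (sparse_n a)) _.
by rewrite le_eqVlt; apply/orP; left; apply/eqP; ring.
Qed.

Lemma var_closed_paths i : 0 <= K -> EG (fun a => (closed_paths a i - p * nu) ^+ 2) <=
  p * (36 * K * M ^+ 2 + 36 * n%:R ^+ 3 * bad_prob).
Proof.
move=> K0; rewrite -{1}(EG_closed_paths i); apply: efron_stein_outside => [| |a ga|a].
- by rewrite mulr_ge0 ?sqr_ge0 // mulr_ge0 ?ler0n.
- by rewrite mulr_ge0 ?exprn_ge0.
- exact: sum_closed_del_sqr_le (goodP ga) K0.
apply: le_trans (sum_closed_del_sqr_le _ (sparse_n a) _) _ => //.
by rewrite le_eqVlt; apply/orP; left; apply/eqP; ring.
Qed.

End Good.
End CountVariance.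

(** * Variance of the linearization error *)

Section LinErrVariance.
Context {R : realFieldType} {n : nat} (p : R).
Hypothesis p0 : 0 <= p.
Hypothesis p_half : p <= 1 / 2.
Implicit Types (u v i j k : 'I_n) (a : @graph n).
Local Notation paths := (paths (R := R)).
Local Notation closed_paths := (closed_paths (R := R)).
Local Notation du := (paths_incr (R := R)).
Local Notation dv := (closed_incr (R := R)).
Local Notation nu := (@paths_mean R n p).
Local Notation EG := (@EG R n p).
Hypothesis nu_gt0 : 0 < nu.

Let p01 : 0 <= p <= 1.
Proof. by rewrite p0 (le_trans p_half) // ler_pdivrMr ?mul1r ?ler1n. Qed.

Definition dev_paths a i : R := `|paths a i - nu|.
Definition dev_closed a i : R := `|closed_paths a i - p * nu|.

(** Up to a factor, cost0 without the edge u v plus cost1 with it bounds the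
    squared increment of lin_errs. Keeping the two apart matters: the first comes
    with the probability 1 - p and the second with p. *)
Definition cost0 u v a : R :=
  (\sum_i dv u v a i) * (\sum_i dv u v a i * dev_paths a i ^+ 2) +
  p ^+ 2 * ((\sum_i du u v a i) * (\sum_i du u v a i * dev_paths a i ^+ 2)).

Definition cost1 u v a : R :=
  2 * ((\sum_i du u v a i) * (\sum_i du u v a i *
    (dev_closed a i ^+ 2 + p ^+ 2 * dev_paths a i ^+ 2))).

Lemma sum_incr_ge0 (w F : 'I_n -> R) : (forall i, 0 <= w i) ->
  (forall i, 0 <= F i) -> 0 <= (\sum_i w i) * (\sum_i w i * F i).
Proof. by move=> w0 F0; rewrite mulr_ge0 // sumr_ge0 // => i _; rewrite mulr_ge0. Qed.

Lemma cost0_ge0 u v a : 0 <= cost0 u v a.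
Proof.
rewrite addr_ge0 // ?(mulr_ge0 (sqr_ge0 p)) // sum_incr_ge0 // => i;
  by rewrite ?sqr_ge0 ?closed_incr_ge0 ?paths_incr_ge0.
Qed.

(** Sum lin_err_incr over the nodes and apply the Cauchy-Schwarz inequality with
    the increments of the counts as weights. Their total mass is small since one
    edge lies on few paths. *)
Lemma lin_errs_del_sqr u v a : u != v ->
  del u v (lin_errs p) a ^+ 2 <= 3 * (32 ^+ 2 / nu ^+ 2) ^+ 2 *
    (cost0 u v (set_edge a u v false) + cost1 u v (set_edge a u v true)).
Proof.
move=> uv; set a0 := set_edge a u v false; set a1 := set_edge a u v true.
set c := 32 ^+ 2 / nu ^+ 2; have c0 : 0 <= c by rewrite divr_ge0 ?sqr_ge0.
pose A := \sum_i dv u v a i * dev_paths a0 i.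
pose B := \sum_i du u v a i * dev_paths a0 i.
pose C := \sum_i du u v a i * (dev_closed a1 i + p * dev_paths a1 i).
have h : `|del u v (lin_errs p) a| <= c * (A + (p * B + C)).
  rewrite /del /lin_errs -/a0 -/a1 -sumrB.
  apply: le_trans (ler_norm_sum _ _ _) _.
  rewrite /A /B /C [p * _]mulr_sumr -!big_split mulr_sumr /=; apply: ler_sum => i _.
  rewrite /a1 paths_set1 // closed_paths_set1 // -/a0.
  have := lin_err_incr (closed_paths a0 i) (paths a0 i) nu_gt0 p0
    (paths_incr_ge0 u v a i) (closed_incr_ge0 u v a i).
  rewrite /dev_paths /dev_closed /a1 paths_set1 // closed_paths_set1 // -/a0.
  rewrite -/(du u v a i) -/(dv u v a i).
  rewrite [dv u v a i * _]mulrC [du u v a i * `|paths a0 i - nu|]mulrC.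
  exact.
have sqr3 (x y z : R) : (x + (y + z)) ^+ 2 <= 3 * (x ^+ 2 + (y ^+ 2 + z ^+ 2)).
  have := sqr_ge0 (x - y); have := sqr_ge0 (y - z); have := sqr_ge0 (x - z).
  by rewrite !expr2; nra.
apply: (@le_trans _ _ ((c * (A + (p * B + C))) ^+ 2)).
  by rewrite -real_normK ?num_real // lerXn2r ?nnegrE ?normr_ge0 // (le_trans _ h).
rewrite exprMn [leRHS]mulrAC [leLHS]mulrC ler_wpM2r ?sqr_ge0 //.
apply: le_trans (sqr3 _ _ _) _; rewrite ler_wpM2l ?ler0n //.
have hA : A ^+ 2 <= (\sum_i dv u v a i) * (\sum_i dv u v a i * dev_paths a0 i ^+ 2).
  by apply: sqr_sum_le => i; exact: closed_incr_ge0.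
have hB : (p * B) ^+ 2 <= p ^+ 2 *
    ((\sum_i du u v a i) * (\sum_i du u v a i * dev_paths a0 i ^+ 2)).
  rewrite exprMn ler_wpM2l ?sqr_ge0 //.
  by apply: sqr_sum_le => i; exact: paths_incr_ge0.
have hC : C ^+ 2 <= 2 * ((\sum_i du u v a i) * (\sum_i du u v a i *
    (dev_closed a1 i ^+ 2 + p ^+ 2 * dev_paths a1 i ^+ 2))).
  apply: le_trans (sqr_sum_le _ _) _ => [i|]; first exact: paths_incr_ge0.
  rewrite mulrCA; apply: ler_wpM2l.
    by apply: sumr_ge0 => i _; exact: paths_incr_ge0.
  rewrite mulr_sumr; apply: ler_sum => i _; rewrite [leRHS]mulrCA ler_wpM2l ?paths_incr_ge0 //.
  by move: (dev_closed _ _) (dev_paths _ _) => y d; have := sqr_ge0 (y - p * d); nra.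
have -> : cost0 u v a0 = (\sum_i dv u v a i) * (\sum_i dv u v a i * dev_paths a0 i ^+ 2) +
  p ^+ 2 * ((\sum_i du u v a i) * (\sum_i du u v a i * dev_paths a0 i ^+ 2)).
  rewrite /cost0 /a0; under eq_bigr do rewrite closed_incr_set.
  under [X in _ * X + _]eq_bigr do rewrite closed_incr_set.
  under [X in _ + _ * (X * _)]eq_bigr do rewrite paths_incr_set.
  by under [X in _ + _ * (_ * X)]eq_bigr do rewrite paths_incr_set.
have -> : cost1 u v a1 = 2 * ((\sum_i du u v a i) * (\sum_i du u v a i *
    (dev_closed a1 i ^+ 2 + p ^+ 2 * dev_paths a1 i ^+ 2))).
  rewrite /cost1 /a1; under eq_bigr do rewrite paths_incr_set.
  by under [X in _ * (_ * X)]eq_bigr do rewrite paths_incr_set.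
by rewrite addrA lerD // lerD.
Qed.

Definition total_cost a : R :=
  \sum_u \sum_(v | u != v) (2 * p * cost0 u v a + xe a u v * cost1 u v a).

(** The factor p of the Efron-Stein inequality turns cost1 with the edge present
    into the mean of xe a u v * cost1; without the edge, the mean of cost0 at most
    doubles because 1 - p >= 1 / 2. *)
Lemma var_lin_errs_cost :
  EG (fun a => (lin_errs p a - EG (lin_errs p)) ^+ 2) <=
  3 * (32 ^+ 2 / nu ^+ 2) ^+ 2 * EG total_cost.
Proof.
apply: le_trans (efron_stein_graph p01 _) _.
rewrite /EG Ex_sum !mulr_sumr; apply: ler_sum => u _.
rewrite Ex_sum !mulr_sumr; apply: ler_sum => v uv.
set c := 3 * _.
have c0 : 0 <= c by rewrite mulr_ge0 ?sqr_ge0.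
apply: (@le_trans _ _ (p * (c * (EG (fun a => cost0 u v (set_edge a u v false)) +
    EG (fun a => cost1 u v (set_edge a u v true)))))).
  rewrite ler_wpM2l // /EG -ExD -ExZ; apply: le_EG => // a.
  exact: lin_errs_del_sqr.
rewrite mulrCA ler_wpM2l // mulrDr -EG_xe // ExD lerD //.
have h : (1 - p) * EG (fun a => cost0 u v (set_edge a u v false)) <= EG (cost0 u v).
  rewrite -EG_xeN //; apply: le_EG => // a.
  by rewrite ler_piMl ?cost0_ge0 // gerBl xe_ge0.
have h' : 0 <= EG (fun a => cost0 u v (set_edge a u v false)).
  by apply: EG_ge0 => // a; exact: cost0_ge0.
rewrite ExZ [2 * p]mulrC -mulrA ler_wpM2l //; apply: le_trans (_ : 2 * ((1 - p) *
    EG (fun a => cost0 u v (set_edge a u v false))) <= _); last first.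
  by rewrite ler_pM2l ?ltr0n.
by rewrite mulrA ler_peMl //; move: p_half; lra.
Qed.

(** Exchange the sums over edges and nodes: at a fixed node the squared deviations
    factor out, and the increments summed over all edges are bounded by the lemmas
    on sparse graphs. *)
Lemma total_cost_le M K a : sparse M K a -> 0 <= K -> p * n%:R <= M ->
  total_cost a <= (72 * p * K * M ^+ 2 + 64 * p ^+ 2 * M ^+ 3) *
    (\sum_i dev_paths a i ^+ 2) + 32 * M ^+ 3 * \sum_i dev_closed a i ^+ 2.
Proof.
move=> sp K0 pnM.
have M0 : 0 <= M by apply: le_trans pnM; rewrite mulr_ge0.
pose d i := dev_paths a i ^+ 2; pose y i := dev_closed a i ^+ 2.
have d0 i : 0 <= d i by exact: sqr_ge0.
have y0 i : 0 <= y i by exact: sqr_ge0.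
have yd0 i : 0 <= y i + p ^+ 2 * d i.
  by apply: addr_ge0 => //; apply: mulr_ge0 => //; exact: sqr_ge0.
apply: (@le_trans _ _ (\sum_u \sum_(v | u != v) \sum_i (12 * p * K * (dv u v a i * d i) +
   8 * p ^+ 3 * M * (du u v a i * d i) +
   8 * M * (xe a u v * du u v a i * (y i + p ^+ 2 * d i))))).
  apply: ler_sum => u _; apply: ler_sum => v uv.
  rewrite !big_split /= -!mulr_sumr.
  have S0 : 0 <= \sum_i dv u v a i * d i.
    by apply: sumr_ge0 => i _; rewrite mulr_ge0 ?closed_incr_ge0.
  have S1 : 0 <= \sum_i du u v a i * d i.
    by apply: sumr_ge0 => i _; rewrite mulr_ge0 ?paths_incr_ge0.
  have S2 : 0 <= \sum_i du u v a i * (y i + p ^+ 2 * d i).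
    by apply: sumr_ge0 => i _; apply: mulr_ge0 => //; exact: paths_incr_ge0.
  have h0 := ler_wpM2r S0 (sum_closed_incr_le sp uv).
  have h1 := ler_wpM2r S1 (sum_paths_incr_le sp u v).
  have h2 := ler_wpM2r S2 (sum_paths_incr_le sp u v).
  have -> : \sum_i xe a u v * du u v a i * (y i + p ^+ 2 * d i) =
      xe a u v * \sum_i du u v a i * (y i + p ^+ 2 * d i).
    by rewrite mulr_sumr; apply: eq_bigr => i _; rewrite mulrA.
  rewrite lerD //.
    rewrite /cost0 -/(d _) mulrDr lerD //.
      have -> : 12 * p * K * (\sum_i dv u v a i * d i) =
        2 * p * (6 * K * (\sum_i dv u v a i * d i)) by ring.
      by rewrite ler_wpM2l // mulr_ge0.
    have -> : 8 * p ^+ 3 * M * (\sum_i du u v a i * d i) =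
      2 * p * (p ^+ 2 * (4 * M * (\sum_i du u v a i * d i))) by ring.
    by rewrite ler_wpM2l ?mulr_ge0 // ler_wpM2l ?sqr_ge0.
  rewrite [leRHS]mulrCA ler_wpM2l ?xe_ge0 // /cost1.
  have -> : 8 * M = 2 * (4 * M) by ring.
  by rewrite -[leRHS]mulrA ler_pM2l ?ltr0n.
under eq_bigr do rewrite exchange_big /=.
rewrite exchange_big /= 2!mulr_sumr -big_split /=; apply: ler_sum => i _.
rewrite -/(d i) -/(y i).
have -> : \sum_u \sum_(v | u != v) (12 * p * K * (dv u v a i * d i) +
   8 * p ^+ 3 * M * (du u v a i * d i) +
   8 * M * (xe a u v * du u v a i * (y i + p ^+ 2 * d i))) =
   12 * p * K * d i * (\sum_u \sum_(v | u != v) dv u v a i) +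
   8 * p ^+ 3 * M * d i * (\sum_u \sum_(v | u != v) du u v a i) +
   8 * M * (y i + p ^+ 2 * d i) * (\sum_u \sum_(v | u != v) xe a u v * du u v a i).
  rewrite !mulr_sumr -!big_split; apply: eq_bigr => u _ /=.
  rewrite !mulr_sumr -!big_split; apply: eq_bigr => v _ /=.
  by move: (dv _ _ _ _) (du _ _ _ _) (xe _ _ _) (d i) (y i) => e f x t z; ring.
have c0 : 0 <= 12 * p * K * d i.
  by apply: mulr_ge0 => //; apply: mulr_ge0 => //; apply: mulr_ge0.
have c1 : 0 <= 8 * p ^+ 3 * M * d i.
  by apply: mulr_ge0 => //; apply: mulr_ge0 => //; rewrite mulr_ge0 ?exprn_ge0.
have c2 : 0 <= 8 * M * (y i + p ^+ 2 * d i).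
  by apply: mulr_ge0 => //; apply: mulr_ge0.
have h0 := ler_wpM2l c0 (sum_edges_closed_incr sp i).
have h1 := ler_wpM2l c1 (sum_edges_paths_incr sp i).
have h2 := ler_wpM2l c2 (sum_xe_paths_incr sp i).
have h3 : 8 * p ^+ 3 * M * d i * (4 * (n%:R * M)) <= 32 * p ^+ 2 * M ^+ 3 * d i.
  have -> : 8 * p ^+ 3 * M * d i * (4 * (n%:R * M)) =
    32 * p ^+ 2 * M ^+ 2 * d i * (p * n%:R) by ring.
  have -> : 32 * p ^+ 2 * M ^+ 3 * d i = 32 * p ^+ 2 * M ^+ 2 * d i * M by ring.
  rewrite ler_wpM2l //; apply: mulr_ge0 => //.
  by apply: mulr_ge0; [apply: mulr_ge0 => //|]; exact: sqr_ge0.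
apply: le_trans (lerD (lerD h0 (le_trans h1 h3)) h2) _.
by rewrite le_eqVlt; apply/orP; left; apply/eqP; ring.
Qed.

End LinErrVariance.

(** * The linear statistic of edges and triangles *)

Section LeadingStatistic.
Context {R : realFieldType} {n : nat} (p : R).
Hypothesis p01 : 0 <= p <= 1.
Implicit Types (u v i j k x y : 'I_n) (a : @graph n).
Local Notation EG := (@EG R n p).
Local Notation G := (y_cod p).
Local Notation q := (1 - p).

Let p0 : 0 <= p. Proof. by case/andP: p01. Qed.
Let q0 : 0 <= q. Proof. by case/andP: p01 => _; rewrite subr_ge0. Qed.

Lemma EG_sum2 (F : 'I_n -> 'I_n -> @graph n -> R) :
  EG (fun a => \sum_k \sum_l F k l a) = \sum_k \sum_l EG (F k l).
Proof. by rewrite /EG Ex_sum; apply: eq_bigr => k _; rewrite Ex_sum. Qed.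

Lemma EG_ye0 u v : EG (fun a => ye p a u v) = 0.
Proof.
case: (eqVneq u v) => [->|uv].
  by rewrite -[RHS](Ex_cst (edge_p (n := n) p)); apply: eq_Ex => a; exact: ye_diag.
rewrite -[RHS](@EG_ye_ignores R n p u v (fun=> 1)) //.
by apply: eq_Ex => a; rewrite mulr1.
Qed.

Lemma EG_ye_y_cod u v : EG (fun a => ye p a u v * G a v u) = 0.
Proof.
case: (eqVneq u v) => [->|uv].
  rewrite -[RHS](Ex_cst (edge_p (n := n) p)); apply: eq_Ex => a.
  by rewrite ye_diag mul0r.
apply: EG_ye_ignores => // a b; rewrite ![y_cod p _ v u]y_codC.
exact: y_cod_ignores.
Qed.

Lemma y_trianglesE a : y_triangles p a = \sum_i \sum_j ye p a i j * G a j i.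
Proof.
apply: eq_bigr => i _; apply: eq_bigr => j _; rewrite mulr_sumr.
by apply: eq_bigr => k _; rewrite mulrA.
Qed.

Lemma EG_y_edges : EG (y_edges p) = 0.
Proof.
rewrite /EG Ex_sum big1 // => i _; rewrite Ex_sum big1 // => j _; exact: EG_ye0.
Qed.

Lemma EG_y_triangles : EG (y_triangles p) = 0.
Proof.
transitivity (EG (fun a => \sum_i \sum_j ye p a i j * G a j i)).
  by apply: eq_Ex => a; exact: y_trianglesE.
rewrite /EG Ex_sum big1 // => i _; rewrite Ex_sum big1 // => j _; exact: EG_ye_y_cod.
Qed.

(** A sum of fewer than n independent centred bits of variance at most p; the
    Efron-Stein inequality loses a factor 2. *)
Lemma EG_y_deg_but_sqr u v : u != v ->
  EG (fun a => y_deg_but p a u v ^+ 2) <= 2 * (n%:R * p).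
Proof.
move=> uv.
have E0 : EG (fun a => y_deg_but p a u v) = 0.
  rewrite /EG Ex_sum big1 // => k _.
  under eq_Ex do rewrite mulrC.
  by rewrite ExZ [X in _ * X]EG_ye0 mulr0.
have -> : EG (fun a => y_deg_but p a u v ^+ 2) =
    EG (fun a => (y_deg_but p a u v - EG (fun a => y_deg_but p a u v)) ^+ 2).
  by apply: eq_Ex => a; rewrite E0 subr0.
apply: le_trans (efron_stein_graph p01 _) _.
rewrite [leRHS](_ : _ = p * (n%:R + n%:R)); last by rewrite mulrDr; ring.
rewrite ler_wpM2l //.
apply: (@le_trans _ _ (\sum_x \sum_y ((x == v)%:R * 1 + (y == v)%:R * 1))); last first.
  under eq_bigr do rewrite big_split /=.
  rewrite big_split /= exchange_big /=.
  have e : \sum_(x < n) \sum_(j < n) (j == v)%:R * 1 = n%:R :> R.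
    by under eq_bigr do rewrite (sum_delta v (fun=> 1)); rewrite sumr_const card_ord.
  by rewrite !e.
apply: le_trans (ler_sum _ _) (sum_neq_le _) => [x _|x y]; last first.
  by rewrite addr_ge0 ?mulr_ge0 ?ler0n.
apply: ler_sum => y xy; rewrite -[leRHS](Ex_cst (edge_p (n := n) p)).
apply: le_EG => // a; rewrite /del -sumrB.
have -> : \sum_k (ye p (set_edge a x y true) v k * (u != k)%:R -
    ye p (set_edge a x y false) v k * (u != k)%:R) =
   (v == x)%:R * (u != y)%:R + (v == y)%:R * (u != x)%:R.
  rewrite -(sum_unit_edge x y v (fun k => (u != k)%:R)); apply: eq_bigr => k _.
  by rewrite -mulrBl ye_set1 // [X in X * _]addrAC subrr add0r.
rewrite [x == v]eq_sym [y == v]eq_sym !mulr1.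
move: xy; case: (eqVneq v x) => [<-|_]; case: (eqVneq v y) => [<-|_] //=;
  rewrite ?eqxx //= => _; case: (u != y); case: (u != x); rewrite /=; lra.
Qed.

Lemma y_deg_but_ignores u v : u != v -> ignores u v (fun a => y_deg_but p a u v).
Proof.
move=> uv a b; apply: eq_bigr => k _.
case: (eqVneq u k) => [_|uk]; first by rewrite !mulr0.
by rewrite ye_set_neq // eq_sym (negPf uv) /= eqxx /= eq_sym.
Qed.

(** The increments of y_paths are centred degrees, of typical size the square root
    of n p. *)
Lemma var_y_paths : EG (fun a => (y_paths p a - EG (y_paths p)) ^+ 2) <=
  32 * n%:R ^+ 3 * p ^+ 2.
Proof.
apply: le_trans (efron_stein_graph p01 _) _.
rewrite [leRHS](_ : _ = p * (\sum_(u < n) \sum_(v < n) 32 * (n%:R * p))); last first.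
  by rewrite !sumr_const !card_ord; ring.
rewrite ler_wpM2l //.
apply: le_trans (ler_sum _ _) (sum_neq_le _) => [u _|u v]; last first.
  by rewrite mulr_ge0 ?mulr_ge0 ?ler0n.
apply: ler_sum => v uv; have vu : v != u by rewrite eq_sym.
have h1 := EG_y_deg_but_sqr uv; have h2 := EG_y_deg_but_sqr vu.
apply: (@le_trans _ _ (8 * (EG (fun a => y_deg_but p a u v ^+ 2) +
  EG (fun a => y_deg_but p a v u ^+ 2)))); last by lra.
rewrite /EG -ExD -ExZ; apply: le_EG => // a.
rewrite /del y_paths_del //.
rewrite (y_deg_but_ignores uv) set_edgeC (y_deg_but_ignores vu).
move: (y_deg_but _ _ _ _) (y_deg_but _ _ _ _) => s t.
by have := sqr_ge0 (s - t); rewrite !expr2; nra.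
Qed.

(** The products for distinct intermediate nodes k and l involve four distinct
    edges, so that only the diagonal terms survive. *)
Lemma EG_y_cod_sqr u v : u != v ->
  EG (fun a => G a u v ^+ 2) = (n%:R - 2) * (p * q) ^+ 2.
Proof.
move=> uv.
have -> : EG (fun a => G a u v ^+ 2) =
    \sum_k \sum_l EG (fun a => ye p a u k * (ye p a k v * (ye p a u l * ye p a l v))).
  rewrite -EG_sum2.
  apply: eq_Ex => a; rewrite expr2 big_distrlr /=; apply: eq_bigr => k _.
  by apply: eq_bigr => l _; rewrite -mulrA.
rewrite -(sum_ones_neq uv) mulr_suml; apply: eq_bigr => k _.
case: (eqVneq u k) => [->|uk] /=.
  rewrite !mul0r big1 // => l _; rewrite -[RHS](Ex_cst (edge_p (n := n) p)).
  by apply: eq_Ex => a; rewrite ye_diag mul0r.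
case: (eqVneq k v) => [->|kv] /=.
  rewrite mulr0 mul0r big1 // => l _; rewrite -[RHS](Ex_cst (edge_p (n := n) p)).
  by apply: eq_Ex => a; rewrite ye_diag mul0r mulr0.
rewrite !mul1r (bigD1 k) //= big1 ?addr0 => [|l lk].
  transitivity (EG (fun a => ye p a u k ^+ 2 * (ye p a k v ^+ 2 * 1))).
    by apply: eq_Ex => a; ring.
  rewrite EG_ye_sqr_ignores //; last first.
    move=> a b; rewrite ye_set_neq //.
    by rewrite [k == u]eq_sym (negPf uk) [v == u]eq_sym (negPf uv) andbF.
  rewrite EG_ye_sqr_ignores //.
  by rewrite /EG Ex_cst; ring.
case: (eqVneq u l) => [<-|ul].
  rewrite -[RHS](Ex_cst (edge_p (n := n) p)).
  by apply: eq_Ex => a; rewrite ye_diag mul0r !mulr0.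
apply: EG_ye_ignores => // a b.
have ku : k == u = false by rewrite eq_sym (negPf uk).
have lu : l == u = false by rewrite eq_sym (negPf ul).
have vu : v == u = false by rewrite eq_sym (negPf uv).
by rewrite !ye_set_neq // ?ku ?lu ?vu ?(negPf lk) ?(negPf uk) ?andbF ?andFb.
Qed.

Lemma EG_y_cod u v : u != v -> EG (fun a => G a u v) = 0.
Proof.
move=> uv; rewrite /EG Ex_sum big1 // => k _.
case: (eqVneq u k) => [->|uk].
  rewrite -[RHS](Ex_cst (edge_p (n := n) p)).
  by apply: eq_Ex => a; rewrite ye_diag mul0r.
apply: EG_ye_ignores => // a b; rewrite ye_set_neq //.
by rewrite [k == u]eq_sym (negPf uk) [v == u]eq_sym (negPf uv) andbF.
Qed.

Section LeadingTerm.
Context (k1 k3 : R).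

(** The linear statistic that carries the fluctuations. Its edge part dominates for
    alpha < 1/2 and its triangle part for alpha > 1/2. *)
Definition lead a : R := k1 * y_edges p a + k3 * y_triangles p a.
(** lead is the sum of ye p a u v * half_del u v a over ordered pairs. A triangle
    contains three edges, hence the different ratios of lead_del to half_del in the
    two parts. *)
Definition half_del u v a : R := k1 + k3 * G a u v.
Definition lead_del u v a : R := 2 * k1 + 6 * k3 * G a u v.
(** The Stein factor of lead: its mean is the variance of lead, by lead_ibp with F
    = lead, and its concentration is what makes lead asymptotically Gaussian. *)
Definition gamma a : R :=
  p * q * \sum_u \sum_(v | u != v) half_del u v a * lead_del u v a.

Lemma lead_delE u v a : u != v -> del u v lead a = lead_del u v a.
Proof.
move=> uv; rewrite /del /lead.
have h1 := y_edges_del p a uv; have h3 := y_triangles_del p a uv.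
rewrite (y_cod_ignores p uv) in h3.
by rewrite opprD addrACA -!mulrBr h1 h3 /lead_del; ring.
Qed.

Lemma EG_lead : EG lead = 0.
Proof.
rewrite /EG ExD !ExZ -/(EG (y_edges p)) -/(EG (y_triangles p)).
by rewrite EG_y_edges EG_y_triangles !mulr0 addr0.
Qed.

(** Each summand ye p a u v of lead is multiplied by a function that does not read
    the edge u v, so EG_ye applies and the difference falls on F alone. *)
Lemma lead_ibp (F : @graph n -> R) : EG (fun a => lead a * F a) =
  p * q * \sum_u \sum_(v | u != v) EG (fun a => half_del u v a * del u v F a).
Proof.
have -> : EG (fun a => lead a * F a) =
    \sum_u \sum_v EG (fun a => ye p a u v * (half_del u v a * F a)).
  rewrite -EG_sum2.
  apply: eq_Ex => a; rewrite /lead y_trianglesE /y_edges !mulr_sumr -big_split /= mulr_suml.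
  apply: eq_bigr => u _; rewrite !mulr_sumr -big_split /= mulr_suml.
  apply: eq_bigr => v _; rewrite /half_del [y_cod _ _ u v]y_codC.
  by move: (ye _ _ _ _) (y_cod _ _ _ _) (F a) => s t w; ring.
rewrite mulr_sumr; apply: eq_bigr => u _.
rewrite (bigID (fun v => u != v)) /= [X in _ + X]big1 ?addr0 => [|v]; last first.
  rewrite negbK => /eqP <-; rewrite -[RHS](Ex_cst (edge_p (n := n) p)).
  by apply: eq_Ex => a; rewrite ye_diag mul0r.
rewrite mulr_sumr; apply: eq_bigr => v uv.
rewrite EG_ye //; congr (_ * _); apply: eq_Ex => a.
by rewrite /del /half_del !(y_cod_ignores p uv) mulrBr.
Qed.

Lemma EG_lead_del_sqr u v : u != v -> EG (fun a => lead_del u v a ^+ 2) =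
  4 * k1 ^+ 2 + 36 * k3 ^+ 2 * ((n%:R - 2) * (p * q) ^+ 2).
Proof.
move=> uv; rewrite -(EG_y_cod_sqr uv).
transitivity (EG (fun a => 4 * k1 ^+ 2 + (24 * k1 * k3 * G a u v +
    36 * k3 ^+ 2 * G a u v ^+ 2))).
  apply: eq_Ex => a; rewrite /lead_del; move: (y_cod _ _ _ _) => t; ring.
by rewrite /EG !ExD !ExZ Ex_cst -!/(EG _) EG_y_cod //; ring.
Qed.

Lemma EG_gamma : EG gamma = p * q * (n%:R * (n%:R - 1)) *
  (2 * k1 ^+ 2 + 6 * k3 ^+ 2 * ((n%:R - 2) * (p * q) ^+ 2)).
Proof.
rewrite /EG ExZ -[RHS]mulrA; congr (_ * _).
rewrite Ex_sum.
transitivity (\sum_(u < n) ((n%:R - 1) * (2 * k1 ^+ 2 + 6 * k3 ^+ 2 * ((n%:R - 2) * (p * q) ^+ 2)))); last first.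
  by rewrite sumr_const card_ord; ring.
apply: eq_bigr => u _; rewrite Ex_sum -(sum_ones_neq1 u) mulr_suml big_mkcond /=.
apply: eq_bigr => v _; case: (boolP (u != v)) => [uv|_]; last by rewrite mul0r.
rewrite mul1r -(EG_y_cod_sqr uv).
transitivity (EG (fun a => 2 * k1 ^+ 2 + (8 * k1 * k3 * G a u v +
    6 * k3 ^+ 2 * G a u v ^+ 2))).
  apply: eq_Ex => a; rewrite /half_del /lead_del; move: (y_cod _ _ _ _) => t; ring.
by rewrite /EG !ExD !ExZ Ex_cst -!/(EG _) EG_y_cod //; ring.
Qed.

End LeadingTerm.
End LeadingStatistic.

(** * Stein's method for the linear statistic *)

Section SteinIdentity.
Context {R : realFieldType} {n : nat} (p : R).
Hypothesis p01 : 0 <= p <= 1.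
Implicit Types (u v i j k x y : 'I_n) (a : @graph n) (M K : R).
Local Notation EG := (@EG R n p).
Local Notation G := (y_cod p).
Local Notation q := (1 - p).

Let p0 : 0 <= p. Proof. by case/andP: p01. Qed.
Let q0 : 0 <= q. Proof. by case/andP: p01 => _; rewrite subr_ge0. Qed.
Let q1 : q <= 1. Proof. by rewrite gerBl. Qed.

Lemma sparse_set0 M K a u v : sparse M K a -> sparse M K (set_edge a u v false).
Proof.
case=> h1 h2; split=> [w|w z wz].
  exact: le_trans (deg_set0_le _ _ _ _) (h1 w).
exact: le_trans (cod_set0_le _ _ _ _ _) (h2 w z wz).
Qed.

Lemma y_cod_norm_le M K a u v : sparse M K a -> p * n%:R <= M -> u != v ->
  `|G a u v| <= K + 3 * p * M.
Proof.
move=> [hM hK] pnM uv; apply: le_trans (ler_norm_sum _ _ _) _.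
apply: (@le_trans _ _ (\sum_k (xe a u k + p) * (xe a v k + p))).
  apply: ler_sum => k _; rewrite normrM [ye p a k v]yeC.
  by apply: ler_pM => //; exact: ye_norm_le.
have -> : \sum_k (xe a u k + p) * (xe a v k + p) =
    cod a u v + p * deg a u + p * deg a v + p * (p * n%:R).
  have -> : p * (p * n%:R) = \sum_(k < n) p ^+ 2 by rewrite sumr_const card_ord; ring.
  rewrite /cod /deg !mulr_sumr -!big_split; apply: eq_bigr => k _ /=.
  by rewrite [xe a k v]xeC; move: (xe _ _ _) (xe _ _ _) => s t; ring.
have h1 := ler_wpM2l p0 (hM u); have h2 := ler_wpM2l p0 (hM v).
have h3 := ler_wpM2l p0 pnM; have := hK _ _ uv; lra.
Qed.

Section Lead.
Context (k1 k3 : R).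
Hypothesis k1_ge0 : 0 <= k1.
Hypothesis k3_ge0 : 0 <= k3.
Local Notation half_del := (half_del p k1 k3).
Local Notation lead_del := (lead_del p k1 k3).
Local Notation gamma := (gamma p k1 k3).
Local Notation lead := (lead p k1 k3).

Definition gamma_lip M K : R := p * k3 * M * (64 * k1 + 96 * k3 * (K + 3 * p * M + 2)).

(** The edge x y only changes the centred codegrees of pairs that meet {x, y}: each
    of them by at most 4, and all together by at most 8 M. *)
Lemma gamma_del_le M K a x y : sparse M K a -> p * n%:R <= M -> 0 <= K -> x != y ->
  `|del x y gamma a| <= gamma_lip M K.
Proof.
move=> sp pnM K0 xy; have sp0 := sparse_set0 x y sp.
have M0 : 0 <= M by apply: le_trans pnM; rewrite mulr_ge0.
set a0 := set_edge a x y false in sp0 *.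
set K' := K + 3 * p * M.
have K'0 : 0 <= K' by rewrite addr_ge0 ?mulr_ge0.
pose b u v : R := (u == x)%:R * `|ye p a0 y v| + (u == y)%:R * `|ye p a0 x v| +
   ((v == x)%:R * `|ye p a0 u y| + (v == y)%:R * `|ye p a0 u x|).
pose g u v := G (set_edge a x y true) u v - G a0 u v.
have gb u v : u != v -> `|g u v| <= b u v.
  move=> uv; rewrite /g y_cod_del // -/a0 /b.
  have nb (c : bool) (t : R) : `|c%:R * t| = c%:R * `|t|.
    by rewrite normrM ger0_norm ?ler0n.
  rewrite -!nb; apply: le_trans (ler_normD _ _) _.
  by apply: lerD; apply: ler_normD.
have b0 u v : 0 <= b u v by rewrite !addr_ge0 ?mulr_ge0 ?ler0n.
have b4 u v : b u v <= 4.
  have h1 (c : bool) (t : R) : 0 <= t -> t <= 1 -> c%:R * t <= 1.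
    by case: c => /=; rewrite ?mul1r ?mul0r.
  have := h1 (u == x) _ (normr_ge0 (ye p a0 y v)) (ye_norm_le1 p01 _ _ _).
  have := h1 (u == y) _ (normr_ge0 (ye p a0 x v)) (ye_norm_le1 p01 _ _ _).
  have := h1 (v == x) _ (normr_ge0 (ye p a0 u y)) (ye_norm_le1 p01 _ _ _).
  have := h1 (v == y) _ (normr_ge0 (ye p a0 u x)) (ye_norm_le1 p01 _ _ _).
  by rewrite /b; lra.
have sy w : \sum_v `|ye p a0 w v| <= 2 * M.
  apply: (@le_trans _ _ (\sum_v (xe a0 w v + p))).
    by apply: ler_sum => v _; exact: ye_norm_le.
  rewrite big_split /= sumr_const card_ord.
  have -> : p *+ n = p * n%:R by rewrite mulr_natr.
  by have := proj1 sp0 w; rewrite /deg; lra.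
have sb : \sum_u \sum_(v | u != v) b u v <= 8 * M.
  apply: le_trans (sum_neq_le b0) _; rewrite /b.
  under eq_bigr do rewrite !big_split /=.
  rewrite !big_split /= !sum_delta2.
  rewrite [X in _ + _ + (X + _)]exchange_big /= [X in _ + _ + (_ + X)]exchange_big /=.
  rewrite !sum_delta2.
  under [X in _ + _ + (X + _)]eq_bigr do rewrite yeC.
  under [X in _ + _ + (_ + X)]eq_bigr do rewrite yeC.
  by have := sy x; have := sy y; lra.
rewrite /del /gamma -mulrBr normrM ger0_norm ?mulr_ge0 //.
set L := 8 * k1 * k3 + 12 * k3 ^+ 2 * (K' + 2).
have L0 : 0 <= L.
  apply: addr_ge0; first by rewrite !mulr_ge0.
  by apply: mulr_ge0; [rewrite mulr_ge0 ?sqr_ge0|rewrite addr_ge0].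
have hS : `|\sum_u \sum_(v | u != v) half_del u v (set_edge a x y true) *
      lead_del u v (set_edge a x y true) -
    \sum_u \sum_(v | u != v) half_del u v a0 * lead_del u v a0| <= 8 * M * L.
  rewrite -sumrB; apply: le_trans (ler_norm_sum _ _ _) _.
  apply: le_trans (ler_wpM2r L0 sb); rewrite mulr_suml; apply: ler_sum => u _.
  rewrite -sumrB; apply: le_trans (ler_norm_sum _ _ _) _.
  rewrite mulr_suml; apply: ler_sum => v uv.
  have hG := y_cod_norm_le sp0 pnM uv; rewrite -/K' in hG.
  have := gb u v uv; have := b4 u v.
  have -> : half_del u v (set_edge a x y true) * lead_del u v (set_edge a x y true) -
      half_del u v a0 * lead_del u v a0 =
      g u v * (8 * k1 * k3 + 6 * k3 ^+ 2 * (2 * G a0 u v + g u v)).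
    rewrite /half_del /lead_del /g; move: (y_cod _ _ _ _) (y_cod _ _ _ _) => s t; ring.
  move: (g u v) (b u v) (G a0 u v) hG => s t r hr t4 st.
  rewrite normrM; apply: ler_pM => //.
  have k13 : 0 <= 8 * k1 * k3 by rewrite !mulr_ge0.
  apply: le_trans (ler_normD _ _) _; rewrite (ger0_norm k13) lerD2l normrM.
  have k33 : 0 <= 6 * k3 ^+ 2 by rewrite mulr_ge0 ?sqr_ge0.
  rewrite (ger0_norm k33) (_ : 12 * k3 ^+ 2 * (K' + 2) = 6 * k3 ^+ 2 * (2 * (K' + 2))); last by ring.
  apply: ler_wpM2l => //; apply: le_trans (ler_normD _ _) _.
  by rewrite normrM (ger0_norm (ler0n R 2)); lra.
apply: (@le_trans _ _ (p * (8 * M * L))).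
  apply: ler_pM => //; first by rewrite mulr_ge0.
  by rewrite ler_piMr.
by rewrite le_eqVlt; apply/orP; left; apply/eqP; rewrite /gamma_lip /L -/K'; ring.
Qed.

Lemma var_gamma M K (good : pred (@graph n)) :
  (forall a, good a -> sparse M K a) -> 0 <= K -> p * n%:R <= M ->
  EG (fun a => (gamma a - EG gamma) ^+ 2) <=
  p * (n%:R ^+ 2 * gamma_lip M K ^+ 2 + n%:R ^+ 2 * gamma_lip n%:R n%:R ^+ 2 *
     EG (fun a => (~~ good a)%:R)).
Proof.
move=> goodP K0 pnM.
have h M' K' a : sparse M' K' a -> p * n%:R <= M' -> 0 <= K' ->
    \sum_u \sum_(v | u != v) del u v gamma a ^+ 2 <= n%:R ^+ 2 * gamma_lip M' K' ^+ 2.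
  move=> sp pn' K'0.
  apply: le_trans (ler_sum _ _) (_ : \sum_(u < n) \sum_(v < n) gamma_lip M' K' ^+ 2 <= _) => [u _|].
    apply: le_trans (_ : \sum_(v | u != v) gamma_lip M' K' ^+ 2 <= _).
      apply: ler_sum => v uv; rewrite -real_normK ?num_real //.
      have hd := gamma_del_le sp pn' K'0 uv.
      by rewrite lerXn2r ?nnegrE ?normr_ge0 // (le_trans _ hd).
    by rewrite [leRHS](bigID (fun v => u != v)) /= lerDl sumr_ge0 // => v _; exact: sqr_ge0.
  by rewrite !sumr_const !card_ord le_eqVlt; apply/orP; left; apply/eqP; ring.
apply: efron_stein_outside => // [||a ga|a].
- by rewrite mulr_ge0 ?sqr_ge0.
- by rewrite mulr_ge0 ?sqr_ge0.
- exact: h (goodP _ ga) _ _.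
by apply: h => //; [exact: sparse_n|rewrite ler_piMl //; case/andP: p01].
Qed.

(** One factor is bounded uniformly through the codegrees; the square that remains
    has a known mean. *)
Lemma third_order_le M K (good : pred (@graph n)) : (1 < n)%N ->
  (forall a, good a -> sparse M K a) -> 0 <= K -> p * n%:R <= M ->
  EG (fun a => \sum_u \sum_(v | u != v) `|half_del u v a| * lead_del u v a ^+ 2) <=
  n%:R ^+ 2 * ((k1 + k3 * (K + 3 * p * M)) *
      (4 * k1 ^+ 2 + 36 * k3 ^+ 2 * ((n%:R - 2) * (p * q) ^+ 2)) +
    (k1 + 4 * n%:R * k3) * (2 * k1 + 24 * n%:R * k3) ^+ 2 *
     EG (fun a => (~~ good a)%:R)).
Proof.
move=> n1 goodP K0 pnM; have M0 : 0 <= M by apply: le_trans pnM; rewrite mulr_ge0.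
set B := (X in _ * X).
have -> : n%:R ^+ 2 * B = \sum_(u < n) \sum_(v < n) B.
  by rewrite !sumr_const !card_ord; ring.
have hh M' K' a u v : sparse M' K' a -> p * n%:R <= M' -> u != v ->
    `|half_del u v a| <= k1 + k3 * (K' + 3 * p * M').
  move=> sp pn' uv; rewrite /half_del; apply: le_trans (ler_normD _ _) _.
  by rewrite (ger0_norm k1_ge0) lerD2l normrM (ger0_norm k3_ge0) ler_wpM2l ?y_cod_norm_le.
have pn : p * n%:R <= n%:R by rewrite ler_piMl //; case/andP: p01.
have Kn a u v : u != v -> `|G a u v| <= 4 * n%:R.
  by move=> uv; have := y_cod_norm_le (sparse_n a) pn uv; move: pn; lra.
have be : 0 <= EG (fun a => (~~ good a)%:R) by apply: EG_ge0 => // a; rewrite ler0n.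
have C0 : 0 <= (k1 + 4 * n%:R * k3) * (2 * k1 + 24 * n%:R * k3) ^+ 2.
  by apply: mulr_ge0; rewrite ?sqr_ge0 // addr_ge0 ?mulr_ge0.
have eta0 : 0 <= k1 + k3 * (K + 3 * p * M).
  by apply: addr_ge0 => //; apply: mulr_ge0 => //; rewrite addr_ge0 ?mulr_ge0.
have term u v : u != v ->
    EG (fun a => `|half_del u v a| * lead_del u v a ^+ 2) <= B.
  move=> uv; rewrite /B -(EG_lead_del_sqr p k1 k3 uv) /EG -ExZ.
  apply: le_EG_outside => // [a ga|a|a].
  - by rewrite ler_wpM2r ?sqr_ge0 // (hh M K) //; exact: goodP.
  - apply: ler_pM; rewrite ?sqr_ge0 ?normr_ge0 //.
      rewrite /half_del; apply: le_trans (ler_normD _ _) _.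
      rewrite (ger0_norm k1_ge0) lerD2l normrM.
      by rewrite (ger0_norm k3_ge0) mulrC ler_wpM2r // Kn.
    rewrite -real_normK ?num_real //.
    have hl : `|lead_del u v a| <= 2 * k1 + 24 * n%:R * k3.
      rewrite /lead_del; apply: le_trans (ler_normD _ _) _; apply: lerD.
        by rewrite ger0_norm // mulr_ge0.
      rewrite normrM (@ger0_norm _ (6 * k3)) ?mulr_ge0 //.
      have := ler_wpM2l k3_ge0 (Kn a u v uv); lra.
    by rewrite lerXn2r ?nnegrE ?normr_ge0 // (le_trans _ hl).
  by rewrite mulr_ge0 ?sqr_ge0.
have B0 : 0 <= B.
  apply: addr_ge0; last exact: mulr_ge0.
  apply: mulr_ge0 => //; apply: addr_ge0; first by rewrite mulr_ge0 ?sqr_ge0.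
  apply: mulr_ge0; first by rewrite mulr_ge0 ?sqr_ge0.
  by apply: mulr_ge0; rewrite ?sqr_ge0 // subr_ge0 ler_nat.
have -> : EG (fun a => \sum_u \sum_(v | u != v) `|half_del u v a| * lead_del u v a ^+ 2) =
    \sum_u \sum_(v | u != v) EG (fun a => `|half_del u v a| * lead_del u v a ^+ 2).
  by rewrite /EG Ex_sum; apply: eq_bigr => u _; rewrite Ex_sum.
apply: le_trans (ler_sum _ _) (sum_neq_le _) => [u _|u v] //.
by apply: ler_sum => v uv; exact: term.
Qed.

Lemma set_edge_adj a u v : u != v -> set_edge a u v (adj a u v) = a.
Proof. by move=> uv; rewrite /set_edge /adj uv /= upd_id. Qed.

(** After integration by parts, the increment of f (lead / s) along an edge is f'
    times that of lead / s up to the quadratic error Cf. The first-order terms add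
    up to f' * gamma / s^2, which is compared with f'; the errors add up to the
    third-order sum. *)
Lemma stein_lead (f f' : R -> R) (Bf Cf s : R) : 0 < s ->
  (forall x y : R, `|f y - f x - f' x * (y - x)| <= Cf * (y - x) ^+ 2) ->
  (forall x : R, `|f' x| <= Bf) ->
  `|EG (fun a => lead a / s * f (lead a / s)) - EG (fun a => f' (lead a / s))| <=
  Bf * EG (fun a => `|gamma a / s ^+ 2 - 1|) + Cf / s ^+ 3 * (p * q) *
  EG (fun a => \sum_u \sum_(v | u != v) `|half_del u v a| * lead_del u v a ^+ 2).
Proof.
move=> s0 fC fB; pose F a := f (lead a / s); pose F' a := f' (lead a / s).
have sV : 0 <= s^-1 by rewrite invr_ge0 ltW.
have fC' (x y : R) : `|f y - f x - f' y * (y - x)| <= Cf * (y - x) ^+ 2.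
  have e : f x - f y - f' y * (x - y) = - (f y - f x - f' y * (y - x)) by ring.
  by have := fC y x; rewrite e normrN (_ : (x - y) ^+ 2 = (y - x) ^+ 2) //; ring.
have step a u v : u != v ->
    `|del u v F a - F' a * (lead_del u v a / s)| <= Cf * (lead_del u v a / s) ^+ 2.
  move=> uv; rewrite -(lead_delE p k1 k3 a uv) /del mulrBl.
  rewrite /F /F' -{3}(set_edge_adj a uv); case: (adj a u v).
    exact: fC'.
  exact: fC.
have -> : EG (fun a => lead a / s * f (lead a / s)) = s^-1 * (p * q *
    \sum_u \sum_(v | u != v) EG (fun a => half_del u v a * del u v F a)).
  rewrite -lead_ibp // /EG -ExZ; apply: eq_Ex => a.
  by rewrite mulrA [s^-1 * _]mulrC.
have -> : EG (fun a => f' (lead a / s)) = EG (fun a => F' a * (gamma a / s ^+ 2)) -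
    EG (fun a => F' a * (gamma a / s ^+ 2 - 1)).
  rewrite /EG -ExB; apply: eq_Ex => a; rewrite /F'; move: (f' _) => t; ring.
have -> : EG (fun a => F' a * (gamma a / s ^+ 2)) = s^-1 * (p * q *
    \sum_u \sum_(v | u != v) EG (fun a => half_del u v a * (F' a * (lead_del u v a / s)))).
  have -> : \sum_u \sum_(v | u != v) EG (fun a => half_del u v a * (F' a * (lead_del u v a / s))) =
    EG (fun a => \sum_u \sum_(v | u != v) half_del u v a * (F' a * (lead_del u v a / s))).
    by rewrite /EG Ex_sum; apply: eq_bigr => u _; rewrite Ex_sum.
  rewrite /EG -!ExZ; apply: eq_Ex => a; rewrite /gamma.
  rewrite -!mulrA !mulr_suml !mulr_sumr; apply: eq_bigr => u _.
  rewrite !mulr_suml !mulr_sumr; apply: eq_bigr => v _.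
  move: (half_del _ _ _) (lead_del _ _ _) (F' a) => h l t.
  by field; rewrite gt_eqF.
rewrite opprB addrA addrAC -mulrBr -mulrBr addrC.
apply: le_trans (ler_normD _ _) _; apply: lerD.
  apply: le_trans (ler_norm_Ex (edge_p01 p01) _) _; rewrite /EG -ExZ; apply: le_EG => // a.
  by rewrite normrM ler_wpM2r // fB.
rewrite -sumrB normrM (ger0_norm sV) normrM ger0_norm ?mulr_ge0 //.
have -> : Cf / s ^+ 3 * (p * q) * EG (fun a => \sum_u \sum_(v | u != v)
    `|half_del u v a| * lead_del u v a ^+ 2) = s^-1 * (p * q * (Cf / s ^+ 2 *
    EG (fun a => \sum_u \sum_(v | u != v) `|half_del u v a| * lead_del u v a ^+ 2))).
  by move: (EG _) => t; field; rewrite gt_eqF.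
rewrite ler_wpM2l // ler_wpM2l ?mulr_ge0 //.
rewrite /EG -ExZ; apply: le_trans (ler_norm_sum _ _ _) _.
apply: (@le_trans _ _ (\sum_u \sum_(v | u != v) EG (fun a => Cf / s ^+ 2 *
  (`|half_del u v a| * lead_del u v a ^+ 2)))).
  apply: ler_sum => u _; rewrite -sumrB; apply: le_trans (ler_norm_sum _ _ _) _.
  apply: ler_sum => v uv; rewrite /EG -ExB.
  apply: le_trans (ler_norm_Ex (edge_p01 p01) _) _; apply: le_EG => // a.
  rewrite -mulrBr normrM [leRHS]mulrCA ler_wpM2l //.
  by apply: le_trans (step a u v uv) _; rewrite exprMn exprVn mulrA mulrAC.
rewrite le_eqVlt; apply/orP; left; apply/eqP.
rewrite [RHS](_ : _ = EG (fun a => \sum_u \sum_(v | u != v) Cf / s ^+ 2 *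
  (`|half_del u v a| * lead_del u v a ^+ 2))).
  by rewrite /EG Ex_sum; apply: eq_bigr => u _; rewrite Ex_sum.
apply: eq_Ex => a; rewrite mulr_sumr; apply: eq_bigr => u _; by rewrite mulr_sumr.
Qed.

End Lead.
End SteinIdentity.

(** * The closure coefficient as linear statistic plus remainder *)

Section ClosureDecomposition.
Context {R : realFieldType} {n : nat} (p : R).
Hypothesis p0 : 0 <= p.
Hypothesis p_half : p <= 1 / 2.
Implicit Types (u v i j k : 'I_n) (a : @graph n) (M K m : R).
Local Notation deg := (deg (R := R)).
Local Notation cod := (cod (R := R)).
Local Notation paths := (paths (R := R)).
Local Notation closed_paths := (closed_paths (R := R)).
Local Notation nu := (@paths_mean R n p).
Local Notation EG := (@EG R n p).

Let p01 : 0 <= p <= 1.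
Proof. by rewrite p0 (le_trans p_half) // ler_pdivrMr ?mul1r ?ler1n. Qed.

Definition closure_coef a : R := n%:R^-1 * \sum_i closed_paths a i / paths a i.
(** The weights of triangles and edges that the linearization produces. *)
Definition k3 : R := (n%:R * nu)^-1.
Definition k1 : R := k3 * (p ^+ 2 * (n%:R - 2)).
(** The value of closure_coef when no truncation is active (closure_approxE). *)
Definition closure_approx a : R :=
  p + lead p k1 k3 a + 2 * p * k3 * y_paths p a - n%:R^-1 * lin_errs p a.

Lemma paths_xe a i : paths a i = \sum_j xe a i j * (deg a j - xe a j i).
Proof.
apply: eq_bigr => j _; rewrite -(sum_delta i (fun k => xe a j k)) -sumrB mulr_sumr.
apply: eq_bigr => k _; rewrite -mulrA [i == k]eq_sym; congr (_ * _).
by case: (k == i); rewrite /= ?mul0r ?mul1r ?mulr0 ?mulr1 ?subrr ?subr0.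
Qed.

Lemma closed_le_paths a i : 0 <= closed_paths a i <= paths a i.
Proof.
apply/andP; split.
  by apply: sumr_ge0 => j _; apply: sumr_ge0 => k _; rewrite !mulr_ge0 ?xe_ge0.
apply: ler_sum => j _; apply: ler_sum => k _.
case: (eqVneq i k) => [->|_]; first by rewrite xe_diag !mulr0.
by rewrite mulr1 ler_piMr ?mulr_ge0 ?xe_ge0 ?xe_le1.
Qed.

Lemma paths_le_sqr a i : paths a i <= n%:R ^+ 2.
Proof.
have -> : n%:R ^+ 2 = \sum_(j < n) \sum_(k < n) 1 :> R.
  by rewrite !sumr_const !card_ord; ring.
apply: ler_sum => j _; apply: ler_sum => k _.
rewrite -[leRHS]mulr1; apply: ler_pM; rewrite ?mulr_ge0 ?xe_ge0 ?ler0n ?lern1 ?leq_b1 //.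
by rewrite -[leRHS]mulr1; apply: ler_pM; rewrite ?xe_ge0 ?xe_le1.
Qed.

(** Each neighbour of i has at least m - 1 >= m / 2 neighbours other than i. *)
Lemma paths_ge m a i : 2 <= m -> (forall u, m <= deg a u) -> m ^+ 2 / 2 <= paths a i.
Proof.
move=> m2 h; rewrite paths_xe.
apply: (@le_trans _ _ (\sum_j xe a i j * (m / 2))).
  rewrite -mulr_suml expr2 -mulrA ler_wpM2r ?divr_ge0 //; last exact: h.
  exact: le_trans m2.
apply: ler_sum => j _; apply: ler_wpM2l; first exact: xe_ge0.
have := h j; have := xe_le1 (R := R) a j i; lra.
Qed.

Lemma closure_bounds a : 0 <= closure_coef a <= 1.
Proof.
have h i : 0 <= closed_paths a i / paths a i <= 1.
  have /andP[c0 cp] := closed_le_paths a i.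
  rewrite divr_ge0 ?(le_trans c0) //=.
  have : 0 <= paths a i by exact: le_trans cp.
  rewrite le_eqVlt => /predU1P[<-|P0]; first by rewrite invr0 mulr0.
  by rewrite ler_pdivrMr // mul1r.
rewrite /closure_coef mulr_ge0 ?invr_ge0 ?ler0n ?sumr_ge0 //=; last first.
  by move=> i _; case/andP: (h i).
case: (posnP n) => [n0|n0].
  by rewrite big1 ?mulr0 // => i _; exfalso; have := ltn_ord i; lia.
rewrite ler_pdivrMl ?ltr0n // mulr1.
have -> : n%:R = \sum_(k < n) 1 :> R by rewrite sumr_const card_ord.
by apply: ler_sum => i _; case/andP: (h i).
Qed.

Hypothesis n3 : (2 < n)%N.
Hypothesis nu1 : 1 <= nu.

Let nu_gt0 : 0 < nu. Proof. exact: lt_le_trans ltr01 nu1. Qed.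
Let n0 : 0 < n%:R :> R. Proof. by rewrite ltr0n; case: n n3. Qed.

Lemma nu_le_sqr : nu <= n%:R ^+ 2.
Proof.
have n2 : 2 <= n%:R :> R by rewrite ler_nat ltnW.
rewrite /paths_mean; have h : p ^+ 2 <= 1 by rewrite exprn_ile1 //; case/andP: p01.
apply: (@le_trans _ _ ((n%:R - 1) * (n%:R - 2))); last by nra.
by rewrite ler_piMr // mulr_ge0 // subr_ge0 // ler1n (ltn_trans _ n3).
Qed.

Lemma k3_ge0 : 0 <= k3.
Proof. by rewrite invr_ge0 mulr_ge0 ?(ltW nu_gt0). Qed.

Lemma k1_ge0 : 0 <= k1.
Proof.
rewrite mulr_ge0 ?k3_ge0 // mulr_ge0 ?sqr_ge0 // subr_ge0 ler_nat.
exact: ltnW.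
Qed.

(** Sum ratio_linearization over the nodes; centered_expansion then extracts the
    linear statistic. *)
Lemma closure_approxE a : (forall i, nu / 32 <= paths a i) ->
  closure_coef a = closure_approx a.
Proof.
move=> h; rewrite /closure_coef.
under eq_bigr => i _.
  have tE : trunc nu (paths a i) = paths a i by apply/max_idPl.
  have := ratio_linearization p (closed_paths a i) (paths a i) nu_gt0.
  rewrite tE => ->; over.
rewrite sumrB big_split /= sumr_const card_ord -mulr_suml sumrB -mulr_sumr.
rewrite centered_expansion /closure_approx /lead /k1 /k3 -/(lin_errs p a).
move: (y_triangles _ _) (y_paths _ _) (y_edges _ _) (lin_errs _ _) => t s e l.
have := nu_gt0; move: nu => w w0; field.
by rewrite !gt_eqF.
Qed.

Lemma lin_err_bound a i : `|lin_err p nu (closed_paths a i) (paths a i)| <= 66 * n%:R ^+ 2.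
Proof.
have T0 := trunc_gt0 (paths a i) nu_gt0; have iT := inv_trunc_le (paths a i) nu_gt0.
have hT : trunc nu (paths a i) <= n%:R ^+ 2.
  rewrite /trunc ge_max paths_le_sqr /=; have := nu_le_sqr; have := nu_gt0; lra.
have /andP[c0 cp] := closed_le_paths a i; have pl := paths_le_sqr a i.
have pT : p * trunc nu (paths a i) <= n%:R ^+ 2.
  apply: le_trans hT; rewrite ler_piMl ?(ltW T0) //; by case/andP: p01.
rewrite /lin_err normrM (_ : 66 * n%:R ^+ 2 = 33 * (2 * n%:R ^+ 2)); last by ring.
have nV : nu^-1 <= 1 by rewrite invf_le1.
have nV0 : 0 < nu^-1 by rewrite invr_gt0.
have TV0 : 0 < (trunc nu (paths a i))^-1 by rewrite invr_gt0.
have pT0 : 0 <= p * trunc nu (paths a i) by rewrite mulr_ge0 ?(ltW T0).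
apply: ler_pM => //.
  by apply: le_trans (ler_normB _ _) _; rewrite !gtr0_norm //; lra.
apply: le_trans (ler_normB _ _) _; rewrite !ger0_norm //; lra.
Qed.

(** A crude bound on all graphs suffices, as it is multiplied by the probability of
    irregular graphs. *)
Lemma closure_approx_bound a : `|closure_approx a| <= 69 * n%:R ^+ 2.
Proof.
have n1 : 1 <= n%:R :> R by rewrite ler1n (ltn_trans _ n3).
have n21 : 1 <= n%:R ^+ 2 :> R by rewrite exprn_ege1.
(* undoing centered_expansion gives averages of ratios, each easy to bound *)
have -> : closure_approx a = p + n%:R^-1 * (\sum_i closed_paths a i / nu) -
    p * (n%:R^-1 * \sum_i paths a i / nu) - n%:R^-1 * lin_errs p a.
  have := centered_expansion p a; rewrite -!mulr_suml /closure_approx /lead /k1 /k3.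
  move: (y_triangles _ _) (y_paths _ _) (y_edges _ _) (lin_errs _ _) => t s e l.
  move: (\sum_i _) (\sum_i _) => P C.
  have := nu_gt0; move: nu => w w0 E.
  have -> : C = p * P + (t + 2 * p * s + p ^+ 2 * (n%:R - 2) * e) by rewrite -E addrC subrK.
  by field; rewrite !gt_eqF.
have avg (F : 'I_n -> R) C : (forall i, `|F i| <= C) -> `|n%:R^-1 * \sum_i F i| <= C.
  move=> FC; rewrite normrM gtr0_norm ?invr_gt0 // ler_pdivrMl //.
  apply: le_trans (ler_norm_sum _ _ _) _; apply: le_trans (ler_sum _ (fun i _ => FC i)) _.
  by rewrite sumr_const card_ord mulr_natl.
have b1 : `|n%:R^-1 * (\sum_i closed_paths a i / nu)| <= n%:R ^+ 2.
  apply: avg => i; have /andP[c0 cp] := closed_le_paths a i.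
  rewrite ger0_norm ?divr_ge0 ?(ltW nu_gt0) // ler_pdivrMr //.
  apply: le_trans cp _; apply: le_trans (paths_le_sqr a i) _.
  by rewrite ler_peMr ?sqr_ge0.
have b2 : `|n%:R^-1 * \sum_i paths a i / nu| <= n%:R ^+ 2.
  apply: avg => i; have /andP[c0 cp] := closed_le_paths a i.
  rewrite ger0_norm ?divr_ge0 ?(ltW nu_gt0) ?(le_trans c0) // ler_pdivrMr //.
  by apply: le_trans (paths_le_sqr a i) _; rewrite ler_peMr ?sqr_ge0.
have b3 : `|n%:R^-1 * lin_errs p a| <= 66 * n%:R ^+ 2.
  by apply: avg => i; exact: lin_err_bound.
have p1 : p <= 1 by case/andP: p01.
have b4 : `|p * (n%:R^-1 * \sum_i paths a i / nu)| <= n%:R ^+ 2.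
  apply: le_trans b2; rewrite normrM (ger0_norm p0) ler_piMl //.
move: b1 b3 b4 n21 p0; rewrite !ler_norml => /andP[? ?] /andP[? ?] /andP[? ?] ? ?.
by apply/andP; split; lra.
Qed.

(** The mean is the best constant approximation in mean square. *)
Lemma Ex_var_le (I : finType) (pp : I -> R) (f : {ffun I -> bool} -> R) c :
  Ex pp (fun x => (f x - Ex pp f) ^+ 2) <= Ex pp (fun x => (f x - c) ^+ 2).
Proof. rewrite !Ex_sqrB; have := sqr_ge0 (Ex pp f - c); nra. Qed.

Section Good.
Context (M K m : R) (good : pred (@graph n)).
Hypothesis goodP : forall a, good a -> sparse M K a /\ (forall u, m <= deg a u).
Hypothesis K0 : 0 <= K.
Hypothesis pnM : p * n%:R <= M.
Hypothesis m2 : 2 <= m.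
Hypothesis nu_m : nu <= 16 * m ^+ 2.
Let bad_prob := EG (fun a => (~~ good a)%:R).
Let bad_prob_ge0 : 0 <= bad_prob. Proof. by apply: EG_ge0 => // a; rewrite ler0n. Qed.
Let M0 : 0 <= M. Proof. by apply: le_trans pnM; rewrite mulr_ge0. Qed.

(** All that is negligible at the scale sigma: the centred 2-paths, the errors of
    linearization, and the effect of the truncation. *)
Definition remainder a : R := closure_coef a - lead p k1 k3 a.

Lemma EG_total_cost :
  EG (total_cost p) <=
  (72 * p * K * M ^+ 2 + 64 * p ^+ 2 * M ^+ 3) *
    (n%:R * (p * (16 * n%:R * M ^+ 2 + 16 * n%:R ^+ 3 * bad_prob))) +
  32 * M ^+ 3 * (n%:R * (p * (36 * K * M ^+ 2 + 36 * n%:R ^+ 3 * bad_prob))) +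
  168 * n%:R ^+ 8 * bad_prob.
Proof.
have sp a : good a -> sparse M K a by move=> /goodP[].
have c1 : 0 <= 72 * p * K * M ^+ 2 + 64 * p ^+ 2 * M ^+ 3.
  by apply: addr_ge0; rewrite mulr_ge0 ?exprn_ge0 // !mulr_ge0 ?exprn_ge0.
have c2 : 0 <= 32 * M ^+ 3 by rewrite mulr_ge0 ?exprn_ge0.
have S0 (F : 'I_n -> R) : 0 <= \sum_i F i ^+ 2.
  by apply: sumr_ge0 => i _; exact: sqr_ge0.
have p1 : p <= 1 by case/andP: p01.
have nn : 0 <= n%:R :> R by exact: ltW.
have p2 : p ^+ 2 <= 1 by rewrite exprn_ile1.
apply: (@le_trans _ _ (EG (fun a => (72 * p * K * M ^+ 2 + 64 * p ^+ 2 * M ^+ 3) *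
    (\sum_i dev_paths p a i ^+ 2) + 32 * M ^+ 3 * \sum_i dev_closed p a i ^+ 2) +
    168 * n%:R ^+ 8 * bad_prob)).
  have C0 : 0 <= 168 * n%:R ^+ 8 :> R by rewrite mulr_ge0 ?exprn_ge0.
  apply: (le_EG_outside p01 C0) => [a /sp sa|a|a].
  - exact: total_cost_le.
  - apply: le_trans (total_cost_le p0 (sparse_n a) _ _) _ => //; first by rewrite ler_piMl.
    have dev : \sum_i dev_paths p a i ^+ 2 <= n%:R ^+ 5.
      apply: (@le_trans _ _ (\sum_(i < n) n%:R ^+ 4)); last first.
        by rewrite sumr_const card_ord le_eqVlt; apply/orP; left; apply/eqP; ring.
      apply: ler_sum => i _; have n4 : n%:R ^+ 4 = (n%:R ^+ 2) ^+ 2 :> R by ring.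
      rewrite n4.
      rewrite lerXn2r ?nnegrE ?normr_ge0 ?exprn_ge0 // ler_norml.
      have := paths_le_sqr a i; have /andP[c0 cp] := closed_le_paths a i.
      have := nu_le_sqr; have := nu_gt0.
      by move=> ? ? ?; apply/andP; split; lra.
    have dev' : \sum_i dev_closed p a i ^+ 2 <= n%:R ^+ 5.
      apply: (@le_trans _ _ (\sum_(i < n) n%:R ^+ 4)); last first.
        by rewrite sumr_const card_ord le_eqVlt; apply/orP; left; apply/eqP; ring.
      apply: ler_sum => i _; have n4 : n%:R ^+ 4 = (n%:R ^+ 2) ^+ 2 :> R by ring.
      rewrite n4.
      rewrite lerXn2r ?nnegrE ?normr_ge0 ?exprn_ge0 // ler_norml.
      have := paths_le_sqr a i; have /andP[c0 cp] := closed_le_paths a i.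
      have pnu : p * nu <= nu by rewrite ler_piMl ?(ltW nu_gt0).
      have pnu0 : 0 <= p * nu by rewrite mulr_ge0 ?(ltW nu_gt0).
      have := nu_le_sqr; have := nu_gt0.
      by move=> ? ? ?; apply/andP; split; lra.
    have b1 : 72 * p * n%:R * n%:R ^+ 2 + 64 * p ^+ 2 * n%:R ^+ 3 <= 136 * n%:R ^+ 3.
      rewrite (_ : _ + _ = (72 * p + 64 * p ^+ 2) * n%:R ^+ 3); last by ring.
      by rewrite ler_wpM2r ?exprn_ge0 //; lra.
    have b0 : 0 <= 72 * p * n%:R * n%:R ^+ 2 + 64 * p ^+ 2 * n%:R ^+ 3.
      by apply: addr_ge0; rewrite mulr_ge0 ?exprn_ge0 // !mulr_ge0 ?exprn_ge0.
    have -> : 168 * n%:R ^+ 8 = 136 * n%:R ^+ 3 * n%:R ^+ 5 + 32 * n%:R ^+ 3 * n%:R ^+ 5 :> R.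
      by ring.
    apply: lerD; first exact: ler_pM.
    by rewrite ler_wpM2l // mulr_ge0 ?exprn_ge0.
  - by rewrite addr_ge0 // mulr_ge0.
rewrite lerD2r /EG ExD !ExZ !Ex_sum; apply: lerD.
  apply: ler_wpM2l => //.
  apply: (@le_trans _ _ (\sum_(i < n) p * (16 * n%:R * M ^+ 2 + 16 * n%:R ^+ 3 * bad_prob))).
    apply: ler_sum => i _; apply: le_trans (var_paths p01 sp i).
    by rewrite /EG le_eqVlt; apply/orP; left; apply/eqP; apply: eq_Ex => a;
      rewrite /dev_paths real_normK ?num_real.
  by rewrite sumr_const card_ord -[X in X <= _]mulr_natl.
apply: ler_wpM2l => //.
apply: (@le_trans _ _ (\sum_(i < n) p * (36 * K * M ^+ 2 + 36 * n%:R ^+ 3 * bad_prob))).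
  apply: ler_sum => i _; apply: le_trans (var_closed_paths p01 sp i K0).
  by rewrite /EG le_eqVlt; apply/orP; left; apply/eqP; apply: eq_Ex => a;
    rewrite /dev_closed real_normK ?num_real.
by rewrite sumr_const card_ord -[X in X <= _]mulr_natl.
Qed.

Lemma var_remainder : EG (fun a => (remainder a - EG remainder) ^+ 2) <=
  3 * (128 * p ^+ 4 * k3 ^+ 2 * n%:R ^+ 3 +
       3 * (n%:R^-1 * (32 ^+ 2 / nu ^+ 2)) ^+ 2 * EG (total_cost p) +
       (70 * n%:R ^+ 2) ^+ 2 * bad_prob).
Proof.
pose A a := 2 * p * k3 * (y_paths p a - EG (y_paths p)).
pose B a := n%:R^-1 * (lin_errs p a - EG (lin_errs p)).
pose C a := closure_coef a - closure_approx a.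
apply: le_trans (Ex_var_le (edge_p p) remainder (p + 2 * p * k3 * EG (y_paths p) -
   n%:R^-1 * EG (lin_errs p))) _.
apply: (@le_trans _ _ (EG (fun a => 3 * (A a ^+ 2 + B a ^+ 2 + C a ^+ 2)))).
  apply: le_EG => // a.
  have -> : remainder a - (p + 2 * p * k3 * EG (y_paths p) - n%:R^-1 * EG (lin_errs p)) =
      A a - B a + C a.
    rewrite /remainder /A /B /C /closure_approx.
    move: (closure_coef a) (lead _ _ _ _) (y_paths _ _) (EG _) (EG _) (lin_errs _ _) => *; ring.
  move: (A a) (B a) (C a) => x y z.
  have := sqr_ge0 (x + y); have := sqr_ge0 (x - z); have := sqr_ge0 (y + z).
  by rewrite !expr2; nra.
rewrite /EG ExZ ler_wpM2l // !ExD; apply: lerD; first apply: lerD.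
- have -> : 128 * p ^+ 4 * k3 ^+ 2 * n%:R ^+ 3 =
    (2 * p * k3) ^+ 2 * (32 * n%:R ^+ 3 * p ^+ 2) by ring.
  rewrite /A; under eq_Ex do rewrite exprMn.
  by rewrite ExZ ler_wpM2l ?sqr_ge0 // var_y_paths.
- rewrite /B; under eq_Ex do rewrite exprMn.
  rewrite [(n%:R^-1 * (32 ^+ 2 / nu ^+ 2)) ^+ 2]exprMn [3 * (_ * _)]mulrCA -[leRHS]mulrA.
  by rewrite ExZ ler_wpM2l ?sqr_ge0 // var_lin_errs_cost.
rewrite -[leRHS]add0r -[X in _ <= X + _](Ex_cst (edge_p (n := n) p) 0).
have C0 : 0 <= (70 * n%:R ^+ 2) ^+ 2 :> R by exact: sqr_ge0.
apply: (le_EG_outside p01 C0) => [a ga|a|a] //.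
- have [_ dm] := goodP ga; rewrite /C closure_approxE ?subrr ?expr0n //= => i.
  by apply: le_trans (paths_ge i m2 dm); move: nu_m; lra.
have /andP[h0 h1] := closure_bounds a; have := closure_approx_bound a.
have n21 : 1 <= n%:R ^+ 2 :> R by rewrite exprn_ege1 // ler1n (ltn_trans _ n3).
rewrite ler_norml => /andP[? ?].
have hC : `|C a| <= 70 * n%:R ^+ 2.
  by rewrite /C ler_norml; apply/andP; split; lra.
by rewrite -real_normK ?num_real // lerXn2r ?nnegrE ?normr_ge0 // (le_trans _ hC).
Qed.

End Good.

Lemma EG_remainder : EG remainder = EG closure_coef.
Proof. by rewrite /EG ExB [X in _ - X]EG_lead subr0. Qed.

End ClosureDecomposition.

(** * Regularity of the random graph *)

Section ExponentialMoments.
Context {R : realFieldType} {n : nat} (p : R).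
Implicit Types (u v k : 'I_n) (s : seq 'I_n).
Local Notation EG := (@EG R n p).

(** The factors read different edges, hence are independent; EG_xe_ignores removes
    them one at a time. *)
Lemma EG_prod_deg t u s : uniq s -> u \notin s ->
  EG (fun a => \prod_(k <- s) (1 + t * xe a u k)) = (1 + t * p) ^+ size s.
Proof.
elim: s => [_ _|k s IH /= /andP[ks us]].
  by rewrite /EG; under eq_Ex do rewrite big_nil; rewrite Ex_cst.
rewrite inE negb_or => /andP[uk us'].
transitivity (EG (fun a => \prod_(j <- s) (1 + t * xe a u j)) +
  t * EG (fun a => xe a u k * \prod_(j <- s) (1 + t * xe a u j))).
  rewrite /EG -ExZ -ExD; apply: eq_Ex => a; rewrite big_cons; move: (\prod_(j <- s) _) => w; ring.
rewrite EG_xe_ignores //; first by rewrite IH // exprS; ring.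
move=> a b; apply: eq_big_seq => j js; rewrite xe_set_neq // eqxx /= negb_or.
apply/andP; split; first by apply: contraNneq ks => <-.
by rewrite (negPf uk).
Qed.

(** The paths u k v with different k share no edge. *)
Lemma EG_prod_cod t u v s : u != v -> uniq s -> u \notin s -> v \notin s ->
  EG (fun a => \prod_(k <- s) (1 + t * (xe a u k * xe a k v))) =
  (1 + t * p ^+ 2) ^+ size s.
Proof.
move=> uv; elim: s => [_ _ _|k s IH /= /andP[ks us]].
  by rewrite /EG; under eq_Ex do rewrite big_nil; rewrite Ex_cst.
rewrite !inE !negb_or => /andP[uk us'] /andP[vk vs].
transitivity (EG (fun a => \prod_(j <- s) (1 + t * (xe a u j * xe a j v))) +
  t * EG (fun a => xe a u k * (xe a k v * \prod_(j <- s) (1 + t * (xe a u j * xe a j v))))).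
  rewrite /EG -ExZ -ExD; apply: eq_Ex => a; rewrite big_cons; move: (\prod_(j <- s) _) => w; ring.
have vu : v == u = false by rewrite eq_sym (negPf uv).
have ku : k == u = false by rewrite eq_sym (negPf uk).
have kv : k == v = false by rewrite eq_sym (negPf vk).
have ign (w z : 'I_n) : (w == k) && ((z == u) || (z == v)) || (z == k) && ((w == u) || (w == v)) ->
    ignores w z (fun a => \prod_(j <- s) (1 + t * (xe a u j * xe a j v)) : R).
  move=> wz a b; apply: eq_big_seq => j js.
  have jk : j == k = false by apply: contraNF ks => /eqP <-.
  have ju : j == u = false by apply: contraNF us' => /eqP <-.
  have jv : j == v = false by apply: contraNF vs => /eqP <-.
  congr (1 + t * (_ * _)); apply: xe_set_neq; apply: contraT; rewrite negbK.
    by case/orP: wz => /andP[/eqP -> /orP[]/eqP ->]; rewrite ?jk ?ju ?jv ?eqxx ?(negPf uk) ?(negPf uv) ?andbF ?andFb.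
  by case/orP: wz => /andP[/eqP -> /orP[]/eqP ->]; rewrite ?jk ?ju ?jv ?eqxx ?(negPf vk) ?vu ?andbF ?andFb.
rewrite EG_xe_ignores //; last first.
  move=> a b; rewrite ign ?eqxx ?orbT // xe_set_neq //.
  by rewrite ku vu !andbF.
rewrite EG_xe_ignores ?kv //; last by apply: ign; rewrite !eqxx orbT.
by rewrite IH // [RHS]exprS; ring.
Qed.

End ExponentialMoments.

Section IrregularGraphs.
Context {R : realType} {n : nat} (p theta : R).
Hypothesis p01 : 0 <= p <= 1.
Implicit Types (u v k : 'I_n) (a : @graph n).
Local Notation deg := (deg (R := R)).
Local Notation cod := (cod (R := R)).
Local Notation EG := (@EG R n p).

Let p0 : 0 <= p. Proof. by case/andP: p01. Qed.

Definition min_deg : R := (n%:R - 1) * p / 4.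
Definition max_deg : R := 4 * n%:R * p.
Definition max_cod : R := 3 * n%:R * p ^+ 2 + theta.

Definition regular a : bool :=
  [forall u, (min_deg <= deg a u) && (deg a u <= max_deg)] &&
  [forall u, forall v, (u != v) ==> (cod a u v <= max_cod)].

Lemma regularP a : regular a ->
  sparse max_deg max_cod a /\ (forall u, min_deg <= deg a u).
Proof.
case/andP => /forallP h1 /forallP h2; split; first split.
- by move=> u; case/andP: (h1 u).
- by move=> u v uv; move/forallP: (h2 u) => /(_ v) /implyP; exact.
- by move=> u; case/andP: (h1 u).
Qed.

Lemma expR1_ge2 : 2 <= expR 1 :> R.
Proof. by have := expR_ge1Dx (1 : R); lra. Qed.

Lemma expR1_le4 : expR 1 <= 4 :> R.
Proof.
have h : 1 / 2 <= expR (- (1 / 2)) :> R by have := expR_ge1Dx (- (1 / 2) : R); lra.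
have -> : expR 1 = (expR (1 / 2)) ^+ 2 :> R by rewrite expr2 -expRD; congr expR; lra.
have -> : expR (1 / 2) = (expR (- (1 / 2)))^-1 :> R by rewrite expRN invrK.
have -> : 4 = ((1 / 2)^-1) ^+ 2 :> R by field.
have h2 : 0 < 1 / 2 :> R by lra.
by rewrite lerXn2r ?nnegrE ?invr_ge0 ?expR_ge0 ?(ltW h2) // lef_pV2 ?posrE ?expR_gt0.
Qed.

Lemma pow_le_expR (t : R) (N : nat) : 0 <= 1 + t -> (1 + t) ^+ N <= expR (t * N%:R).
Proof.
move=> t0; rewrite mulrC expRM_natl lerXn2r ?nnegrE ?expR_ge0 //.
exact: expR_ge1Dx.
Qed.

Lemma expR_bool (c : R) (b : bool) : expR (c * b%:R) = 1 + (expR c - 1) * b%:R.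
Proof. by case: b => /=; rewrite ?mulr1 ?mulr0 ?expR0 ?addr0 // addrC subrK. Qed.

Lemma EG_expR_deg c u :
  EG (fun a => expR (c * deg a u)) = (1 + (expR c - 1) * p) ^+ n.-1.
Proof.
pose s := [seq k <- enum 'I_n | k != u].
have us : u \notin s by rewrite mem_filter eqxx.
have Us : uniq s by rewrite filter_uniq // enum_uniq.
have -> : n.-1 = size s.
  rewrite size_filter -[n in LHS]card_ord cardE.
  have := count_predC (pred1 u) (enum 'I_n).
  by rewrite count_uniq_mem ?enum_uniq // mem_enum /= => <-.
rewrite -(EG_prod_deg p (expR c - 1) Us us); apply: eq_Ex => a.
rewrite /deg mulr_sumr expR_sum big_filter big_enum_cond /= big_mkcond [RHS]big_mkcond /=.
apply: eq_bigr => k _; case: eqVneq => [->|_]; first by rewrite xe_diag mulr0 expR0.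
by rewrite expR_bool.
Qed.

(** The factor 3 bounds exp(1) - 1. *)
Lemma EG_expR_cod u v : u != v ->
  EG (fun a => expR (cod a u v)) <= expR (3 * n%:R * p ^+ 2).
Proof.
move=> uv; pose s := [seq k <- enum 'I_n | (k != u) && (k != v)].
have us : u \notin s by rewrite mem_filter eqxx.
have vs : v \notin s by rewrite mem_filter eqxx andbF.
have Us : uniq s by rewrite filter_uniq // enum_uniq.
have ss : (size s <= n)%N by rewrite size_filter -[leqRHS]size_enum_ord count_size.
have e2 := expR1_ge2; have e4 := expR1_le4.
have -> : EG (fun a => expR (cod a u v)) =
    EG (fun a => \prod_(k <- s) (1 + (expR 1 - 1) * (xe a u k * xe a k v))).
  apply: eq_Ex => a; rewrite /cod expR_sum big_filter big_enum_cond /= [RHS]big_mkcond /=.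
  apply: eq_bigr => k _; case: eqVneq => [->|_] /=; first by rewrite xe_diag mul0r expR0.
  case: eqVneq => [->|_] /=; first by rewrite xe_diag mulr0 expR0.
  by rewrite /xe -natrM mulnb -[X in expR X]mul1r expR_bool.
rewrite EG_prod_cod //; apply: le_trans (pow_le_expR _ _) _.
  by rewrite addr_ge0 // mulr_ge0 ?sqr_ge0 //; lra.
rewrite ler_expR mulrAC ler_wpM2r ?sqr_ge0 //.
by apply: ler_pM; rewrite ?ler_nat ?ler0n //; lra.
Qed.

(** Markov's inequality for the exponential moments, with a union bound over the
    nodes and the pairs of nodes. *)
Lemma EG_irregular : (0 < n)%N -> theta <= min_deg -> theta <= n%:R * p ->
  EG (fun a => (~~ regular a)%:R) <= 3 * n%:R ^+ 2 * expR (- theta).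
Proof.
move=> n0 th1 th2; have e2 := expR1_ge2; have e4 := expR1_le4.
have n1 : 1 <= n%:R :> R by rewrite ler1n.
have hn : n.-1%:R = n%:R - 1 :> R by rewrite -subn1 natrB.
(* min_deg and max_deg are about a fourth and four times the mean degree: both tails
   cost a constant times n p in the exponent, hence at least theta *)
have lo u : EG (fun a => expR (min_deg - deg a u)) <= expR (- theta).
  have -> : EG (fun a => expR (min_deg - deg a u)) =
      expR min_deg * EG (fun a => expR (- 1 * deg a u)).
    by rewrite /EG -ExZ; apply: eq_Ex => a; rewrite -expRD mulN1r.
  rewrite EG_expR_deg -{1}[min_deg]opprK.
  have eV : expR (- 1) <= 1 / 2 :> R.
    by rewrite expRN -[1/2]invrK lef_pV2 ?posrE ?expR_gt0 //; lra.
  have eV0 := expR_gt0 (- 1 : R).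
  have := @pow_le_expR ((expR (- 1) - 1) * p) n.-1; rewrite hn => h.
  apply: le_trans (ler_wpM2l (expR_ge0 _) (h _)) _; first by case/andP: p01 => *; nra.
  rewrite -expRD ler_expR opprK; move: th1; rewrite /min_deg.
  have : (expR (- 1) - 1) * p * (n%:R - 1) <= - (1 / 2) * (p * (n%:R - 1)).
    by rewrite -mulrA ler_wpM2r ?mulr_ge0 ?subr_ge0 //; lra.
  lra.
have hi u : EG (fun a => expR (deg a u - max_deg)) <= expR (- theta).
  have -> : EG (fun a => expR (deg a u - max_deg)) =
      expR (- max_deg) * EG (fun a => expR (1 * deg a u)).
    by rewrite /EG -ExZ; apply: eq_Ex => a; rewrite -expRD mul1r addrC.
  rewrite EG_expR_deg.
  have := @pow_le_expR ((expR 1 - 1) * p) n.-1; rewrite hn => h.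
  apply: le_trans (ler_wpM2l (expR_ge0 _) (h _)) _; first by rewrite addr_ge0 // mulr_ge0 //; lra.
  rewrite -expRD ler_expR /max_deg.
  have : (expR 1 - 1) * p * (n%:R - 1) <= 3 * (p * n%:R).
    by rewrite -mulrA; apply: ler_pM; rewrite ?mulr_ge0 ?subr_ge0 ?ler_wpM2l //; lra.
  lra.
have co u v : u != v -> EG (fun a => expR (cod a u v - max_cod)) <= expR (- theta).
  move=> uv.
  have -> : EG (fun a => expR (cod a u v - max_cod)) =
      expR (- max_cod) * EG (fun a => expR (cod a u v)).
    by rewrite /EG -ExZ; apply: eq_Ex => a; rewrite -expRD addrC.
  apply: le_trans (ler_wpM2l (expR_ge0 _) (EG_expR_cod uv)) _.
  by rewrite -expRD ler_expR /max_cod; lra.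
apply: (@le_trans _ _ (EG (fun a => \sum_u expR (min_deg - deg a u) +
   \sum_u expR (deg a u - max_deg) +
   \sum_u \sum_(v | u != v) expR (cod a u v - max_cod)))).
  apply: le_EG => // a.
  have S1 : 0 <= \sum_u expR (min_deg - deg a u) by apply: sumr_ge0 => u _; exact: expR_ge0.
  have S2 : 0 <= \sum_u expR (deg a u - max_deg) by apply: sumr_ge0 => u _; exact: expR_ge0.
  have S3 u : 0 <= \sum_(v | u != v) expR (cod a u v - max_cod).
    by apply: sumr_ge0 => v _; exact: expR_ge0.
  have S3' : 0 <= \sum_u \sum_(v | u != v) expR (cod a u v - max_cod) by exact: sumr_ge0.
  have ex (x : R) : 0 <= x -> 1 <= expR x by move=> x0; have := expR_ge1Dx x; lra.
  case: (boolP (regular a)) => /= [_|]; first by rewrite !addr_ge0.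
  rewrite negb_and => /orP[|] /forallPn[u].
    rewrite negb_and -!ltNge => /orP[h|h].
      have : 1 <= \sum_u expR (min_deg - deg a u); last by lra.
      rewrite (bigD1 u) //=; have := ex (min_deg - deg a u).
      rewrite subr_ge0 => /(_ (ltW h)); have : 0 <= \sum_(i | i != u) expR (min_deg - deg a i).
        by apply: sumr_ge0 => i _; exact: expR_ge0.
      lra.
    have : 1 <= \sum_u expR (deg a u - max_deg); last by lra.
    rewrite (bigD1 u) //=; have := ex (deg a u - max_deg).
    rewrite subr_ge0 => /(_ (ltW h)); have : 0 <= \sum_(i | i != u) expR (deg a i - max_deg).
      by apply: sumr_ge0 => i _; exact: expR_ge0.
    lra.
  case/forallPn => v; rewrite negb_imply -ltNge => /andP[uv h].
  have : 1 <= \sum_u \sum_(v | u != v) expR (cod a u v - max_cod); last by lra.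
  rewrite (bigD1 u) //= (bigD1 v) //=; have := ex (cod a u v - max_cod).
  rewrite subr_ge0 => /(_ (ltW h)).
  have : 0 <= \sum_(i | i != u) \sum_(v | i != v) expR (cod a i v - max_cod) by exact: sumr_ge0.
  have : 0 <= \sum_(i | (u != i) && (i != v)) expR (cod a u i - max_cod).
    by apply: sumr_ge0 => i _; exact: expR_ge0.
  lra.
rewrite /EG !ExD !Ex_sum.
have -> : 3 * n%:R ^+ 2 * expR (- theta) = n%:R ^+ 2 * expR (- theta) +
  n%:R ^+ 2 * expR (- theta) + n%:R * (n%:R * expR (- theta)) by ring.
have cst : \sum_(u < n) expR (- theta) = n%:R * expR (- theta).
  by rewrite sumr_const card_ord mulr_natl.
have one (F : 'I_n -> R) : (forall u, F u <= expR (- theta)) ->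
    \sum_u F u <= n%:R ^+ 2 * expR (- theta).
  move=> h; apply: le_trans (ler_sum _ (fun u _ => h u)) _.
  rewrite cst ler_wpM2r ?expR_ge0 // expr2 ler_peMl //; exact: ler0n.
apply: lerD; first apply: lerD.
- exact: one.
- exact: one.
have -> : n%:R * (n%:R * expR (- theta)) = \sum_(u < n) \sum_(v < n) expR (- theta).
  by rewrite cst sumr_const card_ord mulr_natl.
apply: ler_sum => u _; rewrite Ex_sum [leRHS](bigID (fun v => u != v)) /=.
apply: ler_wpDr; first by apply: sumr_ge0 => v _; exact: expR_ge0.
by apply: ler_sum => v uv; exact: co.
Qed.

End IrregularGraphs.

(** * The Gaussian distribution function and Mills ratio *)

Section GaussianTail.
Context {R : realType}.
Local Notation mu := (@lebesgue_measure R).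
Implicit Types (w x y a b : R).

Definition gpdf : R -> R := normal_pdf 0 1.
Definition gcdf w : R := fine (normal_prob 0 1 `]-oo, w] : \bar R).

Lemma gpdfE w : gpdf w = normal_peak 1 * expR (- (w ^+ 2 / 2)).
Proof.
rewrite /gpdf normal_pdfE ?oner_eq0 //; congr (_ * expR _).
by rewrite subr0 expr1n mulNr.
Qed.

Lemma gpdf_gt0 w : 0 < gpdf w.
Proof. by rewrite gpdfE mulr_gt0 ?expR_gt0 // normal_peak_gt0 ?oner_eq0. Qed.

Lemma is_derive_gpdf w : is_derive w 1 gpdf (- w * gpdf w).
Proof.
rewrite (_ : gpdf = fun t => normal_peak 1 * expR (- (t ^+ 2 / 2))); last first.
  by apply/funext => t; exact: gpdfE.
apply: is_derive_eq; rewrite /GRing.scale /=.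
by move: (normal_peak 1) (expR _) => c e; field.
Qed.

Lemma mvt_ray (f df : R -> R) z : (forall w, w <= z -> is_derive w 1 f (df w)) ->
  forall a b, a <= b -> b <= z -> exists2 c, a <= c <= b & f b - f a = df c * (b - a).
Proof.
move=> fd a b ab bz.
have le_z x : x <= b -> x <= z by move=> xb; exact: le_trans bz.
have [||c] := @MVT_segment R f df a b ab.
- by move=> x; rewrite in_itv /= => /andP[_ /ltW/le_z/fd].
- apply: derivable_within_continuous => x; rewrite in_itv /= => /andP[_ /le_z/fd h].
  exact: ex_derive.
by rewrite in_itv /= => hc e; exists c.
Qed.

Lemma mvt_line (f df : R -> R) : (forall w, is_derive w 1 f (df w)) ->
  forall a b, a <= b -> exists2 c, a <= c <= b & f b - f a = df c * (b - a).
Proof. by move=> fd a b ab; exact: mvt_ray (fun w _ => fd w) _ _ ab (lexx b). Qed.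

Section Antiderivative.
Variable h : R -> R.
Hypothesis hc : continuous h.
Hypothesis h01 : forall w, 0 <= h w <= 1.
Let hphi w := h w * gpdf w.

Definition gint w : R := (\int[mu]_(t in `]-oo, w]) hphi t)%R.
Definition gint_total : R := (\int[mu]_t hphi t)%R.

Lemma continuous_gpdf : continuous gpdf.
Proof. by apply: continuous_normal_pdf; rewrite oner_eq0. Qed.

Lemma hphi_continuous : continuous hphi.
Proof. by move=> w; apply: cvgM; [exact: hc|exact: continuous_gpdf]. Qed.

Lemma hphi_bounds w : 0 <= hphi w <= gpdf w.
Proof.
have /andP[h0 h1] := h01 w; have g0 := ltW (gpdf_gt0 w).
by rewrite mulr_ge0 //= ler_piMl.
Qed.

Lemma integrable_hphi (D : set R) : measurable D -> mu.-integrable D (EFin \o hphi).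
Proof.
move=> mD; apply: (integrableS measurableT) => //.
apply: (le_integrable measurableT _ _ (integrable_normal_pdf 0 1)).
  by apply/measurable_EFinP; apply: continuous_measurable_fun; exact: hphi_continuous.
move=> w _ /=; have /andP[h0 h1] := hphi_bounds w.
by rewrite lee_fin !ger0_norm // normal_pdf_ge0.
Qed.

Lemma is_derive_gint w : is_derive w 1 gint (hphi w).
Proof.
have wlt : w < w + 1 by rewrite ltrDl.
have hi : mu.-integrable [set` Interval -oo%O (BRight (w + 1))] (EFin \o hphi).
  exact: integrable_hphi.
have hcw : {for w, continuous hphi} by exact: hphi_continuous.
have [d e] := continuous_FTC1 wlt hi (ltNyr w) hcw.
by apply: DeriveDef; [exact: d|rewrite -derive1E; exact: e].
Qed.

End Antiderivative.

Lemma gcdfE : gcdf = gint (fun=> 1).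
Proof.
by apply/funext => w; rewrite /gcdf /gint /normal_prob; under eq_Rintegral do rewrite mul1r.
Qed.

Lemma cst1_01 (w : R) : 0 <= (1 : R) <= 1. Proof. by rewrite ler01 lexx. Qed.

Lemma is_derive_gcdf w : is_derive w 1 gcdf (gpdf w).
Proof.
rewrite gcdfE -[gpdf w]mul1r; apply: is_derive_gint => [x|]; first exact: cvg_cst.
exact: cst1_01.
Qed.

Lemma gcdfE_fin w : (gcdf w)%:E = normal_prob 0 1 `]-oo, w].
Proof. by rewrite /gcdf fineK // fin_num_measure. Qed.

Lemma gcdf_ge0 w : 0 <= gcdf w. Proof. exact: fine_ge0. Qed.

Lemma gcdf_le1 w : gcdf w <= 1.
Proof. by rewrite -lee_fin gcdfE_fin probability_le1. Qed.

(** The identity as a random variable under the Gaussian law, which makes the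
    limits of distribution functions at infinity available for gcdf. *)
Definition gauss_id : R -> R := idfun.

Lemma measurable_gauss_id :
  measurable_fun [set: measurableTypeR R] (gauss_id : measurableTypeR R -> R).
Proof. exact: measurable_id. Qed.

HB.instance Definition _ := isMeasurableFun.Build _ _ (measurableTypeR R) R
  (gauss_id : measurableTypeR R -> R) measurable_gauss_id.

Lemma gcdf_small (e : R) : 0 < e -> exists2 v, v < 0 & forall w, w <= v -> gcdf w < e.
Proof.
move=> e0; have := cvg_cdfNy0 (P := normal_prob (0 : R) 1) (gauss_id : {RV _ >-> _}).
move=> /fine_cvgP[_] /cvgr0Pnorm_lt /(_ e e0) [v [_ hv]].
exists (Num.min v 0 - 1).
  by have : Num.min v 0 <= 0 by [rewrite ge_min lexx orbT]; lra.
move=> w wv; have := hv w; rewrite /= ger0_norm; last exact: gcdf_ge0.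
by apply; have : Num.min v 0 <= v by [rewrite ge_min lexx]; lra.
Qed.

Lemma gcdf_large (e : R) : 0 < e -> exists2 v, 0 < v & forall w, v <= w -> 1 - e < gcdf w.
Proof.
move=> e0; have := cvg_cdfy1 (P := normal_prob (0 : R) 1) (gauss_id : {RV _ >-> _}).
move=> /fine_cvgP[_] /cvgrPdist_lt /(_ e e0) [v [_ hv]].
exists (Num.max v 0 + 1).
  by have : 0 <= Num.max v 0 by [rewrite le_max lexx orbT]; lra.
move=> w wv; have := hv w; rewrite /= => h.
have : `|1 - gcdf w| < e.
  by apply: h; have : v <= Num.max v 0 by [rewrite le_max lexx]; lra.
by rewrite ltr_norml => /andP[_]; rewrite ltrBlDr -ltrBlDl.
Qed.

(** gcdf t + gcdf (- t) has derivative 0, and at infinity it tends to 1. *)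
Lemma gcdfN w : gcdf (- w) = 1 - gcdf w.
Proof.
pose Q t := gcdf t + gcdf (- t).
have gN (t : R) : gpdf (- t) = gpdf t by rewrite !gpdfE sqrrN.
have dQ (t : R) : is_derive t 1 Q 0.
  have d1 := is_derive_gcdf t; have d2 := is_derive_gcdf (- t).
  apply: is_derive_eq; rewrite /GRing.scale /= gN; ring.
have QC a b : a <= b -> Q a = Q b.
  by move=> ab; have [c _] := mvt_line dQ ab; rewrite mul0r => /eqP; rewrite subr_eq0 => /eqP.
have QN (t : R) : Q (- t) = Q t by rewrite /Q opprK addrC.
have Q0 (t : R) : Q t = Q 0.
  by case: (lerP 0 t) => [/QC|/ltW/QC].
suff : Q w = 1 by rewrite /Q => <-; rewrite addrAC subrr add0r.
rewrite Q0; apply/eqP; rewrite -subr_eq0 -normr_le0; apply/ler_addgt0Pr => e e0.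
rewrite add0r.
have [v v0 hv] := gcdf_small e0; have [u u0 hu] := gcdf_large e0.
pose t := Num.max u (- v); have tu : u <= t by rewrite le_max lexx.
have tv : - t <= v by rewrite lerNl le_max lexx orbT.
rewrite -(Q0 t) /Q; have := hv _ tv; have := hu _ tu.
have := gcdf_ge0 (- t); have := gcdf_le1 t.
by move=> *; rewrite ler_norml; apply/andP; split; lra.
Qed.

Lemma gpdf_le_peak w : gpdf w <= normal_peak 1.
Proof. by apply: normal_pdf_ub; rewrite oner_eq0. Qed.

(** Mills ratio: gcdf t + gpdf t / t decreases on the negative axis, starting from
    0 at -oo. *)
Lemma gcdf_tail_upper w : w < 0 -> gcdf w * - w <= gpdf w.
Proof.
move=> w0; pose h t := gcdf t + gpdf t * t^-1.
have dh (t : R) : t <= w -> is_derive t 1 h (- (gpdf t * t ^- 2)).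
  move=> tw; have t0 : t != 0 by rewrite lt_eqF // (le_lt_trans tw).
  have d1 := is_derive_gcdf t; have d2 := is_derive_gpdf t.
  have d3 : is_derive t 1 (fun t : R => t^-1) (- t ^- 2 *: 1).
    exact: (is_deriveV (f := id)).
  apply: is_derive_eq; rewrite /GRing.scale /=.
  by move: (gpdf t) => g; field.
have hw : h w <= 0.
  apply/ler_addgt0Pr => e e0; rewrite add0r; have [v v0 hv] := gcdf_small e0.
  have vw : Num.min v w <= w by rewrite ge_min lexx orbT.
  have vv : Num.min v w <= v by rewrite ge_min lexx.
  have [c _] := mvt_ray dh vw (lexx w).
  have : - (gpdf c * c ^- 2) * (w - Num.min v w) <= 0.
    by rewrite mulNr oppr_le0 !mulr_ge0 ?invr_ge0 ?sqr_ge0 ?subr_ge0 ?(ltW (gpdf_gt0 _)).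
  have : gpdf (Num.min v w) * (Num.min v w)^-1 <= 0.
    by rewrite pmulr_rle0 ?gpdf_gt0 // invr_le0 (le_trans vv) // ltW.
  by have := hv _ vv; rewrite /h; lra.
have : h w * - w <= 0 by rewrite pmulr_lle0 // oppr_gt0.
have -> : h w * - w = gcdf w * - w - gpdf w.
  by rewrite /h; move: (gcdf w) (gpdf w) => c g; field; rewrite lt_eqF.
lra.
Qed.

(** gcdf t + gpdf t * t / (1 + t^2) increases, starting from 0 at -oo. *)
Lemma gcdf_tail_lower w : w < 0 -> gpdf w * - w <= gcdf w * (1 + w ^+ 2).
Proof.
move=> w0; pose h t := gcdf t + gpdf t * (t * (1 + t ^+ 2)^-1).
have pos (t : R) : 0 < 1 + t ^+ 2 by rewrite ltr_pwDl // sqr_ge0.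
have dh (t : R) : is_derive t 1 h (gpdf t * (2 * (1 + t ^+ 2) ^- 2)).
  have t0 : 1 + t ^+ 2 != 0 by rewrite gt_eqF.
  have d1 := is_derive_gcdf t; have d2 := is_derive_gpdf t.
  have d4 : is_derive t 1 (fun t : R => 1 + t ^+ 2) (2 * t).
    by apply: is_derive_eq; rewrite /GRing.scale /=; ring.
  have d3 : is_derive t 1 (fun t : R => (1 + t ^+ 2)^-1) (- (1 + t ^+ 2) ^- 2 *: (2 * t)).
    exact: (is_deriveV (f := fun t : R => 1 + t ^+ 2)).
  apply: is_derive_eq; rewrite /GRing.scale /=.
  by move: (gpdf t) => g; field.
have hw : 0 <= h w.
  apply/ler_addgt0Pr => e e0; have pk0 : 0 < normal_peak 1 :> R by rewrite normal_peak_gt0 ?oner_eq0.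
  pose v := Num.min w (- (normal_peak 1 / e)).
  have vw : v <= w by rewrite ge_min lexx.
  have vv : v <= - (normal_peak 1 / e) by rewrite ge_min lexx orbT.
  have [c _] := mvt_line dh vw.
  have : 0 <= gpdf c * (2 * (1 + c ^+ 2) ^- 2) * (w - v).
    by rewrite !mulr_ge0 ?invr_ge0 ?sqr_ge0 ?subr_ge0 ?(ltW (gpdf_gt0 _)).
  have : - e <= gpdf v * (v * (1 + v ^+ 2)^-1).
    have nv : 0 < - v by move: vv; have := divr_gt0 pk0 e0; lra.
    rewrite lerNl -mulrN -mulNr mulrA ler_pdivrMr ?pos //.
    have h1 : gpdf v * - v <= normal_peak 1 * - v by rewrite ler_wpM2r ?gpdf_le_peak ?ltW.
    have h2 : normal_peak 1 <= e * - v.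
      by rewrite mulrC -ler_pdivrMr //; move: vv; lra.
    have h3 := ler_wpM2r (ltW nv) h2.
    by move: h1 h3 e0 => *; nra.
  by have := gcdf_ge0 v; rewrite /h; lra.
have : 0 <= h w * (1 + w ^+ 2) by rewrite mulr_ge0 // ltW.
have -> : h w * (1 + w ^+ 2) = gcdf w * (1 + w ^+ 2) + gpdf w * w.
  by rewrite /h; have := pos w; move: (gcdf w) (gpdf w) => c g p0; field; rewrite gt_eqF.
lra.
Qed.

End GaussianTail.

(** * Stein's equation for a ramp *)

Section SteinEquation.
Context {R : realType}.
Local Notation mu := (@lebesgue_measure R).
Variables x y : R.
Implicit Types (w a b : R).
Hypothesis xy : x < y.

(** A Lipschitz substitute for the indicator of a ray: 1 up to x, 0 from y on,
    linear in between. *)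
Definition ramp w : R := (`|w - y| - `|w - x|) / (2 * (y - x)) + 1 / 2.

Let yx0 : 0 < y - x. Proof. by rewrite subr_gt0. Qed.

Lemma ramp1 w : w <= x -> ramp w = 1.
Proof.
move=> wx; have wy : w <= y by rewrite (le_trans wx) // ltW.
rewrite /ramp !ler0_norm ?subr_le0 //.
by field; rewrite subr_eq0 gt_eqF.
Qed.

Lemma ramp0 w : y <= w -> ramp w = 0.
Proof.
move=> yw; have xw : x <= w by rewrite (le_trans (ltW xy)).
rewrite /ramp !ger0_norm ?subr_ge0 //.
by field; rewrite subr_eq0 gt_eqF.
Qed.

Lemma ramp01 w : 0 <= ramp w <= 1.
Proof.
have h1 : `|w - y| - `|w - x| <= y - x.
  have := ler_normD (w - x) (x - y); rewrite addrA subrK [`|x - y|]distrC.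
  by rewrite (gtr0_norm yx0); lra.
have h2 : - (y - x) <= `|w - y| - `|w - x|.
  have := ler_normD (w - y) (y - x); rewrite addrA subrK.
  by rewrite (gtr0_norm yx0); lra.
have yx2 : 0 < 2 * (y - x) by rewrite mulr_gt0.
have a1 : (`|w - y| - `|w - x|) / (2 * (y - x)) <= 1 / 2.
  by rewrite ler_pdivrMr //; move: h1; lra.
have a2 : - (1 / 2) <= (`|w - y| - `|w - x|) / (2 * (y - x)).
  by rewrite ler_pdivlMr //; move: h2; lra.
by rewrite /ramp; apply/andP; split; lra.
Qed.

Lemma ramp_lip a b : `|ramp b - ramp a| <= (y - x)^-1 * `|b - a|.
Proof.
have -> : ramp b - ramp a =
    (2 * (y - x))^-1 * ((`|b - y| - `|a - y|) - (`|b - x| - `|a - x|)).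
  by rewrite /ramp; field; rewrite subr_eq0 gt_eqF.
have yx2 : 0 < (2 * (y - x))^-1 by rewrite invr_gt0 mulr_gt0.
rewrite normrM (gtr0_norm yx2) invfM -mulrA [2^-1 * _]mulrC -mulrA.
rewrite ler_wpM2l ?invr_ge0 ?(ltW yx0) // ler_pdivrMr //.
apply: le_trans (ler_normB _ _) _.
have h z : `| `|b - z| - `|a - z| | <= `|b - a|.
  by apply: le_trans (ler_dist_dist _ _) _; rewrite opprB addrA subrK.
by have := h x; have := h y; lra.
Qed.

Lemma ramp_continuous : continuous ramp.
Proof.
move=> w; apply: cvgD; last exact: cvg_cst.
apply: cvgM; last exact: cvg_cst.
by apply: cvgB; apply: cvg_norm; apply: cvgB; [exact: cvg_id|exact: cvg_cst|exact: cvg_id|exact: cvg_cst].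
Qed.

Let G := gint ramp.
Let c := gint_total ramp.

Lemma integrable_ramp (D : set R) : measurable D ->
  mu.-integrable D (EFin \o (fun w => ramp w * gpdf w)).
Proof. by apply: integrable_hphi; [exact: ramp_continuous|exact: ramp01]. Qed.

Lemma gint_ramp_left w : w <= x -> G w = gcdf w.
Proof.
move=> wx; rewrite gcdfE; apply: eq_Rintegral => t; rewrite inE /= in_itv /= => tw.
by rewrite ramp1 // (le_trans tw).
Qed.

Lemma gint_ramp_right w : y <= w -> G w = c.
Proof.
move=> yw; rewrite /G /c /gint /gint_total [LHS]Rintegral_mkcond; apply: eq_Rintegral => t _.
rewrite patchE; case: ifPn => // /negP tw; rewrite ramp0 ?mul0r //.
apply: le_trans yw _; rewrite leNgt; apply/negP => tlt; apply: tw.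
by rewrite inE /= in_itv /= ltW.
Qed.

Lemma gint_ramp_bounds w : 0 <= G w <= gcdf w.
Proof.
apply/andP; split.
  apply: Rintegral_ge0 => t _; rewrite mulr_ge0 ?(ltW (gpdf_gt0 _)) //.
  by case/andP: (ramp01 t).
rewrite gcdfE; apply: le_Rintegral => // [||t _].
- exact: integrable_ramp.
- by apply: integrable_hphi => // [t|t]; [exact: cvg_cst|exact: cst1_01].
- by rewrite ler_wpM2r ?(ltW (gpdf_gt0 _)) //; case/andP: (ramp01 t).
Qed.

Lemma is_derive_G (w : R) : is_derive w 1 G (ramp w * gpdf w).
Proof. by apply: is_derive_gint; [exact: ramp_continuous|exact: ramp01]. Qed.

Lemma gint_total_bounds : gcdf x <= c <= gcdf y.
Proof.
rewrite -(gint_ramp_right (lexx y)); apply/andP; split; last first.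
  by case/andP: (gint_ramp_bounds y).
rewrite -(gint_ramp_left (lexx x)) -subr_ge0.
have [t _ ->] := mvt_line is_derive_G (ltW xy).
rewrite !mulr_ge0 ?(ltW (gpdf_gt0 _)) ?(ltW yx0) //; by case/andP: (ramp01 t).
Qed.

Let c01 : 0 <= c <= 1.
Proof.
have /andP[h1 h2] := gint_total_bounds.
by rewrite (le_trans (gcdf_ge0 x) h1) (le_trans h2 (gcdf_le1 y)).
Qed.

(** Variation of constants for f' - w f = ramp - c. *)
Definition stein_sol w : R := (G w - c * gcdf w) / gpdf w.
Definition stein_der w : R := ramp w - c + w * stein_sol w.

Lemma is_derive_stein_sol (w : R) : is_derive w 1 stein_sol (stein_der w).
Proof.
have g0 : gpdf w != 0 by rewrite gt_eqF // gpdf_gt0.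
have d1 := is_derive_gcdf w; have d2 := is_derive_gpdf w; have d3 := is_derive_G w.
have d4 : is_derive w 1 (fun t : R => (gpdf t)^-1) (- (gpdf w) ^- 2 *: (- w * gpdf w)).
  exact: (is_deriveV (f := gpdf)).
apply: is_derive_eq; rewrite /GRing.scale /= /stein_der /stein_sol.
by move: (gpdf w) g0 (gcdf w) (G w) => g g0 P Q; field.
Qed.

Let wsol_der w := stein_sol w + w * stein_der w.

Lemma is_derive_wsol (w : R) : is_derive w 1 (fun t => t * stein_sol t) (wsol_der w).
Proof.
have d := is_derive_stein_sol w.
by apply: is_derive_eq; rewrite /GRing.scale /= /wsol_der; ring.
Qed.

(** The two Mills bounds together confine r * (1 + w^2) to an interval of length 1,
    although both r * w^2 and w are unbounded. *)
Lemma tail_ratio w : w <= -1 -> let r := gcdf w / gpdf w in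
  [/\ 0 <= r, r * - w <= 1 & 0 <= r * (1 + w ^+ 2) + w <= 1].
Proof.
move=> w1 r; have g0 := gpdf_gt0 w; have w0 : w < 0 by lra.
have r0 : 0 <= r by rewrite divr_ge0 ?gcdf_ge0 // ltW.
have rw : r * - w <= 1.
  by rewrite /r mulrAC ler_pdivrMr // mul1r gcdf_tail_upper.
have rw' : - w <= r * (1 + w ^+ 2).
  by rewrite /r mulrAC ler_pdivlMr // mulrC gcdf_tail_lower.
split=> //; apply/andP; split; first by lra.
have r1 : r <= 1 by apply: le_trans rw; rewrite ler_peMr //; lra.
have : r * - w * - w <= 1 * - w by rewrite ler_wpM2r //; lra.
by rewrite expr2; nra.
Qed.

(** On either tail the ramp is constant, and stein_sol is a multiple of the Mills
    ratio, so tail_ratio applies; in between the density is bounded below. These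
    bounds make w * stein_sol bounded and Lipschitz. *)
Lemma stein_sol_bounds : exists B : R, forall w,
  `|w * stein_sol w| <= B /\ `|wsol_der w| <= B.
Proof.
have /andP[c0 c1] := c01.
(* beyond A the ramp is constant, and the tail bounds apply from 1 on *)
pose A := Num.max 1 (Num.max `|x| `|y|).
have A1 : 1 <= A by rewrite le_max lexx.
have Ax : `|x| <= A by rewrite !le_max lexx ?orbT.
have Ay : `|y| <= A by rewrite !le_max lexx ?orbT.
have gA := gpdf_gt0 A; pose B := (gpdf A)^-1.
have B0 : 0 <= B by rewrite invr_ge0 ltW.
exists (1 + A * B + (B + A * (1 + A * B))) => w.
have big : 1 <= 1 + A * B + (B + A * (1 + A * B)).
  have h1 : 0 <= A * B by rewrite mulr_ge0 //; lra.
  have h2 : 0 <= A * (1 + A * B) by rewrite mulr_ge0 //; lra.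
  by lra.
case: (lerP w (- A)) => [wA|wA].
  have wx : w <= x by move: Ax; rewrite ler_norml => /andP[? _]; lra.
  have w1 : w <= -1 by lra.
  have [r0 r1 r2] := tail_ratio w1.
  rewrite /wsol_der /stein_der /stein_sol ramp1 // gint_ramp_left //.
  have -> : (gcdf w - c * gcdf w) / gpdf w = (1 - c) * (gcdf w / gpdf w) by ring.
  move: (gcdf w / gpdf w) r0 r1 r2 => r r0 r1 /andP[r2 r3].
  have c10 : 0 <= 1 - c by lra.
  split; apply: le_trans big; rewrite ler_norml.
    have -> : w * ((1 - c) * r) = - ((1 - c) * (r * - w)) by ring.
    have h0 : 0 <= r * - w by rewrite mulr_ge0 //; lra.
    have : (1 - c) * (r * - w) <= 1 by rewrite -[leRHS]mulr1; apply: ler_pM => //; lra.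
    have : 0 <= (1 - c) * (r * - w) by rewrite mulr_ge0.
    by move=> *; apply/andP; split; lra.
  have -> : (1 - c) * r + w * (1 - c + w * ((1 - c) * r)) =
     (1 - c) * (r * (1 + w ^+ 2) + w) by ring.
  have : (1 - c) * (r * (1 + w ^+ 2) + w) <= 1 by rewrite -[leRHS]mulr1; apply: ler_pM => //; lra.
  have : 0 <= (1 - c) * (r * (1 + w ^+ 2) + w) by rewrite mulr_ge0.
  by move=> *; apply/andP; split; lra.
case: (lerP A w) => [Aw|Aw].
  have yw : y <= w by move: Ay; rewrite ler_norml => /andP[_ ?]; lra.
  have w1 : - w <= -1 by lra.
  have [r0 r1 r2] := tail_ratio w1.
  rewrite /wsol_der /stein_der /stein_sol ramp0 // gint_ramp_right //.
  have gN : gpdf (- w) = gpdf w :> R by rewrite !gpdfE sqrrN.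
  have -> : (c - c * gcdf w) / gpdf w = c * (gcdf (- w) / gpdf (- w)).
    by rewrite gN gcdfN; ring.
  move: (gcdf (- w) / gpdf (- w)) r0 r1 r2 => r r0; rewrite opprK sqrrN => r1 /andP[r2 r3].
  split; apply: le_trans big; rewrite ler_norml.
    have -> : w * (c * r) = c * (r * w) by ring.
    have h0 : 0 <= r * w by rewrite mulr_ge0 //; lra.
    have : c * (r * w) <= 1 by rewrite -[leRHS]mulr1; apply: ler_pM => //; lra.
    have : 0 <= c * (r * w) by rewrite mulr_ge0.
    by move=> *; apply/andP; split; lra.
  have -> : c * r + w * (0 - c + w * (c * r)) = c * (r * (1 + w ^+ 2) - w) by ring.
  have : c * (r * (1 + w ^+ 2) - w) <= 1 by rewrite -[leRHS]mulr1; apply: ler_pM => //; lra.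
  have : 0 <= c * (r * (1 + w ^+ 2) - w) by rewrite mulr_ge0.
  by move=> *; apply/andP; split; lra.
have wA' : `|w| <= A by rewrite ler_norml; apply/andP; split; lra.
have gw : gpdf A <= gpdf w :> R.
  rewrite !gpdfE ler_wpM2l ?normal_peak_ge0 // ler_expR lerN2 ler_wpM2r //.
  by rewrite -(real_normK (num_real w)) lerXn2r ?nnegrE // (le_trans _ wA').
have sB : `|stein_sol w| <= B.
  rewrite /stein_sol normrM normfV (gtr0_norm (gpdf_gt0 w)) -[B]mul1r.
  apply: ler_pM => //; first by rewrite invr_ge0 ltW // gpdf_gt0.
    have /andP[h1 h2] := gint_ramp_bounds w; have h3 := gcdf_le1 w; have h4 := gcdf_ge0 w.
    have h5 : 0 <= c * gcdf w by rewrite mulr_ge0.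
    have h6 : c * gcdf w <= 1 by rewrite -[leRHS]mulr1; apply: ler_pM.
    by rewrite ler_norml; apply/andP; split; lra.
  by rewrite /B lef_pV2 ?posrE ?gpdf_gt0.
have wsB : `|w * stein_sol w| <= A * B by rewrite normrM ler_pM.
have /andP[r0 r1] := ramp01 w.
have dB : `|stein_der w| <= 1 + A * B.
  apply: le_trans (ler_normD _ _) _; apply: lerD => //.
  by rewrite ler_norml; apply/andP; split; lra.
have wdB : `|w * stein_der w| <= A * (1 + A * B) by rewrite normrM ler_pM.
split.
  apply: le_trans wsB _; have h2 : 0 <= A * (1 + A * B) by rewrite mulr_ge0 // ?addr_ge0 ?mulr_ge0 //; lra.
  by lra.
apply: le_trans (ler_normD _ _) _.
have h1 : 0 <= A * B by rewrite mulr_ge0 //; lra.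
by lra.
Qed.

(** The derivative of stein_sol is ramp - c + w * stein_sol, a sum of Lipschitz
    functions; the mean value theorem turns this into the quadratic error. *)
Lemma stein_equation : exists f f' : R -> R, exists Bf Cf : R,
  [/\ forall w, f' w - w * f w = ramp w - gint_total ramp,
      forall w, `|f' w| <= Bf &
      forall a b, `|f b - f a - f' a * (b - a)| <= Cf * (b - a) ^+ 2].
Proof.
have [B hB] := stein_sol_bounds.
exists stein_sol, stein_der, (1 + B), (B + (y - x)^-1); split.
- by move=> w; rewrite /stein_der addrK.
- move=> w; apply: le_trans (ler_normD _ _) _; apply: lerD; last by case: (hB w).
  have /andP[r0 r1] := ramp01 w; have /andP[c0 c1] := c01.
  by rewrite ler_norml; apply/andP; split; lra.
have lip a b : `|stein_der b - stein_der a| <= (B + (y - x)^-1) * `|b - a|.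
  have wlip s t : s <= t -> `|t * stein_sol t - s * stein_sol s| <= B * `|t - s|.
    move=> st; have [z _ ->] := mvt_line is_derive_wsol st.
    by rewrite normrM ler_wpM2r //; case: (hB z).
  have wlip' : `|b * stein_sol b - a * stein_sol a| <= B * `|b - a|.
    case/orP: (le_total a b) => h; first exact: wlip.
    by rewrite distrC [`|b - a|]distrC; exact: wlip.
  have -> : stein_der b - stein_der a = (b * stein_sol b - a * stein_sol a) +
     (ramp b - ramp a) by rewrite /stein_der; ring.
  by apply: le_trans (ler_normD _ _) _; rewrite mulrDl lerD // ramp_lip.
have taylor a b z : `|z - a| <= `|b - a| -> stein_sol b - stein_sol a = stein_der z * (b - a) ->
    `|stein_sol b - stein_sol a - stein_der a * (b - a)| <= (B + (y - x)^-1) * (b - a) ^+ 2.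
  move=> za ->; rewrite -mulrBl normrM -(real_normK (num_real (b - a))) expr2 mulrA.
  rewrite ler_wpM2r //; apply: le_trans (lip _ _) _; rewrite ler_wpM2l //.
  rewrite addr_ge0 ?invr_ge0 ?(ltW yx0) //.
  by case: (hB 0) => h _; exact: le_trans h.
move=> a b; case/orP: (le_total a b) => ab.
  have [z /andP[az zb] e] := mvt_line is_derive_stein_sol ab.
  by apply: taylor e; rewrite !ger0_norm ?subr_ge0 // lerD2r.
have [z /andP[bz za] e] := mvt_line is_derive_stein_sol ab.
apply: (taylor a b z); first by rewrite !ler0_norm ?subr_le0 // lerN2 lerD2r.
by rewrite -[LHS]opprB e -mulrN opprB.
Qed.

End SteinEquation.

(** * Orders of magnitude as powers of n *)

Section PowerBounds.
Context {R : realType}.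
Implicit Types (f g : nat -> R) (e c : R).

(** Only exponents are recorded, so that comparing error terms amounts to linear
    inequalities in alpha. *)
Definition bigO f e : Prop :=
  exists C : R, \forall n \near \oo, `|f n| <= C * n%:R `^ e.

Lemma near_ge_nat (k : nat) : \forall n \near \oo, (k <= n)%N.
Proof. by exists k. Qed.

Lemma powR_nat_gt0 (n : nat) e : (0 < n)%N -> 0 < n%:R `^ e :> R.
Proof. by move=> n0; rewrite powR_gt0 // ltr0n. Qed.

Lemma bigO_pos f e : bigO f e ->
  exists2 C : R, 0 <= C & \forall n \near \oo, `|f n| <= C * n%:R `^ e.
Proof.
case=> C h; exists `|C|; rewrite ?normr_ge0 //; near=> n.
apply: le_trans (_ : C * n%:R `^ e <= _); first by near: n.
by rewrite ler_wpM2r ?powR_ge0 // ler_norm.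
Unshelve. all: by end_near. Qed.

Lemma bigO_le f g e : (\forall n \near \oo, `|f n| <= `|g n|) -> bigO g e -> bigO f e.
Proof.
move=> fg [C h]; exists C; near=> n.
by apply: le_trans (_ : `|g n| <= _); near: n.
Unshelve. all: by end_near. Qed.

Lemma bigO_ext f g e : (\forall n \near \oo, f n = g n) -> bigO g e -> bigO f e.
Proof. by move=> fg; apply: bigO_le; apply: filterS fg => n ->. Qed.

Lemma bigO_weaken f a e : bigO f a -> a <= e -> bigO f e.
Proof.
move=> /bigO_pos[C C0 h] ae; exists C; near=> n.
apply: le_trans (_ : C * n%:R `^ a <= _); first by near: n.
rewrite ler_wpM2l // ler_powR // ler1n; near: n; exact: near_ge_nat.
Unshelve. all: by end_near. Qed.

Lemma bigOM f g a b e : bigO f a -> bigO g b -> a + b <= e ->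
  bigO (fun n => f n * g n) e.
Proof.
move=> /bigO_pos[C C0 hf] /bigO_pos[D D0 hg] abe.
apply: bigO_weaken abe; exists (C * D); near=> n.
rewrite normrM powRD; last first.
  apply/implyP => _; rewrite pnatr_eq0 -lt0n; near: n; exact: near_ge_nat.
rewrite mulrACA; apply: ler_pM => //; by near: n.
Unshelve. all: by end_near. Qed.

Lemma bigOD f g a b e : bigO f a -> bigO g b -> a <= e -> b <= e ->
  bigO (fun n => f n + g n) e.
Proof.
move=> fa gb ae be; have [C hf] := bigO_weaken fa ae; have [D hg] := bigO_weaken gb be.
exists (C + D); near=> n; apply: le_trans (ler_normD _ _) _; rewrite mulrDl.
by apply: lerD; near: n.
Unshelve. all: by end_near. Qed.

Lemma bigO_cst c e : 0 <= e -> bigO (fun=> c) e.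
Proof.
move=> e0; exists `|c|; near=> n; rewrite ler_peMr //.
apply: le_trans (_ : n%:R `^ 0 <= _); first by rewrite powRr0.
rewrite ler_powR // ler1n; near: n; exact: near_ge_nat.
Unshelve. all: by end_near. Qed.

Lemma bigO_powR a : bigO (fun n => n%:R `^ a) a.
Proof. by exists 1; near=> n; rewrite mul1r ger0_norm ?powR_ge0. Unshelve. all: by end_near. Qed.

Lemma bigO_nat : bigO (fun n => n%:R) 1.
Proof.
by exists 1; near=> n; rewrite mul1r powRr1 ?ler0n // ger0_norm ?ler0n.
Unshelve. all: by end_near. Qed.

Lemma bigO_natV : bigO (fun n => n%:R^-1) (-1).
Proof.
by exists 1; near=> n; rewrite mul1r powR_inv1 ?ler0n // ger0_norm ?invr_ge0 ?ler0n.
Unshelve. all: by end_near. Qed.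

Lemma bigOX f a (k : nat) : bigO f a -> bigO (fun n => f n ^+ k) (k%:R * a).
Proof.
move=> fa; elim: k => [|k IH].
  by rewrite mul0r; apply: bigO_ext (bigO_cst 1 (lexx 0)); near=> n; rewrite expr0.
apply: bigO_ext (bigOM fa IH _); first by near=> n; rewrite exprS.
by rewrite -natr1 mulrDl mul1r addrC.
Unshelve. all: by end_near. Qed.

Lemma bigO_natX (k : nat) : bigO (fun n => n%:R ^+ k) k%:R.
Proof. by have := bigOX k bigO_nat; rewrite mulr1. Qed.

Lemma cvg_powR_neg e : e < 0 -> n%:R `^ e @[n --> \oo] --> (0 : R).
Proof.
move=> e0; apply/cvgr0Pnorm_lt => eps eps0.
have eps1 : 0 < eps `^ (e^-1) by exact: powR_gt0.
near=> n; rewrite ger0_norm ?powR_ge0 //.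
have n0 : (0 < n)%N by near: n; exact: near_ge_nat.
have big : eps `^ (e^-1) < n%:R.
  by near: n; apply: nbhs_infty_gtr.
rewrite -[X in _ < X](_ : (eps `^ (e^-1)) `^ e = _); last first.
  by rewrite -powRrM mulVf ?lt_eqF // powRr1 // ltW.
rewrite -[e]opprK !(powRN _ (- e)) ltf_pV2 ?posrE ?powR_gt0 ?ltr0n //.
apply: gt0_ltr_powR => //; rewrite ?oppr_gt0 // ?nnegrE ?powR_ge0 ?ler0n //.
by rewrite opprK.
Unshelve. all: by end_near. Qed.

Lemma bigO_cvg0 f e : bigO f e -> e < 0 -> f n @[n --> \oo] --> (0 : R).
Proof.
move=> /bigO_pos[C C0 h] e0; apply/norm_cvg0P.
have hC : C * n%:R `^ e @[n --> \oo] --> (0 : R).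
  by rewrite -(mulr0 C); apply: cvgM; [exact: cvg_cst|exact: cvg_powR_neg].
apply: squeeze_cvgr (cvg_cst (0 : R)) hC.
by near=> n; rewrite normr_ge0 /=; near: n.
Unshelve. all: by end_near. Qed.

(** One term of the exponential series of x bounds expR x from below. *)
Lemma expR_powR_le (k : nat) (x : R) : 0 < x -> expR (- x) <= k.+1`!%:R * x ^- k.+1.
Proof.
move=> x0; have := expR_ge1Dxn k (ltW x0).
have f0 : 0 < k.+1`!%:R :> R by rewrite ltr0n fact_gt0.
move=> h; rewrite expRN -[leRHS]invrK lef_pV2 ?posrE ?expR_gt0 //; last first.
  by rewrite invr_gt0 mulr_gt0 // invr_gt0 exprn_gt0.
rewrite invfM invrK mulrC; apply: le_trans h; by rewrite lerDr.
Qed.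

Lemma bigO_expR c e : 0 < c -> bigO (fun n => expR (- (n%:R `^ c))) e.
Proof.
move=> c0; pose k := Num.truncn (`|e| / c).
have ke : - e <= k.+1%:R * c.
  rewrite -ler_pdivrMr //; apply: le_trans (_ : `|e| / c <= _).
    by rewrite ler_pM2r ?invr_gt0 // -normrN ler_norm.
  by apply: ltW; rewrite truncnS_gt.
exists k.+1`!%:R; near=> n; rewrite ger0_norm ?expR_ge0 //.
have n0 : (0 < n)%N by near: n; exact: near_ge_nat.
apply: le_trans (expR_powR_le k (powR_nat_gt0 c n0)) _.
rewrite ler_wpM2l ?ler0n // -powR_mulrn ?powR_ge0 // -powRrM -powRN ler_powR ?ler1n //.
by rewrite mulrC; lra.
Unshelve. all: by end_near. Qed.

End PowerBounds.

(** * The two variances in closed form *)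

Section VarianceFormulas.
Context {R : realType} (n : nat) (p : R).
Hypothesis n3 : (2 < n)%N.
Hypothesis p0 : 0 < p.
Implicit Types i j k s t : 'I_n.
Local Notation N := (n%:R : R).

Let N3 : 3 <= N. Proof. by rewrite ler_nat. Qed.

Lemma sum_below (F : nat -> R) (k : 'I_n) : \sum_(i < n | (i < k)%N) F i = \sum_(i < k) F i.
Proof. by rewrite (big_ord_widen n F (ltnW (ltn_ord k))). Qed.

Lemma sum_nat (m : nat) : \sum_(i < m) (i%:R : R) = m%:R * (m%:R - 1) / 2.
Proof.
elim: m => [|m IH]; first by rewrite big_ord0 !mul0r.
by rewrite big_ord_recr /= IH -natr1; field.
Qed.

Lemma sum_pairs (m : nat) : \sum_(i < m) (i%:R * (i%:R - 1) / 2 : R) =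
  m%:R * (m%:R - 1) * (m%:R - 2) / 6.
Proof.
elim: m => [|m IH]; first by rewrite big_ord0 !mul0r.
by rewrite big_ord_recr /= IH -natr1; field.
Qed.

Lemma count_pairs : \sum_(i < n) \sum_(j < n | (i < j)%N) (1 : R) = N * (N - 1) / 2.
Proof.
rewrite (exchange_big_dep predT) //= -sum_nat; apply: eq_bigr => j _.
by rewrite (sum_below (fun=> 1)) sumr_const card_ord.
Qed.

Lemma count_triples : \sum_(i < n) \sum_(j < n | (i < j)%N) \sum_(k < n | (j < k)%N) (1 : R) =
  N * (N - 1) * (N - 2) / 6.
Proof.
rewrite (exchange_big_dep predT) //=.
transitivity (\sum_(j < n) \sum_(k < n | (j < k)%N) (j%:R : R)).
  apply: eq_bigr => j _; rewrite (sum_below (fun=> \sum_(k < n | (j < k)%N) 1)).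
  rewrite sumr_const card_ord -sumrMnl; apply: eq_bigr => k _; by [].
rewrite (exchange_big_dep predT) //= -sum_pairs; apply: eq_bigr => k _.
by rewrite (sum_below (fun m : nat => m%:R)) sum_nat.
Qed.

Lemma nuE i : nu p i = p ^+ 2 * (N - 1) ^+ 2.
Proof.
rewrite /nu /wt; under eq_bigr do rewrite -mulr_sumr sum_ones_neq1.
rewrite -mulr_suml -mulr_sumr sum_ones_neq1; ring.
Qed.

Let x : R := (N - 2) / (N - 1) ^+ 2.

Let N1 : N - 1 != 0. Proof. by rewrite gt_eqF //; move: N3; lra. Qed.
Let pn0 : p != 0. Proof. by rewrite gt_eqF. Qed.

Lemma coef_common i j : i != j ->
  \sum_k (p * wt i k) * (p * wt j k) = p ^+ 2 * (N - 2) :> R.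
Proof.
move=> ij; rewrite /wt -(sum_ones_neq ij) mulr_sumr; apply: eq_bigr => k _.
by rewrite [k == j]eq_sym; ring.
Qed.

Lemma coef_bE i j : i != j -> coef_b p i j = x.
Proof.
move=> ij; rewrite /coef_b /x; under eq_bigr do rewrite nuE.
by rewrite -mulr_suml coef_common //; field; rewrite N1 pn0.
Qed.

Lemma coef_cE i j : i != j -> coef_c p i j = x.
Proof.
move=> ij; rewrite /coef_c /x nuE.
by rewrite -mulr_suml coef_common //; field; rewrite N1 pn0.
Qed.

Lemma sum_triangle_wt i : \sum_j \sum_k (p * wt i j) * (p * wt j k) * (p * wt k i) =
  p ^+ 3 * ((N - 1) * (N - 2)) :> R.
Proof.
rewrite -(sum_ones_neq2 i) mulr_sumr; apply: eq_bigr => j _.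
rewrite mulr_sumr; apply: eq_bigr => k _.
by rewrite /wt [k == i]eq_sym; ring.
Qed.

Lemma sum_wtl s : \sum_i wt i s = N - 1 :> R.
Proof.
by rewrite -(sum_ones_neq1 s); apply: eq_bigr => i _; rewrite /wt eq_sym.
Qed.

Lemma coef_aE s : coef_a p s = x.
Proof.
rewrite /coef_a.
transitivity (\sum_i (p ^+ 4 * ((N - 1) * (N - 2)) / (p ^+ 2 * (N - 1) ^+ 2) ^+ 2) * wt i s).
  apply: eq_bigr => i _.
  transitivity ((p * wt i s) / (p ^+ 2 * (N - 1) ^+ 2) ^+ 2 *
    \sum_j \sum_k (p * wt i j) * (p * wt j k) * (p * wt k i)).
    rewrite mulr_sumr; apply: eq_bigr => j _; rewrite mulr_sumr; apply: eq_bigr => k _.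
    by rewrite nuE; ring.
  by rewrite sum_triangle_wt; ring.
by rewrite -mulr_sumr sum_wtl /x; field; rewrite N1 pn0.
Qed.

Lemma coef_eE i s : coef_e p i s = x.
Proof.
rewrite /coef_e.
transitivity (\sum_j \sum_k (p * wt i j) * (p * wt j k) * (p * wt k i) *
   (p * (N - 1) / (p ^+ 2 * (N - 1) ^+ 2) ^+ 2)).
  apply: eq_bigr => j _; apply: eq_bigr => k _.
  rewrite nuE -(sum_ones_neq1 s) mulr_sumr mulr_suml mulr_sumr.
  by apply: eq_bigr => t _; rewrite /wt; ring.
under eq_bigr do rewrite -mulr_suml.
by rewrite -mulr_suml sum_triangle_wt /x; field; rewrite N1 pn0.
Qed.

Lemma bern_varE i j : i != j -> bern_var p i j = p * (1 - p).
Proof. by move=> ij; rewrite /bern_var /wt ij mulr1. Qed.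

(** The exact corrections of sigma1_sq and sigma2_sq to their leading terms 6 /
    (n^3 p) and 2 p / n^2. *)
Definition ratio1 : R := (1 - p) ^+ 3 * (N ^+ 2 * (N - 2) / (N - 1) ^+ 3).
Definition ratio2 : R := (1 - p) * (N * (N - 2) ^+ 2 / (N - 1) ^+ 3).

Let Nn0 : N != 0. Proof. by rewrite gt_eqF //; move: N3; lra. Qed.

Lemma sigma1_sqE : sigma1_sq n p = 6 / (N ^+ 3 * p) * ratio1.
Proof.
rewrite /sigma1_sq.
transitivity (4 / N ^+ 2 * ((3 / (p ^+ 2 * (N - 1) ^+ 2)) ^+ 2 * (p * (1 - p)) ^+ 3 *
   \sum_(i < n) \sum_(j < n | (i < j)%N) \sum_(k < n | (j < k)%N) 1)).
  congr (_ * _); rewrite mulr_sumr; apply: eq_bigr => i _.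
  rewrite mulr_sumr; apply: eq_bigr => j ij; rewrite mulr_sumr; apply: eq_bigr => k jk.
  have ki : k != i by rewrite neq_ltn (ltn_trans ij jk) orbT.
  have ij' : i != j by rewrite neq_ltn ij.
  have jk' : j != k by rewrite neq_ltn jk.
  by rewrite !nuE !bern_varE //; move: (p ^+ 2 * _)^-1 => z; ring.
by rewrite count_triples /ratio1; field; rewrite N1 pn0 Nn0.
Qed.

Lemma sigma2_sqE : sigma2_sq n p = 2 * p / N ^+ 2 * ratio2.
Proof.
rewrite /sigma2_sq.
transitivity ((N ^+ 2)^-1 * ((2 * x) ^+ 2 * (p * (1 - p)) *
   \sum_(i < n) \sum_(j < n | (i < j)%N) 1)).
  congr (_ * _); rewrite mulr_sumr; apply: eq_bigr => i _.
  rewrite mulr_sumr; apply: eq_bigr => j ij.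
  have ne : i != j by rewrite neq_ltn ij.
  rewrite coef_bE // coef_cE // coef_cE ?[j == i]eq_sym // !coef_aE !coef_eE bern_varE //.
  ring.
by rewrite count_pairs /ratio2 /x; field; rewrite N1 Nn0.
Qed.

Lemma EG_gammaE : @EG R n p (gamma p (@k1 R n p) (@k3 R n p)) =
  6 / (N ^+ 3 * p) * ((1 - p) ^+ 3 * (N ^+ 2 / ((N - 1) * (N - 2)))) +
  2 * p / N ^+ 2 * ((1 - p) * (N / (N - 1))).
Proof.
have N2 : N - 2 != 0 by rewrite gt_eqF //; move: N3; lra.
by rewrite EG_gamma /k1 /k3 /paths_mean; field; rewrite N1 pn0 Nn0 N2.
Qed.

End VarianceFormulas.

Section VariancePositivity.
Context {R : realType} (n : nat) (p : R).
Hypothesis p01 : 0 <= p <= 1.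

Lemma bern_var_ge0 (i j : 'I_n) : 0 <= bern_var p i j.
Proof.
case/andP: p01 => p0 p1; rewrite /bern_var /wt.
by case: (i != j); rewrite /= ?mulr1 ?mulr0 ?mul0r // mulr_ge0 ?subr_ge0.
Qed.

Lemma sigma1_sq_ge0 : 0 <= sigma1_sq n p.
Proof.
rewrite /sigma1_sq mulr_ge0 ?divr_ge0 ?sqr_ge0 //.
apply: sumr_ge0 => i _; apply: sumr_ge0 => j _; apply: sumr_ge0 => k _.
by do 3![apply: mulr_ge0; rewrite ?bern_var_ge0 ?sqr_ge0 //].
Qed.

Lemma sigma2_sq_ge0 : 0 <= sigma2_sq n p.
Proof.
rewrite /sigma2_sq mulr_ge0 ?invr_ge0 ?sqr_ge0 //.
apply: sumr_ge0 => i _; apply: sumr_ge0 => j _.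
by apply: mulr_ge0; rewrite ?bern_var_ge0 ?sqr_ge0.
Qed.

Lemma sigma_sqE : sigma n p ^+ 2 = sigma1_sq n p + sigma2_sq n p.
Proof. by rewrite /sigma sqr_sqrtr // addr_ge0 ?sigma1_sq_ge0 ?sigma2_sq_ge0. Qed.

Lemma sigma_gt0 : (2 < n)%N -> 0 < p -> p < 1 -> 0 < sigma n p.
Proof.
move=> n3 p0 p1; have N3 : 3 <= n%:R :> R by rewrite ler_nat.
rewrite sqrtr_gt0 ltr_pwDl ?sigma2_sq_ge0 // sigma1_sqE // /ratio1.
have h1 : 0 < n%:R - 1 :> R by lra.
have h2 : 0 < n%:R - 2 :> R by lra.
have h3 : 0 < n%:R :> R by lra.
have h4 : 0 < 1 - p by lra.
by rewrite !(mulr_gt0, divr_gt0, exprn_gt0, invr_gt0).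
Qed.

End VariancePositivity.

(** * From the probability space to the array of bits *)

Section Sampling.
Context {R : realType} (n : nat) d (T : measurableType d) (P : probability T R).
Variables (p : R) (A : 'I_n -> 'I_n -> {RV P >-> bool}).
Hypothesis er : is_erdos_renyi P p A.
Implicit Types (a : @graph n) (e : 'I_n * 'I_n) (t : T).

(** Bits off the increasing pairs are set to false, in accordance with the weight 0
    that edge_p gives them. *)
Definition sample t : @graph n := [ffun e : 'I_n * 'I_n => (e.1 < e.2)%N && A e.1 e.2 t].

Lemma adj_sample t : adj (sample t) = fun i j => A i j t.
Proof.
case: er => Asym Adiag _ _; apply/funext => i; apply/funext => j.
rewrite /adj ffunE /edge_key; case: (eqVneq i j) => [->|ij] /=; first by rewrite Adiag.
case: (ltnP i j) => [->//|ji] /=; rewrite Asym ltn_neqAle ji andbT.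
by rewrite -val_eqE eq_sym in ij; rewrite ij.
Qed.

Lemma measurable_edge e b : measurable (A e.1 e.2 @^-1` [set b]).
Proof. exact: measurable_funPTI. Qed.

Lemma prob_edge e b : (e.1 < e.2)%N ->
  P (A e.1 e.2 @^-1` [set b]) = (if b then p else 1 - p)%:E.
Proof.
case: er => _ _ Ap _ ee; case: b; first exact: Ap.
have -> : A e.1 e.2 @^-1` [set false] = ~` (A e.1 e.2 @^-1` [set true]).
  by apply/seteqP; split=> t /=; case: (A e.1 e.2 t).
by rewrite probability_setC ?Ap //; exact: measurable_edge.
Qed.

(** On arrays without a bit off the increasing pairs this is mutual independence;
    the other arrays have probability 0 on both sides. *)
Lemma prob_sample a : P (sample @^-1` [set a]) = (wgt (edge_p p) a)%:E.
Proof.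
case: (boolP [exists e : 'I_n * 'I_n, ~~ (e.1 < e.2)%N && a e]) => [/existsP[e /andP[ne ae]]|h].
  rewrite /wgt (bigD1 e) //= ae /edge_p (negbTE ne) mul0r.
  rewrite (_ : _ @^-1` _ = set0) ?measure0 // -subset0 => t /= ta.
  by move: ae; rewrite -ta ffunE (negbTE ne).
have a0 e : ~~ (e.1 < e.2)%N -> a e = false.
  move=> ne; apply/negP => ae; move/negP: h; apply; apply/existsP; exists e.
  by rewrite ne.
case: er => _ _ _ ind.
pose S := [set e : 'I_n * 'I_n | (e.1 < e.2)%N]%SET.
have -> : sample @^-1` [set a] =
    \bigcap_(e in [set` S]) ((fun e => A e.1 e.2) e @^-1` [set a e]).
  apply/seteqP; split=> [t /= ta e|t h'] /=.
    by rewrite inE => ee /=; rewrite -ta ffunE ee.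
  apply/ffunP => e; rewrite ffunE; case: (boolP (e.1 < e.2)%N) => [ee|ne] /=; last by rewrite a0.
  by apply: (h' e); rewrite /= inE.
rewrite (ind S (fun e => [set a e])) //.
rewrite (eq_bigr (fun e => (if a e then p else 1 - p)%:E)); last first.
  by move=> e; rewrite inE => ee; exact: prob_edge.
rewrite prodEFin; congr (_%:E); rewrite /wgt [RHS](bigID (fun e => e \in S)) /=.
rewrite [X in _ = _ * X]big1 ?mulr1 => [|e].
  by apply: eq_bigr => e; rewrite inE /edge_p => ->.
by rewrite inE => ne; rewrite a0 // /edge_p (negbTE ne) subr0.
Qed.

Lemma measurable_sample (B : set (@graph n)) : measurable (sample @^-1` B).
Proof.
have m1 a : measurable (sample @^-1` [set a]).
  have -> : sample @^-1` [set a] = \bigcap_(e in [set: 'I_n * 'I_n])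
     [set t | (e.1 < e.2)%N && A e.1 e.2 t = a e].
    apply/seteqP; split=> [t /= ta e _|t h] /=; first by rewrite -ta ffunE.
    by apply/ffunP => e; rewrite ffunE; exact: h.
  apply: fin_bigcap_measurable => [|e _]; first exact: finite_finset.
  case: (e.1 < e.2)%N => /=; last by case: (a e); [rewrite (_ : [set _ | _] = set0) //; apply/seteqP; split|rewrite (_ : [set _ | _] = setT) //; apply/seteqP; split].
  exact: (measurable_edge e (a e)).
rewrite (_ : _ @^-1` B = \bigcup_(a in B) (sample @^-1` [set a])).
  by apply: fin_bigcup_measurable => // ; exact: finite_finset.
by apply/seteqP; split=> [t Bt|t [a Ba /= ->]] //; exists (sample t).
Qed.

Lemma expectation_sample (F : @graph n -> R) :
  ('E_P[fun t => F (sample t)] = (@EG R n p F)%:E)%E.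
Proof.
rewrite unlock.
pose E a := sample @^-1` [set a].
have mE a : measurable (E a) by exact: measurable_sample.
have iE a : P.-integrable [set: T] (EFin \o \1_(E a)).
  exact: integrable_indic.
have -> : (fun t => (F (sample t))%:E) =
    (fun t => \sum_(a : @graph n) ((F a)%:E * (\1_(E a) t)%:E)%E).
  apply/funext => t; rewrite (bigD1 (sample t)) //= big1 => [|a ne].
    by rewrite adde0 indicE mem_set //= mule1.
  rewrite indicE memNset ?mule0 //= => ta; move: ne; by rewrite -ta eqxx.
rewrite integral_sum //; last by move=> a; apply: integrableZl => //; exact: iE.
rewrite /EG /Ex -sumEFin; apply: eq_bigr => a _.
have e1 : (\int[P]_t (\1_(E a) t)%:E)%E = P (E a) by rewrite integral_indic // setIT.
rewrite integralZl //; last exact: iE.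
by rewrite e1 prob_sample -EFinM mulrC.
Qed.

Lemma prob_sampleE (B : pred (@graph n)) :
  P [set t | B (sample t)] = (@EG R n p (fun a => (B a)%:R))%:E.
Proof.
have mB := measurable_sample [set a | B a].
rewrite -expectation_sample -(expectation_indic P mB); congr ('E_P[_])%E.
by apply/funext => t; rewrite indicE; congr (nat_of_bool _)%:R; apply/idP/idP; rewrite inE.
Qed.

End Sampling.

(** * Orders of magnitude of the parameters and of the errors *)

Section Regularity.
Context {R : realType} (alpha : R).
Hypothesis alpha_gt0 : 0 < alpha.
Hypothesis alpha_lt1 : alpha < 1.
Local Notation p n := (edge_prob alpha n).

(** The square root of n p, about the mean degree; irregular graphs have
    probability exp (- theta) up to a power of n. *)
Definition theta (n : nat) : R := n%:R `^ ((1 - alpha) / 2).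
Definition good (n : nat) : pred (@graph n) := regular (p n) (theta n).
Definition bad_prob (n : nat) : R := @EG R n (p n) (fun a => (~~ good a)%:R).

Lemma edge_prob_ge0 n : 0 <= p n. Proof. exact: powR_ge0. Qed.

Lemma edge_prob_le1 n : p n <= 1.
Proof.
rewrite /edge_prob; case: n => [|n]; first by rewrite powR0 ?oppr_eq0 ?gt_eqF.
apply: le_trans (_ : n.+1%:R `^ 0 <= _); last by rewrite powRr0.
by rewrite ler_powR ?ler1n // oppr_le0 ltW.
Qed.

Lemma edge_prob01 n : 0 <= p n <= 1.
Proof. by rewrite edge_prob_ge0 edge_prob_le1. Qed.

Lemma edge_prob_gt0 n : (0 < n)%N -> 0 < p n.
Proof. by move=> n0; exact: powR_nat_gt0. Qed.

Lemma edge_prob_lt1 n : (1 < n)%N -> p n < 1.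
Proof.
move=> n1; rewrite /edge_prob powRN invf_lt1 ?powR_nat_gt0 // ?(ltnW n1) //.
have : 1 `^ alpha < n%:R `^ alpha :> R.
  by apply: gt0_ltr_powR => //; rewrite ?nnegrE ?ler0n // ltr1n.
by rewrite powR1.
Qed.

Lemma np_theta n : (0 < n)%N -> n%:R * p n = theta n ^+ 2.
Proof.
move=> n0; have N0 : n%:R != 0 :> R by rewrite pnatr_eq0 -lt0n.
rewrite /theta -powR_mulrn ?powR_ge0 // -powRrM (_ : _ / 2 * 2 = 1 + - alpha); last by field.
by rewrite powRD ?N0 ?implybT // powRr1.
Qed.

Lemma near_theta_ge (c : R) : \forall n \near \oo, c <= theta n.
Proof.
have h : n%:R `^ (- ((1 - alpha) / 2)) @[n --> \oo] --> (0 : R) by apply: cvg_powR_neg; move: alpha_gt0 alpha_lt1; lra.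
have c0 : 0 < (`|c| + 1)^-1 by rewrite invr_gt0 ltr_wpDl.
move/cvgr0Pnorm_lt : h => /(_ _ c0) h; near=> n.
have n0 : (0 < n)%N by near: n; exact: near_ge_nat.
have : `|n%:R `^ (- ((1 - alpha) / 2))| < (`|c| + 1)^-1 by near: n.
rewrite ger0_norm ?powR_ge0 // powRN ltf_pV2 ?posrE ?powR_nat_gt0 ?ltr_wpDl // -/(theta n) => h1.
have := ler_norm c; lra.
Unshelve. all: by end_near. Qed.

Lemma cvg_edge_prob : p n @[n --> \oo] --> (0 : R).
Proof. by apply: cvg_powR_neg; move: alpha_gt0 alpha_lt1; lra. Qed.

Lemma near_edge_prob_le (c : R) : 0 < c -> \forall n \near \oo, p n <= c.
Proof.
move=> c0; have /cvgr0Pnorm_lt/(_ _ c0) h := cvg_edge_prob; near=> n.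
rewrite -[p n]ger0_norm ?edge_prob_ge0 //; apply: ltW; near: n; exact: h.
Unshelve. all: by end_near. Qed.

(** The codegree bound has the exponent 1 - alpha - delta, against 1 - alpha for
    the degrees; this gain makes the remainder vanish. *)
Definition delta : R := Num.min alpha ((1 - alpha) / 2).

Lemma delta_gt0 : 0 < delta.
Proof. by rewrite lt_min alpha_gt0 divr_gt0 ?subr_gt0. Qed.
Lemma delta_le1 : delta <= alpha. Proof. by rewrite ge_min lexx. Qed.
Lemma delta_le2 : delta <= (1 - alpha) / 2. Proof. by rewrite ge_min lexx orbT. Qed.

(** Standing conditions that hold for all large n (near_large). *)
Definition large (n : nat) : Prop :=
  [/\ (3 < n)%N, p n <= 1 / 4, 8 <= theta n,
      1 / 2 <= ratio1 n (p n) & 1 / 2 <= ratio2 n (p n)].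

Lemma cvg_inv_nat : (n%:R : R)^-1 @[n --> \oo] --> (0 : R).
Proof. by apply: bigO_cvg0 (@bigO_natV R) _; rewrite ltrN10. Qed.

Lemma cvg_one_sub_edge_prob : 1 - p n @[n --> \oo] --> (1 : R).
Proof. by rewrite -[X in _ --> X]subr0; apply: cvgB; [exact: cvg_cst|exact: cvg_edge_prob]. Qed.

Lemma cvg_n2 (a : R) : (n%:R - a) / n%:R @[n --> \oo] --> (1 : R).
Proof.
have h : 1 - a * (n%:R : R)^-1 @[n --> \oo] --> (1 : R).
  rewrite -[X in _ --> X]subr0; apply: cvgB; first exact: cvg_cst.
  by rewrite -[X in _ --> X](mulr0 a); apply: cvgM; [exact: cvg_cst|exact: cvg_inv_nat].
apply: cvg_trans h; apply: near_eq_cvg; near=> n.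
have n0 : (0 < n)%N by near: n; exact: near_ge_nat.
by rewrite mulrBl divff // pnatr_eq0 -lt0n.
Unshelve. all: by end_near. Qed.

Lemma cvg_n2V (a : R) : n%:R / (n%:R - a) @[n --> \oo] --> (1 : R).
Proof.
rewrite -[X in _ --> X]invr1.
have -> : (fun n : nat => n%:R / (n%:R - a)) = (fun n : nat => ((n%:R - a) / n%:R)^-1).
  by apply/funext => n; rewrite invf_div.
exact: (cvgV (oner_neq0 R) (@cvg_n2 a)).
Qed.

Lemma cvgM1 (f g : nat -> R) : f n @[n --> \oo] --> (1 : R) -> g n @[n --> \oo] --> (1 : R) ->
  f n * g n @[n --> \oo] --> (1 : R).
Proof. by move=> hf hg; rewrite -[X in _ --> X]mulr1; apply: cvgM. Qed.

Lemma near_ne1 (k : nat) : \forall n \near \oo, (n%:R - k%:R : R) != 0.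
Proof.
near=> n; have h : (k < n)%N by near: n; exact: near_ge_nat.
by rewrite subr_eq0 eqr_nat gtn_eqF.
Unshelve. all: by end_near. Qed.

Lemma cvg_ratio1 : ratio1 n (p n) @[n --> \oo] --> (1 : R).
Proof.
have q := cvg_one_sub_edge_prob.
have h := cvgM1 (cvgM1 q (cvgM1 q q)) (cvgM1 (cvgM1 (@cvg_n2V 1) (cvgM1 (@cvg_n2V 1) (@cvg_n2V 1))) (@cvg_n2 2)).
apply: cvg_trans h; apply: near_eq_cvg; near=> n.
have n0 : (n%:R : R) != 0 by rewrite -[n%:R]subr0; near: n; exact: (near_ne1 0).
have n1 : (n%:R - 1 : R) != 0 by near: n; exact: (near_ne1 1).
by rewrite /ratio1; move: (p n) => z; field; rewrite n0 n1.
Unshelve. all: by end_near. Qed.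

Lemma cvg_ratio2 : ratio2 n (p n) @[n --> \oo] --> (1 : R).
Proof.
have q := cvg_one_sub_edge_prob.
have h := cvgM1 q (cvgM1 (cvgM1 (@cvg_n2V 1) (cvgM1 (@cvg_n2V 1) (@cvg_n2V 1))) (cvgM1 (@cvg_n2 2) (@cvg_n2 2))).
apply: cvg_trans h; apply: near_eq_cvg; near=> n.
have n0 : (n%:R : R) != 0 by rewrite -[n%:R]subr0; near: n; exact: (near_ne1 0).
have n1 : (n%:R - 1 : R) != 0 by near: n; exact: (near_ne1 1).
by rewrite /ratio2; move: (p n) => z; field; rewrite n0 n1.
Unshelve. all: by end_near. Qed.

Lemma cvg_gratio1 : (1 - p n) ^+ 3 * (n%:R ^+ 2 / ((n%:R - 1) * (n%:R - 2))) @[n --> \oo] --> (1 : R).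
Proof.
have q := cvg_one_sub_edge_prob.
have h := cvgM1 (cvgM1 q (cvgM1 q q)) (cvgM1 (@cvg_n2V 1) (@cvg_n2V 2)).
apply: cvg_trans h; apply: near_eq_cvg; near=> n.
have n1 : (n%:R - 1 : R) != 0 by near: n; exact: (near_ne1 1).
have n2 : (n%:R - 2 : R) != 0 by near: n; exact: (near_ne1 2).
by move: (p n) => z; field; rewrite n2 n1.
Unshelve. all: by end_near. Qed.

Lemma cvg_gratio2 : (1 - p n) * (n%:R / (n%:R - 1)) @[n --> \oo] --> (1 : R).
Proof. by apply: cvgM1; [exact: cvg_one_sub_edge_prob|exact: cvg_n2V]. Qed.

Lemma near_half (f : nat -> R) : f n @[n --> \oo] --> (1 : R) -> \forall n \near \oo, 1 / 2 <= f n.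
Proof.
move=> /cvgrPdist_lt /(_ (1 / 2)) h; have h' := h ltac:(lra); apply: filterS h' => n.
by rewrite ltr_norml => /andP[_]; lra.
Qed.

Lemma near_large : \forall n \near \oo, large n.
Proof.
near=> n; split.
- near: n; exact: near_ge_nat.
- near: n; apply: near_edge_prob_le; lra.
- near: n; exact: near_theta_ge.
- near: n; exact: near_half cvg_ratio1.
- near: n; exact: near_half cvg_ratio2.
Unshelve. all: by end_near. Qed.

End Regularity.

Section ErrorRates.
Context {R : realType} (alpha : R).
Hypothesis alpha_gt0 : 0 < alpha.
Hypothesis alpha_lt1 : alpha < 1.
Local Notation p n := (edge_prob alpha n).
Local Notation theta n := (theta alpha n).
Local Notation bad_prob n := (bad_prob alpha n).
Local Notation delta := (delta alpha).
Local Notation s n := (sigma n (p n)).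
Local Notation M n := (@max_deg R n (p n)).
Local Notation K n := (@max_cod R n (p n) (theta n)).
Local Notation kk1 n := (@k1 R n (p n)).
Local Notation kk3 n := (@k3 R n (p n)).
Local Notation nu n := (@paths_mean R n (p n)).
Local Notation large := (large alpha).

Let d0 : 0 < delta. Proof. exact: delta_gt0. Qed.
Let d1 : delta <= alpha. Proof. exact: delta_le1. Qed.
Let d2 : delta <= (1 - alpha) / 2. Proof. exact: delta_le2. Qed.
Ltac expo := move: alpha_gt0 alpha_lt1 d0 d1 d2; lra.

Lemma bigOM' (f g : nat -> R) a b : bigO f a -> bigO g b -> bigO (fun n => f n * g n) (a + b).
Proof. by move=> hf hg; exact: bigOM hf hg (lexx _). Qed.

Lemma bigO_cst0 (c : R) : bigO (fun=> c) 0. Proof. exact: bigO_cst. Qed.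

Lemma large_facts n : large n ->
  [/\ theta n <= @min_deg R n (p n), theta n <= n%:R * p n,
      n%:R ^+ 2 * p n ^+ 2 <= 4 * nu n, 2 <= @min_deg R n (p n) &
      nu n <= 16 * @min_deg R n (p n) ^+ 2].
Proof.
move=> [n3 p4 th8 _ _].
have n0 : (0 < n)%N by rewrite (ltn_trans _ n3).
have N4 : 4 <= n%:R :> R by rewrite ler_nat.
have p0 : 0 < p n by exact: edge_prob_gt0.
have np := np_theta alpha n0.
have md : n%:R * p n <= 8 * @min_deg R n (p n).
  by rewrite /min_deg; have := ler_wpM2r (ltW p0) (_ : n%:R <= 2 * (n%:R - 1)) ; lra.
have th2 : 8 * theta n <= theta n ^+ 2 by rewrite expr2 ler_wpM2r //; lra.
have th1 : theta n <= @min_deg R n (p n) by lra.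
split=> //; [by lra| |by lra|].
- rewrite /paths_mean [leRHS](_ : _ = 4 * ((n%:R - 1) * (n%:R - 2)) * p n ^+ 2); last by ring.
  by rewrite ler_wpM2r ?sqr_ge0 // expr2; nra.
rewrite /paths_mean /min_deg [leRHS](_ : _ = (n%:R - 1) * (n%:R - 1) * p n ^+ 2); last by field.
by rewrite ler_wpM2r ?sqr_ge0 // ler_wpM2l //; lra.
Qed.

Lemma large_nu n : large n -> 1 <= nu n.
Proof.
move=> ln; have [_ h2 h3 _ _] := large_facts ln.
have [_ _ th8 _ _] := ln.
have : 64 <= n%:R ^+ 2 * p n ^+ 2; last by lra.
have h8 : 8 <= n%:R * p n by lra.
by rewrite -exprMn expr2; nra.
Qed.

Lemma O_edge_prob : bigO (fun n => p n) (- alpha). Proof. exact: bigO_powR. Qed.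

Lemma O_theta : bigO (fun n => theta n) ((1 - alpha) / 2). Proof. exact: bigO_powR. Qed.

Lemma O_edge_probC : bigO (fun n => 1 - p n) 0.
Proof. by apply: (bigOD (bigO_cst0 1) (bigO_le _ O_edge_prob)) => //; [near=> n; rewrite normrN|expo]. Unshelve. all: by end_near. Qed.

Lemma O_max_deg : bigO (fun n => M n) (1 - alpha).
Proof. by apply: bigO_weaken (bigOM' (bigOM' (bigO_cst0 4) (@bigO_nat R)) O_edge_prob) _; lra. Qed.

Lemma O_max_cod : bigO (fun n => K n) (1 - alpha - delta).
Proof.
have h := bigOM' (bigOM' (bigO_cst0 3) (@bigO_nat R)) (bigOX 2 O_edge_prob).
by apply: bigOD h O_theta _ _; expo.
Qed.

Lemma O_bad_prob e : bigO (fun n => bad_prob n) e.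
Proof.
have c0 : 0 < (1 - alpha) / 2 by expo.
have h := bigOM' (bigOM' (bigO_cst0 3) (@bigO_natX R 2)) (bigO_expR (e - 2) c0).
apply: bigO_weaken (_ : bigO _ (0 + 2%:R + (e - 2))) _; last by lra.
apply: bigO_le h; have ln := near_large alpha_gt0 alpha_lt1; near=> n.
have lgn : large n by near: n.
have [h1 h2 _ _ _] := large_facts lgn; have [n3 _ _ _ _] := lgn.
have b0 : 0 <= bad_prob n by apply: EG_ge0 => [|a]; rewrite ?edge_prob01 // ler0n.
rewrite ger0_norm // (le_trans _ (ler_norm _)) //.
apply: EG_irregular => //; first exact: edge_prob01.
by rewrite (ltn_trans _ n3).
Unshelve. all: by end_near. Qed.

Lemma O_paths_meanV : bigO (fun n => (nu n)^-1) (- (2 - 2 * alpha)).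
Proof.
exists 4; have ln := near_large alpha_gt0 alpha_lt1; near=> n.
have lgn : large n by near: n.
have [_ _ h3 _ _] := large_facts lgn; have [n3 _ _ _ _] := lgn.
have n0 : (0 < n)%N by rewrite (ltn_trans _ n3).
have nu1 := large_nu lgn; have nu0 : 0 < nu n by exact: lt_le_trans nu1.
rewrite ger0_norm ?invr_ge0 ?(ltW nu0) //.
have e : n%:R `^ (- (2 - 2 * alpha)) = (n%:R ^+ 2 * p n ^+ 2)^-1.
  rewrite powRN; congr (_^-1); rewrite /edge_prob -!powR_mulrn ?ler0n ?powR_ge0 // -powRrM -powRD.
    by congr (_ `^ _); ring.
  by apply/implyP => _; rewrite pnatr_eq0 -lt0n.
have m0 : 0 < n%:R ^+ 2 * p n ^+ 2.
  by rewrite mulr_gt0 ?exprn_gt0 ?ltr0n // edge_prob_gt0.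
by rewrite e ler_pdivlMr // mulrC ler_pdivrMr.
Unshelve. all: by end_near. Qed.

Lemma O_k3 : bigO (fun n => kk3 n) (- (3 - 2 * alpha)).
Proof.
have h := @bigO_natV R.
apply: bigO_weaken (_ : bigO _ (-1 + - (2 - 2 * alpha))) _; last by lra.
apply: bigO_ext (bigOM' h O_paths_meanV); near=> n; by rewrite /k3 invfM.
Unshelve. all: by end_near. Qed.

Lemma O_nat_sub2 : bigO (fun n => n%:R - 2 : R) 1.
Proof. by apply: bigOD (@bigO_nat R) (bigO_cst0 (- 2)) _ _; lra. Qed.

Lemma O_k1 : bigO (fun n => kk1 n) (- 2).
Proof.
apply: bigO_weaken (bigOM' O_k3 (bigOM' (bigOX 2 O_edge_prob) O_nat_sub2)) _; lra.
Qed.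

Lemma large_sigma n : large n ->
  n%:R `^ (- (3 - alpha)) <= s n ^+ 2 /\ n%:R `^ (- (2 + alpha)) <= s n ^+ 2.
Proof.
move=> ln; have [n3 p4 th8 r1 r2] := ln.
have n0 : (0 < n)%N by rewrite (ltn_trans _ n3).
have n2 : (2 < n)%N by rewrite (ltn_trans _ n3).
have p0 : 0 < p n by exact: edge_prob_gt0.
have N0 : 0 < n%:R :> R by rewrite ltr0n.
have Nne : (n%:R : R) != 0 by rewrite gt_eqF.
rewrite sigma_sqE ?edge_prob01 // sigma1_sqE // sigma2_sqE //.
have e1 : n%:R `^ (- (3 - alpha)) = (n%:R ^+ 3 * p n)^-1.
  rewrite powRN; congr (_^-1); rewrite powRD ?Nne ?implybT // powR_mulrn // ltW.
have e2 : n%:R `^ (- (2 + alpha)) = p n / n%:R ^+ 2.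
  rewrite opprD addrC powRD ?Nne ?implybT //; congr (_ * _).
  by rewrite powRN powR_mulrn // ltW.
have t1 : 0 < (n%:R ^+ 3 * p n)^-1 by rewrite invr_gt0 mulr_gt0 ?exprn_gt0.
have t2 : 0 < p n / n%:R ^+ 2 by rewrite divr_gt0 ?exprn_gt0.
rewrite e1 e2; move: t1 t2; set t1 := (_ * _)^-1; set t2 := p n / _ => t10 t20.
have h1 : t1 <= 6 * t1 * ratio1 n (p n).
  have := ler_wpM2l (ltW t10) r1; lra.
have h2 : t2 <= 2 * t2 * ratio2 n (p n).
  have := ler_wpM2l (ltW t20) r2; lra.
rewrite (_ : 2 * p n / n%:R ^+ 2 = 2 * t2); last by rewrite /t2 mulrA.
by split; lra.
Qed.

Lemma large_sigma_gt0 n : large n -> 0 < s n.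
Proof.
move=> [n3 _ _ _ _]; apply: sigma_gt0; rewrite ?edge_prob01 ?edge_prob_lt1 //;
  by rewrite ?edge_prob_gt0 // (ltn_trans _ n3).
Qed.

(** sigma^2 is at least each of its two parts up to a constant, so 1 / sigma has
    two admissible exponents, and every error term can use the one that suits it. *)
Lemma O_sigmaV e : (forall n, large n -> n%:R `^ (- e) <= s n ^+ 2) ->
  bigO (fun n => (s n)^-1) (e / 2).
Proof.
move=> h; exists 1; have ln := near_large alpha_gt0 alpha_lt1; near=> n.
have lgn : large n by near: n.
have s0 := large_sigma_gt0 lgn; have [n3 _ _ _ _] := lgn.
have n0 : (0 < n)%N by rewrite (ltn_trans _ n3).
rewrite mul1r ger0_norm ?invr_ge0 ?(ltW s0) // -[e / 2]opprK powRN.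
rewrite lef_pV2 ?posrE ?powR_nat_gt0 //.
rewrite -(@ler_pXn2r _ 2) ?nnegrE ?powR_ge0 ?(ltW s0) //.
rewrite -powR_mulrn ?powR_ge0 // -powRrM (_ : - (e / 2) * 2 = - e); last by field.
exact: h.
Unshelve. all: by end_near. Qed.

Lemma O_sigmaV1 : bigO (fun n => (s n)^-1) ((3 - alpha) / 2).
Proof. by apply: O_sigmaV => n /large_sigma[]. Qed.

Lemma O_sigmaV2 : bigO (fun n => (s n)^-1) ((2 + alpha) / 2).
Proof. by apply: O_sigmaV => n /large_sigma[]. Qed.

Local Notation remainder n := (@remainder R n (p n)).

(** The three terms of var_remainder are compared with the first part of sigma^2. *)
Lemma O_var_remainder : bigO (fun n => @EG R n (p n) (fun a => (remainder n a - EG (p n) (remainder n)) ^+ 2) *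
  ((s n)^-1 * (s n)^-1)) (- delta).
Proof.
pose TC n := (72 * p n * K n * M n ^+ 2 + 64 * p n ^+ 2 * M n ^+ 3) *
    (n%:R * (p n * (16 * n%:R * M n ^+ 2 + 16 * n%:R ^+ 3 * bad_prob n))) +
  32 * M n ^+ 3 * (n%:R * (p n * (36 * K n * M n ^+ 2 + 36 * n%:R ^+ 3 * bad_prob n))) +
  168 * n%:R ^+ 8 * bad_prob n.
pose B n := 3 * (128 * p n ^+ 4 * kk3 n ^+ 2 * n%:R ^+ 3 +
       3 * (n%:R^-1 * (32 ^+ 2 * (nu n)^-1 ^+ 2)) ^+ 2 * TC n +
       (70 * n%:R ^+ 2) ^+ 2 * bad_prob n).
have c := bigO_cst0; have N := @bigO_nat R; have NX := @bigO_natX R.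
(* the exponent - 20 outweighs every factor of bad_prob below *)
have b := O_bad_prob (- 20).
have OTC : bigO TC (7 * (1 - alpha) - delta).
  have a1 := bigOM' (bigOM' (bigOM' (c 72) O_edge_prob) O_max_cod) (bigOX 2 O_max_deg).
  have a2 := bigOM' (bigOM' (c 64) (bigOX 2 O_edge_prob)) (bigOX 3 O_max_deg).
  have A : bigO (fun n => 72 * p n * K n * M n ^+ 2 + 64 * p n ^+ 2 * M n ^+ 3)
      (4 * (1 - alpha) - 1 - delta) by apply: bigOD a1 a2 _ _; expo.
  have a3 := bigOM' (bigOM' (c 16) N) (bigOX 2 O_max_deg).
  have a4 := bigOM' (bigOM' (c 16) (NX 3)) b.
  have A' : bigO (fun n => 16 * n%:R * M n ^+ 2 + 16 * n%:R ^+ 3 * bad_prob n)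
      (2 * (1 - alpha) + 1) by apply: bigOD a3 a4 _ _; expo.
  have a5 := bigOM' (bigOM' (c 36) O_max_cod) (bigOX 2 O_max_deg).
  have a6 := bigOM' (bigOM' (c 36) (NX 3)) b.
  have A'' : bigO (fun n => 36 * K n * M n ^+ 2 + 36 * n%:R ^+ 3 * bad_prob n)
      (3 * (1 - alpha) - delta) by apply: bigOD a5 a6 _ _; expo.
  have t1 := bigOM' A (bigOM' N (bigOM' O_edge_prob A')).
  have t2 := bigOM' (bigOM' (c 32) (bigOX 3 O_max_deg)) (bigOM' N (bigOM' O_edge_prob A'')).
  have t3 := bigOM' (bigOM' (c 168) (NX 8)) b.
  apply: bigOD _ t3 _ _; first apply: bigOD t1 t2 _ (lexx _).
  - by expo.
  - by expo.
  - by expo.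
have h := @bigO_natV R.
have s11 := bigOM' O_sigmaV1 O_sigmaV1.
have u1 := bigOM' (bigOM' (bigOM' (c 128) (bigOX 4 O_edge_prob)) (bigOX 2 O_k3)) (NX 3).
have u2 := bigOM' (bigOM' (c 3) (bigOX 2 (bigOM' h (bigOM' (c (32 ^+ 2)) (bigOX 2 O_paths_meanV))))) OTC.
have u3 := bigOM' (bigOX 2 (bigOM' (c 70) (NX 2))) b.
have u12 : bigO (fun n => 128 * p n ^+ 4 * kk3 n ^+ 2 * n%:R ^+ 3 +
       3 * (n%:R^-1 * (32 ^+ 2 * (nu n)^-1 ^+ 2)) ^+ 2 * TC n) (- delta - (3 - alpha)).
  by apply: bigOD u1 u2 _ _; expo.
have u123 : bigO (fun n => 128 * p n ^+ 4 * kk3 n ^+ 2 * n%:R ^+ 3 +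
       3 * (n%:R^-1 * (32 ^+ 2 * (nu n)^-1 ^+ 2)) ^+ 2 * TC n +
       (70 * n%:R ^+ 2) ^+ 2 * bad_prob n) (- delta - (3 - alpha)).
  by apply: bigOD u12 u3 _ _; expo.
apply: bigO_le (_ : bigO (fun n => B n * ((s n)^-1 * (s n)^-1)) _); last first.
  by apply: bigO_weaken (bigOM' (bigOM' (c 3) u123) s11) _; expo.
have ln := near_large alpha_gt0 alpha_lt1; near=> n.
have lgn : large n by near: n.
have [h1 h2 h3 h4 h5] := large_facts lgn; have [n3 p4 th8 _ _] := lgn.
have p0 := edge_prob_ge0 alpha n.
have p12 : p n <= 1 / 2 by lra.
have n2 : (2 < n)%N by rewrite (ltn_trans _ n3).
have K0 : 0 <= K n by rewrite addr_ge0 ?powR_ge0 // !mulr_ge0 ?exprn_ge0.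
have pM : p n * n%:R <= M n.
  by rewrite /max_deg mulrC -mulrA ler_peMl ?mulr_ge0 // ler1n.
have gP (a : @graph n) : @good R alpha n a -> sparse (M n) (K n) a /\ (forall u, @min_deg R n (p n) <= deg a u).
  by move/regularP.
have nu1 := large_nu lgn.
have v := @var_remainder R n (p n) p0 p12 n2 nu1 (M n) (K n) _ (@good _ alpha n) gP h4 h5.
have tc := @EG_total_cost R n (p n) p0 p12 n2 nu1 (M n) (K n) _ (@good _ alpha n) gP K0 pM.
have E0 : 0 <= @EG R n (p n) (fun a => (remainder n a - EG (p n) (remainder n)) ^+ 2).
  by apply: EG_ge0 => [|a]; [exact: edge_prob01|exact: sqr_ge0].
have S0 : 0 <= (s n)^-1 * (s n)^-1 by rewrite mulr_ge0 // invr_ge0 sqrtr_ge0.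
apply: le_trans (ler_norm _); rewrite [leLHS]ger0_norm; last exact: mulr_ge0.
rewrite ler_wpM2r //; apply: le_trans v _; rewrite /B ler_wpM2l // lerD2r lerD2l exprVn.
by rewrite ler_wpM2l // mulr_ge0 ?sqr_ge0.
Unshelve. all: by end_near. Qed.

End ErrorRates.

Section SteinErrorRates.
Context {R : realType} (alpha : R).
Hypothesis alpha_gt0 : 0 < alpha.
Hypothesis alpha_lt1 : alpha < 1.
Local Notation p n := (edge_prob alpha n).
Local Notation theta n := (theta alpha n).
Local Notation bad_prob n := (bad_prob alpha n).
Local Notation delta := (delta alpha).
Local Notation s n := (sigma n (p n)).
Local Notation M n := (@max_deg R n (p n)).
Local Notation K n := (@max_cod R n (p n) (theta n)).
Local Notation kk1 n := (@k1 R n (p n)).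
Local Notation kk3 n := (@k3 R n (p n)).
Local Notation nu n := (@paths_mean R n (p n)).
Local Notation large := (large alpha).
Local Notation Gam n := (@gamma R n (p n) (kk1 n) (kk3 n)).
Local Notation remainder n := (@remainder R n (p n)).

Let d0 : 0 < delta. Proof. exact: delta_gt0. Qed.
Let d1 : delta <= alpha. Proof. exact: delta_le1. Qed.
Let d2 : delta <= (1 - alpha) / 2. Proof. exact: delta_le2. Qed.
Ltac expo := move: alpha_gt0 alpha_lt1 d0 d1 d2; lra.

Lemma large_sparse n : large n ->
  [/\ forall a : @graph n, @good R alpha n a -> sparse (M n) (K n) a,
      0 <= K n & p n * n%:R <= M n].
Proof.
move=> _; have p0 := edge_prob_ge0 alpha n; split.
- by move=> a /regularP[].
- by rewrite addr_ge0 ?powR_ge0 // !mulr_ge0 ?exprn_ge0.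
- by rewrite /max_deg mulrC -mulrA ler_peMl ?mulr_ge0 // ler1n.
Qed.

Lemma large_k n : large n -> 0 <= kk1 n /\ 0 <= kk3 n.
Proof.
move=> lgn; have [n3 _ _ _ _] := lgn; have nu1 := large_nu lgn.
have k30 : 0 <= kk3 n by rewrite invr_ge0 mulr_ge0 // (le_trans _ nu1).
split=> //; rewrite mulr_ge0 // mulr_ge0 ?sqr_ge0 // subr_ge0 ler_nat.
by rewrite (leq_trans _ n3).
Qed.

(** In gamma_lip, the term with k1 is compared with a product of both exponents of
    1 / sigma and the term with k3 with the square of the first one. *)
Lemma O_var_gamma : bigO (fun n => @EG R n (p n) (fun a => (Gam n a - EG (p n) (Gam n)) ^+ 2) *
  ((s n)^-1 * (s n)^-1) ^+ 2) (- alpha).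
Proof.
pose S n := (s n)^-1 * (s n)^-1.
pose L n := gamma_lip (p n) (kk1 n) (kk3 n) (M n) (K n).
pose L' n := gamma_lip (p n) (kk1 n) (kk3 n) n%:R n%:R.
have c := @bigO_cst0 R; have N := @bigO_nat R; have NX := @bigO_natX R.
(* the exponent - 20 outweighs every factor of bad_prob below *)
have b := O_bad_prob alpha_gt0 alpha_lt1 (- 20).
have P := @O_edge_prob _ alpha; have m := O_max_deg alpha; have K1 := O_k1 alpha_gt0 alpha_lt1.
have K3 := O_k3 alpha_gt0 alpha_lt1; have kO := O_max_cod alpha_gt0 alpha_lt1.
have S1 := O_sigmaV1 alpha_gt0 alpha_lt1; have S2 := O_sigmaV2 alpha_gt0 alpha_lt1.
have S11 := bigOM' S1 S1; have S12 := bigOM' S1 S2.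
have pkM := bigOM' (bigOM' P K3) m.
have K' : bigO (fun n => K n + 3 * p n * M n + 2) (1 - alpha - delta).
  have K'' : bigO (fun n => K n + 3 * p n * M n) (1 - alpha - delta).
    by apply: bigOD kO (bigOM' (bigOM' (c 3) P) m) _ _; expo.
  by apply: bigOD K'' (c 2) _ _; expo.
have OL : bigO (fun n => L n * S n) (-1).
  have a1 := bigOM' (bigOM' pkM (bigOM' (c 64) K1)) S12.
  have a2 := bigOM' (bigOM' pkM (bigOM' (bigOM' (c 96) K3) K')) S11.
  apply: bigO_ext (bigOD a1 a2 _ _); [|expo|expo].
  by near=> n; rewrite /L /gamma_lip /S; ring.
have OL' : bigO L' 0.
  have k' : bigO (fun n => n%:R + 3 * p n * n%:R + 2 : R) 1.
    have k'' : bigO (fun n => n%:R + 3 * p n * n%:R : R) 1.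
      by apply: bigOD N (bigOM' (bigOM' (c 3) P) N) _ _; expo.
    by apply: bigOD k'' (c 2) _ _; expo.
  have t : bigO (fun n => 64 * kk1 n + 96 * kk3 n * (n%:R + 3 * p n * n%:R + 2)) 0.
    by apply: bigOD (bigOM' (c 64) K1) (bigOM' (bigOM' (c 96) K3) k') _ _; expo.
  by apply: bigO_weaken (bigOM' (bigOM' (bigOM' P K3) N) t) _; expo.
have O1 := bigOM' P (bigOM' (NX 2) (bigOX 2 OL)).
have O2 := bigOM' (bigOM' P (bigOM' (bigOM' (NX 2) (bigOX 2 OL')) b)) (bigOX 2 S11).
apply: bigO_le (bigOD O1 O2 _ _); [|expo|expo].
have ln := near_large alpha_gt0 alpha_lt1; near=> n.
have lgn : large n by near: n.
have [gP K0 pM] := large_sparse lgn; have [k10 k30] := large_k lgn.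
have v := @var_gamma R n (p n) (edge_prob01 alpha_gt0 n) _ _ k10 k30 _ _ _ gP K0 pM.
apply: le_trans (ler_norm _); rewrite [leLHS]ger0_norm; last first.
  rewrite mulr_ge0 ?sqr_ge0 //; apply: EG_ge0 => [|a]; [exact: edge_prob01|exact: sqr_ge0].
apply: le_trans (ler_wpM2r (sqr_ge0 _) v) _.
rewrite le_eqVlt; apply/orP; left; apply/eqP.
rewrite -/(L n) -/(L' n) -/(S n) -/(bad_prob n).
by move: (L n) (L' n) (S n) (bad_prob n) (p n) => l l' z be q; ring.
Unshelve. all: by end_near. Qed.

(** The mean of gamma and sigma^2 have the same two leading terms, up to factors
    that tend to 1. *)
Lemma cvg_mean_gamma : @EG R n (p n) (Gam n) / s n ^+ 2 - 1 @[n --> \oo] --> (0 : R).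
Proof.
pose g1 n : R := (1 - p n) ^+ 3 * (n%:R ^+ 2 / ((n%:R - 1) * (n%:R - 2))).
pose g2 n : R := (1 - p n) * (n%:R / (n%:R - 1)).
pose r1 n := ratio1 n (p n); pose r2 n := ratio2 n (p n).
have h1 : `|g1 n - r1 n| @[n --> \oo] --> (0 : R).
  rewrite -[X in _ --> X](normr0 R); apply: cvg_norm; rewrite -(subrr (1 : R)).
  by apply: cvgB; [exact: cvg_gratio1|exact: cvg_ratio1].
have h2 : `|g2 n - r2 n| @[n --> \oo] --> (0 : R).
  rewrite -[X in _ --> X](normr0 R); apply: cvg_norm; rewrite -(subrr (1 : R)).
  by apply: cvgB; [exact: cvg_gratio2|exact: cvg_ratio2].
have h : 2 * `|g1 n - r1 n| + 2 * `|g2 n - r2 n| @[n --> \oo] --> (0 : R).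
  rewrite -[X in _ --> X](addr0 0); apply: cvgD; rewrite -[X in _ --> X](mulr0 2);
    by apply: cvgM => //; exact: cvg_cst.
apply/norm_cvg0P; apply: squeeze_cvgr (cvg_cst (0 : R)) h.
have ln := near_large alpha_gt0 alpha_lt1; near=> n.
have lgn : large n by near: n.
rewrite normr_ge0 /=; have [n3 _ _ l1 l2] := lgn.
have n0 : (0 < n)%N by rewrite (ltn_trans _ n3).
have n2 : (2 < n)%N by rewrite (ltn_trans _ n3).
have p0 : 0 < p n by exact: edge_prob_gt0.
have s2E := sigma_sqE n (edge_prob01 alpha_gt0 n).
have s0 := large_sigma_gt0 alpha_gt0 lgn.
have s20 : 0 < s n ^+ 2 by rewrite exprn_gt0.
rewrite EG_gammaE // -/(g1 n) -/(g2 n).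
have t1 : 0 <= 6 / (n%:R ^+ 3 * p n) by rewrite divr_ge0 // mulr_ge0 ?exprn_ge0 // ltW.
have t2 : 0 <= 2 * p n / n%:R ^+ 2 by rewrite divr_ge0 ?exprn_ge0 // mulr_ge0 // ltW.
move: s2E; rewrite sigma1_sqE // sigma2_sqE // -/(r1 n) -/(r2 n).
rewrite -/(r1 n) in l1; rewrite -/(r2 n) in l2.
move: t1 t2 l1 l2; move: (6 / _) (2 * p n / _) (r1 n) (r2 n) (g1 n) (g2 n).
move=> t1 t2 x1 x2 y1 y2 t10 t20 l1 l2 e.
rewrite (_ : _ - 1 = (t1 * (y1 - x1) + t2 * (y2 - x2)) / s n ^+ 2); last first.
  by rewrite e; field; rewrite -e gt_eqF.
have b1 : t1 <= 2 * s n ^+ 2.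
  have := ler_wpM2l t10 l1; have := ler_wpM2l t20 l2; rewrite e; lra.
have b2 : t2 <= 2 * s n ^+ 2.
  have := ler_wpM2l t10 l1; have := ler_wpM2l t20 l2; rewrite e; lra.
rewrite normrM [`|(_ ^+ 2)^-1|]ger0_norm ?invr_ge0 ?(ltW s20) // ler_pdivrMr //.
apply: le_trans (ler_normD _ _) _; rewrite !normrM (ger0_norm t10) (ger0_norm t20).
have c1 := ler_wpM2r (normr_ge0 (y1 - x1)) b1.
have c2 := ler_wpM2r (normr_ge0 (y2 - x2)) b2.
by move: c1 c2; lra.
Unshelve. all: by end_near. Qed.

Definition third_order n : R := @EG R n (p n) (fun a =>
  \sum_u \sum_(v | u != v) `|half_del (p n) (kk1 n) (kk3 n) u v a| *
                           lead_del (p n) (kk1 n) (kk3 n) u v a ^+ 2).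

(** In the uniform factor, the part with k1 uses the second exponent of 1 / sigma
    and the part with k3 the first one; so do the two parts of the mean square. *)
Lemma O_third_order : bigO (fun n => p n * (1 - p n) * third_order n * (s n)^-1 ^+ 3) (- delta).
Proof.
pose A n := kk1 n + kk3 n * (K n + 3 * p n * M n).
pose B n := 4 * kk1 n ^+ 2 + 36 * kk3 n ^+ 2 * ((n%:R - 2) * (p n * (1 - p n)) ^+ 2).
pose D n := (kk1 n + 4 * n%:R * kk3 n) * (2 * kk1 n + 24 * n%:R * kk3 n) ^+ 2.
have c := @bigO_cst0 R; have N := @bigO_nat R; have NX := @bigO_natX R.
(* the exponent - 20 outweighs every factor of bad_prob below *)
have b := O_bad_prob alpha_gt0 alpha_lt1 (- 20).
have P := @O_edge_prob _ alpha; have m := O_max_deg alpha; have K1 := O_k1 alpha_gt0 alpha_lt1.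
have q := O_edge_probC alpha_gt0 alpha_lt1.
have K3 := O_k3 alpha_gt0 alpha_lt1; have kO := O_max_cod alpha_gt0 alpha_lt1.
have S1 := O_sigmaV1 alpha_gt0 alpha_lt1; have S2 := O_sigmaV2 alpha_gt0 alpha_lt1.
have S11 := bigOM' S1 S1; have S22 := bigOM' S2 S2.
have OA : bigO (fun n => A n * (s n)^-1) (- delta).
  have K' : bigO (fun n => K n + 3 * p n * M n) (1 - alpha - delta).
    by apply: bigOD kO (bigOM' (bigOM' (c 3) P) m) _ _; expo.
  apply: bigO_ext (bigOD (bigOM' K1 S2) (bigOM' (bigOM' K3 K') S1) _ _); [|expo|expo].
  by near=> n; rewrite /A mulrDl.
have OB : bigO (fun n => p n * (n%:R ^+ 2 * B n) * ((s n)^-1 * (s n)^-1)) 0.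
  have a1 := bigOM' (bigOM' P (bigOM' (NX 2) (bigOM' (c 4) (bigOX 2 K1)))) S22.
  have a2 := bigOM' (bigOM' P (bigOM' (NX 2) (bigOM' (bigOM' (c 36) (bigOX 2 K3))
    (bigOM' (@O_nat_sub2 R) (bigOX 2 (bigOM' P q)))))) S11.
  apply: bigO_ext (bigOD a1 a2 _ _); [|expo|expo].
  by near=> n; rewrite /B; ring.
have OD : bigO D 0.
  have a1 : bigO (fun n => kk1 n + 4 * n%:R * kk3 n) 0.
    by apply: bigOD K1 (bigOM' (bigOM' (c 4) N) K3) _ _; expo.
  have a2 : bigO (fun n => 2 * kk1 n + 24 * n%:R * kk3 n) 0.
    by apply: bigOD (bigOM' (c 2) K1) (bigOM' (bigOM' (c 24) N) K3) _ _; expo.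
  by apply: bigO_weaken (bigOM' a1 (bigOX 2 a2)) _; expo.
have O1 := bigOM' q (bigOM' OA OB).
have O2 := bigOM' (bigOM' (bigOM' P q) (bigOM' (NX 2) (bigOM' OD b))) (bigOX 3 S1).
apply: bigO_le (bigOD O1 O2 _ _); [|expo|expo].
have ln := near_large alpha_gt0 alpha_lt1; near=> n.
have lgn : large n by near: n.
have [gP K0 pM] := large_sparse lgn; have [k10 k30] := large_k lgn; have [n3 _ _ _ _] := lgn.
have n1 : (1 < n)%N by rewrite (ltn_trans _ n3).
have v := @third_order_le R n (p n) (edge_prob01 alpha_gt0 n) _ _ k10 k30 _ _ _ n1 gP K0 pM.
have pq : 0 <= p n * (1 - p n) by rewrite mulr_ge0 ?edge_prob_ge0 // subr_ge0 edge_prob_le1.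
have s3 : 0 <= (s n)^-1 ^+ 3 by rewrite exprn_ge0 // invr_ge0 sqrtr_ge0.
apply: le_trans (ler_norm _); rewrite [leLHS]ger0_norm; last first.
  apply: mulr_ge0 s3; apply: mulr_ge0 pq _; apply: EG_ge0 => [|a]; first exact: edge_prob01.
  by apply: sumr_ge0 => u _; apply: sumr_ge0 => w _; rewrite mulr_ge0 ?sqr_ge0.
apply: le_trans (ler_wpM2r s3 (ler_wpM2l pq v)) _.
rewrite le_eqVlt; apply/orP; left; apply/eqP.
rewrite -/(A n) -/(B n) -/(D n) -/(bad_prob n).
by move: (A n) (B n) (D n) (bad_prob n) (p n) ((s n)^-1) => l l' z be x y; ring.
Unshelve. all: by end_near. Qed.

End SteinErrorRates.

(** * Convergence to the Gaussian law *)

Section SmoothConvergence.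
Context {R : realType} (alpha : R).
Hypothesis alpha_gt0 : 0 < alpha.
Hypothesis alpha_lt1 : alpha < 1.
Local Notation p n := (edge_prob alpha n).
Local Notation s n := (sigma n (p n)).
Local Notation large := (large alpha).
Local Notation lead n := (@lead R n (p n) (@k1 R n (p n)) (@k3 R n (p n))).
Local Notation Gam n := (@gamma R n (p n) (@k1 R n (p n)) (@k3 R n (p n))).
Local Notation Rem n := (@remainder R n (p n)).
Local Notation E n := (@EG R n (p n)).

Definition std_closure n (a : @graph n) : R := (closure_coef a - E n closure_coef) / s n.

Let p01 n : 0 <= p n <= 1. Proof. exact: edge_prob01. Qed.

Lemma sqr_le_cvg0 (f g : nat -> R) : g n @[n --> \oo] --> (0 : R) ->
  (\forall n \near \oo, 0 <= f n /\ f n ^+ 2 <= g n) -> f n @[n --> \oo] --> (0 : R).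
Proof.
move=> g0 fg; apply/cvgr0Pnorm_lt => e e0.
have e2 : 0 < e ^+ 2 by rewrite exprn_gt0.
have /cvgr0Pnorm_lt/(_ _ e2) h := g0; near=> n.
have [f0 f2] : 0 <= f n /\ f n ^+ 2 <= g n by near: n.
rewrite ger0_norm // -(ltr_pXn2r (n := 2)) ?nnegrE ?(ltW e0) //.
apply: le_lt_trans f2 (le_lt_trans (ler_norm _) _); near: n; exact: h.
Unshelve. all: by end_near. Qed.

Lemma cvg0D (f g : nat -> R) : f n @[n --> \oo] --> (0 : R) -> g n @[n --> \oo] --> (0 : R) ->
  f n + g n @[n --> \oo] --> (0 : R).
Proof. by move=> hf hg; rewrite -[X in _ --> X](addr0 0); apply: cvgD. Qed.

Lemma cvg0Z (c : R) (f : nat -> R) : f n @[n --> \oo] --> (0 : R) ->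
  c * f n @[n --> \oo] --> (0 : R).
Proof. by move=> hf; rewrite -[X in _ --> X](mulr0 c); apply: cvgM => //; exact: cvg_cst. Qed.

Lemma cvg_remainder : E n (fun a => `|(Rem n a - E n (Rem n)) / s n|) @[n --> \oo] --> (0 : R).
Proof.
have dn : - delta alpha < 0 by rewrite oppr_lt0 delta_gt0.
apply: (sqr_le_cvg0 (bigO_cvg0 (O_var_remainder alpha_gt0 alpha_lt1) dn)).
near=> n; split; first by apply: EG_ge0.
apply: le_trans (Ex_sqr_le (edge_p01 (p01 n)) _) _.
rewrite mulrC /EG -ExZ; apply: le_EG => // a; rewrite real_normK ?num_real //.
by rewrite exprMn mulrC expr2.
Unshelve. all: by end_near. Qed.

Lemma cvg_gamma_dev : E n (fun a => `|(Gam n a - E n (Gam n)) / s n ^+ 2|) @[n --> \oo] --> (0 : R).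
Proof.
have dn : - alpha < 0 by rewrite oppr_lt0.
apply: (sqr_le_cvg0 (bigO_cvg0 (O_var_gamma alpha_gt0 alpha_lt1) dn)).
near=> n; split; first by apply: EG_ge0.
apply: le_trans (Ex_sqr_le (edge_p01 (p01 n)) _) _.
rewrite mulrC /EG -ExZ; apply: le_EG => // a; rewrite real_normK ?num_real //.
by rewrite exprMn mulrC exprVn -invfM -expr2 -exprVn.
Unshelve. all: by end_near. Qed.

Lemma cvg_gamma : E n (fun a => `|Gam n a / s n ^+ 2 - 1|) @[n --> \oo] --> (0 : R).
Proof.
have h : E n (fun a => `|(Gam n a - E n (Gam n)) / s n ^+ 2|) +
    `|E n (Gam n) / s n ^+ 2 - 1| @[n --> \oo] --> (0 : R).
  apply: cvg0D cvg_gamma_dev _.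
  by apply/norm_cvg0P; exact: cvg_mean_gamma.
apply: squeeze_cvgr (cvg_cst (0 : R)) h.
near=> n; apply/andP; split; first by apply: EG_ge0.
rewrite -[X in _ <= _ + X](Ex_cst (@edge_p R n (p n))) /EG -ExD; apply: le_EG => // a.
apply: le_trans (ler_normD _ _).
by rewrite addrA mulrBl subrK.
Unshelve. all: by end_near. Qed.

Lemma cvg_third : p n * (1 - p n) * third_order alpha n * (s n)^-1 ^+ 3 @[n --> \oo] --> (0 : R).
Proof.
by apply: bigO_cvg0 (O_third_order alpha_gt0 alpha_lt1) _; rewrite oppr_lt0 delta_gt0.
Qed.

Lemma std_closureE n (a : @graph n) :
  std_closure a = lead n a / s n + (Rem n a - E n (Rem n)) / s n.
Proof. by rewrite /std_closure EG_remainder /remainder -mulrDl; congr (_ / _); ring. Qed.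

(** The ramp is Lipschitz, so the remainder may be dropped. For the linear
    statistic, Stein's equation rewrites the error as the difference that
    stein_lead bounds. *)
Lemma cvg_ramp (x y : R) : x < y ->
  E n (fun a => ramp x y (std_closure a)) @[n --> \oo] --> gint_total (ramp x y).
Proof.
move=> xy; have [f [f' [Bf [Cf [feq fB fC]]]]] := stein_equation xy.
set c := gint_total _ in feq *.
apply/subr_cvg0.
have h : (y - x)^-1 * E n (fun a => `|(Rem n a - E n (Rem n)) / s n|) +
    (Bf * E n (fun a => `|Gam n a / s n ^+ 2 - 1|) +
     Cf * (p n * (1 - p n) * third_order alpha n * (s n)^-1 ^+ 3)) @[n --> \oo] --> (0 : R).
  apply: cvg0D; [|apply: cvg0D]; apply: cvg0Z.
  - exact: cvg_remainder.
  - exact: cvg_gamma.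
  - exact: cvg_third.
apply/norm_cvg0P; apply: squeeze_cvgr (cvg_cst (0 : R)) h.
have ln := near_large alpha_gt0 alpha_lt1; near=> n.
have lgn : large n by near: n.
have s0 := large_sigma_gt0 alpha_gt0 lgn.
rewrite normr_ge0 /=.
pose W' a := lead n a / s n.
rewrite (_ : _ - c = E n (fun a => ramp x y (std_closure a) - ramp x y (W' a)) +
   E n (fun a => ramp x y (W' a) - c)); last first.
  by rewrite /EG !ExB Ex_cst addrA subrK.
apply: le_trans (ler_normD _ _) _; apply: lerD.
  apply: le_trans (ler_norm_Ex (edge_p01 (p01 n)) _) _.
  rewrite /EG -ExZ; apply: le_EG => // a.
  by apply: le_trans (ramp_lip xy _ _) _; rewrite std_closureE addrAC subrr add0r.
have h2 := @stein_lead R n (p n) (p01 n) (@k1 R n (p n)) (@k3 R n (p n)) f f' Bf Cf (s n) s0 fC fB.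
rewrite -/(third_order alpha n) in h2.
have -> : E n (fun a => ramp x y (W' a) - c) =
  E n (fun a => f' (W' a)) - E n (fun a => W' a * f (W' a)).
  by rewrite /EG -ExB; apply: eq_Ex => a; rewrite feq.
rewrite distrC; apply: le_trans h2 _; rewrite lerD2l.
by rewrite exprVn le_eqVlt; apply/orP; left; apply/eqP; ring.
Unshelve. all: by end_near. Qed.

End SmoothConvergence.

Section DistributionFunctions.
Context {R : realType} (alpha : R).
Hypothesis alpha_gt0 : 0 < alpha.
Hypothesis alpha_lt1 : alpha < 1.
Local Notation p n := (edge_prob alpha n).
Local Notation E n := (@EG R n (p n)).

Lemma gcdf_continuous : continuous (@gcdf R).
Proof.
move=> w; apply: differentiable_continuous; apply/derivable1_diffP.
by have [] := is_derive_gcdf w.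
Qed.

(** The indicator of a ray lies between two ramps of small width; by
    gint_total_bounds and the continuity of gcdf their limits differ little. *)
Lemma cvg_EG_std_closure (r : R) :
  E n (fun a => (std_closure alpha a <= r)%R%:R) @[n --> \oo] --> gcdf r.
Proof.
apply/cvgrPdist_lt => e e0; have e2 : 0 < e / 2 by rewrite divr_gt0.
have /cvgrPdist_lt/(_ _ e2)/nbhs_ballP[d /= d0 hd] := @gcdf_continuous r.
pose d' := d / 2; have d'0 : 0 < d' by rewrite divr_gt0.
have dd : d' < d by rewrite /d' ltr_pdivrMr // ltr_pMr // ltr1n.
have lo : `|gcdf r - gcdf (r - d')| < e / 2.
  by apply: hd; rewrite /ball /= opprB addrC subrK gtr0_norm.
have hi : `|gcdf r - gcdf (r + d')| < e / 2.
  by apply: hd; rewrite /ball /= opprD addrA subrr sub0r normrN gtr0_norm.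
have xl : r - d' < r by rewrite ltrBlDr ltrDl.
have xh : r < r + d' by rewrite ltrDl.
have /cvgrPdist_lt/(_ _ e2) h1 := cvg_ramp alpha_gt0 alpha_lt1 xl.
have /cvgrPdist_lt/(_ _ e2) h2 := cvg_ramp alpha_gt0 alpha_lt1 xh.
near=> n.
have a1 : `|gint_total (ramp (r - d') r) - E n (fun a => ramp (r - d') r (std_closure alpha a))| < e / 2.
  by near: n; exact: h1.
have a2 : `|gint_total (ramp r (r + d')) - E n (fun a => ramp r (r + d') (std_closure alpha a))| < e / 2.
  by near: n; exact: h2.
have /andP[b1 _] := gint_total_bounds xl.
have /andP[_ b2] := gint_total_bounds xh.
have p01 := edge_prob01 alpha_gt0 n.
have c1 : E n (fun a => ramp (r - d') r (std_closure alpha a)) <=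
    E n (fun a => (std_closure alpha a <= r)%R%:R).
  apply: le_EG => // a; have /andP[_ k1] := ramp01 xl (std_closure alpha a).
  by case: (lerP (std_closure alpha a) r) => [_ //|wr]; rewrite ramp0 // ltW.
have c2 : E n (fun a => (std_closure alpha a <= r)%R%:R) <=
    E n (fun a => ramp r (r + d') (std_closure alpha a)).
  apply: le_EG => // a; have /andP[k0 _] := ramp01 xh (std_closure alpha a).
  by case: (lerP (std_closure alpha a) r) => [wr|_ //]; rewrite ramp1.
move: a1 a2 lo hi; rewrite !ltr_norml => /andP[_ a1] /andP[a2 _] /andP[_ lo] /andP[hi _].
by apply/andP; split; move: b1 b2 c1 c2 a1 a2 lo hi; lra.
Unshelve. all: by end_near. Qed.

Lemma avg_closure_adj n (a : @graph n) : avg_closure (adj a) = closure_coef a :> R.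
Proof.
have xii (i : 'I_n) : adj a i i = false by rewrite /adj /edge_key eqxx.
rewrite /avg_closure /closure_coef; congr (_ * _); apply: eq_bigr => i _; congr (_ / _).
- rewrite /closed_paths big_mkcond; apply: eq_bigr => j _; rewrite /xe.
  case: (eqVneq j i) => [->|ji] /=; first by rewrite xii big1 // => k _; rewrite !mul0r.
  rewrite big_mkcond; apply: eq_bigr => k _.
  case: (eqVneq k i) => [->|ki] /=; first by rewrite xii mulr0.
  by case: (eqVneq k j) => [->|kj] //=; rewrite xii mulr0 mul0r.
- rewrite /paths big_mkcond; apply: eq_bigr => j _; rewrite /xe.
  case: (eqVneq j i) => [->|ji] /=; first by rewrite xii big1 // => k _; rewrite !mul0r.
  rewrite big_mkcond; apply: eq_bigr => k _; rewrite eq_sym.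
  case: (eqVneq i k) => [->|ki] /=; first by rewrite mulr0.
  by case: (eqVneq k j) => [->|kj] /=; rewrite mulr1 // xii mulr0.
Qed.

Section OnProbabilitySpace.
Context (n : nat) d (T : measurableType d) (P : probability T R).
Variable A : 'I_n -> 'I_n -> {RV P >-> bool}.
Hypothesis er : is_erdos_renyi P (p n) A.

Lemma avg_closure_rvE : avg_closure_rv P A = closure_coef \o sample A :> (T -> R).
Proof.
by apply/funext => t; rewrite /avg_closure_rv /= -avg_closure_adj (adj_sample er).
Qed.

Lemma cdf_standardize (r : R) :
  cdf (standardize P (avg_closure_rv P A) (sigma n (p n)) : {RV P >-> R}) r =
  (E n (fun a => (std_closure alpha a <= r)%R%:R))%:E.
Proof.
rewrite -(prob_sampleE er) /cdf /distribution /pushforward; congr (P _).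
have eE : ('E_P[avg_closure_rv P A])%E = (E n closure_coef)%:E.
  by rewrite avg_closure_rvE; exact: expectation_sample er _.
apply/seteqP; split=> t /=; by rewrite in_itv /= /standardize eE /std_closure -avg_closure_adj (adj_sample er).
Qed.

End OnProbabilitySpace.

Lemma cvg_in_distribution_closure (d : nat -> measure_display) (T : forall n, measurableType (d n))
    (P : forall n, probability (T n) R)
    (A : forall n, 'I_n -> 'I_n -> {RV (P n) >-> bool}) :
    (forall n, is_erdos_renyi (P n) (p n) (A n)) ->
    cvg_in_distribution P
      (fun n => standardize (P n) (avg_closure_rv (P n) (A n)) (sigma n (p n)))
      (normal_prob 0 1).
Proof.
move=> er r _; rewrite [X in _ --> X](_ : _ = (gcdf r)%:E); last exact: esym (gcdfE_fin r).
under eq_fun do rewrite (cdf_standardize (er _)).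
apply: cvg_EFin; first by near=> n.
exact: cvg_EG_std_closure.
Unshelve. all: by end_near. Qed.

End DistributionFunctions.

(** * Asymptotics of the variance *)

Section VarianceAsymptotics.
Context {R : realType} (alpha : R).
Hypothesis alpha_gt0 : 0 < alpha.
Hypothesis alpha_lt1 : alpha < 1.
Local Notation p n := (edge_prob alpha n).

Lemma eq_1o1_ratio (f g r : nat -> R) : r n @[n --> \oo] --> (1 : R) ->
  (\forall n \near \oo, f n = g n * r n) -> eq_1o1 f g.
Proof.
move=> r1 fg; exists (fun n => r n - 1); first by apply/subr_cvg0.
by apply: filterS fg => n ->; rewrite addrC subrK.
Qed.

Lemma sigma1_den n : (0 < n)%N -> n%:R `^ (3 - alpha) = n%:R ^+ 3 * p n.
Proof.
move=> n0; have Nne : (n%:R : R) != 0 by rewrite pnatr_eq0 -lt0n.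
by rewrite powRD ?Nne ?implybT // powR_mulrn.
Qed.

Lemma sigma2_den n : (0 < n)%N -> n%:R `^ (2 + alpha) = n%:R ^+ 2 / p n.
Proof.
move=> n0; have Nne : (n%:R : R) != 0 by rewrite pnatr_eq0 -lt0n.
by rewrite powRD ?Nne ?implybT // powR_mulrn // /edge_prob powRN invrK.
Qed.

Lemma near_gt2 : \forall n \near \oo, (2 < n)%N.
Proof. exact: near_ge_nat. Qed.

Lemma sigma1_asymp : eq_1o1 (fun n => sigma1_sq n (p n)) (fun n => 6 / n%:R `^ (3 - alpha)).
Proof.
have c : ratio1 n (p n) @[n --> \oo] --> (1 : R) by exact: cvg_ratio1.
apply: (eq_1o1_ratio c); near=> n.
have n2 : (2 < n)%N by near: n; exact: near_gt2.
have n0 : (0 < n)%N by rewrite (ltn_trans _ n2).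
by rewrite sigma1_den // sigma1_sqE // edge_prob_gt0.
Unshelve. all: by end_near. Qed.

Lemma sigma2_asymp : eq_1o1 (fun n => sigma2_sq n (p n)) (fun n => 2 / n%:R `^ (2 + alpha)).
Proof.
have c : ratio2 n (p n) @[n --> \oo] --> (1 : R) by exact: cvg_ratio2.
apply: (eq_1o1_ratio c); near=> n.
have n2 : (2 < n)%N by near: n; exact: near_gt2.
have n0 : (0 < n)%N by rewrite (ltn_trans _ n2).
by rewrite sigma2_den // sigma2_sqE ?edge_prob_gt0 //; congr (_ * _); rewrite invf_div mulrA.
Unshelve. all: by end_near. Qed.

Lemma sigma_sq_ratios n : (2 < n)%N -> sigma n (p n) ^+ 2 =
  6 / (n%:R ^+ 3 * p n) * ratio1 n (p n) + 2 * p n / n%:R ^+ 2 * ratio2 n (p n).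
Proof.
move=> n2; have n0 : (0 < n)%N by rewrite (ltn_trans _ n2).
by rewrite sigma_sqE ?edge_prob01 // sigma1_sqE ?sigma2_sqE ?edge_prob_gt0.
Qed.

Lemma np2E n : (0 < n)%N -> n%:R * p n ^+ 2 = n%:R `^ (1 - 2 * alpha).
Proof.
move=> n0; have Nne : (n%:R : R) != 0 by rewrite pnatr_eq0 -lt0n.
rewrite powRD ?Nne ?implybT // powRr1 // -powR_mulrn ?powR_ge0 // -powRrM.
by congr (_ * _ `^ _); ring.
Qed.

(** The quotient of the two leading terms is n p^2 / 3, which tends to 0 exactly
    when alpha > 1/2. *)
Lemma sigma_asymp_sparse : 1 / 2 < alpha ->
  eq_1o1 (fun n => sigma n (p n) ^+ 2) (fun n => 6 / n%:R `^ (3 - alpha)).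
Proof.
move=> a2.
have c : ratio1 n (p n) + ratio2 n (p n) * (n%:R `^ (1 - 2 * alpha) / 3) @[n --> \oo] --> (1 : R).
  rewrite -[X in _ --> X]addr0; apply: cvgD; first exact: cvg_ratio1.
  rewrite -[X in _ --> X](mulr0 1); apply: cvgM; first exact: cvg_ratio2.
  rewrite -[X in _ --> X](mul0r 3^-1); apply: cvgM; last exact: cvg_cst.
  by apply: cvg_powR_neg; lra.
apply: (eq_1o1_ratio c); near=> n.
have n2 : (2 < n)%N by near: n; exact: near_gt2.
have n0 : (0 < n)%N by rewrite (ltn_trans _ n2).
have Nne : (n%:R : R) != 0 by rewrite pnatr_eq0 -lt0n.
have pne : p n != 0 by rewrite gt_eqF ?edge_prob_gt0.
rewrite sigma_sq_ratios // sigma1_den // -np2E //.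
by move: (ratio1 _ _) (ratio2 _ _) => x y; field; rewrite Nne pne.
Unshelve. all: by end_near. Qed.

Lemma sigma_asymp_dense : alpha < 1 / 2 ->
  eq_1o1 (fun n => sigma n (p n) ^+ 2) (fun n => 2 / n%:R `^ (2 + alpha)).
Proof.
move=> a2.
have c : ratio2 n (p n) + ratio1 n (p n) * (3 * n%:R `^ (- (1 - 2 * alpha))) @[n --> \oo] --> (1 : R).
  rewrite -[X in _ --> X]addr0; apply: cvgD; first exact: cvg_ratio2.
  rewrite -[X in _ --> X](mulr0 1); apply: cvgM; first exact: cvg_ratio1.
  rewrite -[X in _ --> X](mulr0 3); apply: cvgM; first exact: cvg_cst.
  by apply: cvg_powR_neg; lra.
apply: (eq_1o1_ratio c); near=> n.
have n2 : (2 < n)%N by near: n; exact: near_gt2.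
have n0 : (0 < n)%N by rewrite (ltn_trans _ n2).
have Nne : (n%:R : R) != 0 by rewrite pnatr_eq0 -lt0n.
have pne : p n != 0 by rewrite gt_eqF ?edge_prob_gt0.
rewrite sigma_sq_ratios // sigma2_den // powRN -np2E //.
by move: (ratio1 _ _) (ratio2 _ _) => x y; field; rewrite Nne pne.
Unshelve. all: by end_near. Qed.

Lemma sigma_asymp_critical : alpha = 1 / 2 ->
  eq_1o1 (fun n => sigma n (p n) ^+ 2) (fun n => 8 / (n%:R ^+ 2 * Num.sqrt n%:R)).
Proof.
move=> a2.
have c : 3 / 4 * ratio1 n (p n) + 1 / 4 * ratio2 n (p n) @[n --> \oo] --> (1 : R).
  rewrite [X in _ --> X](_ : 1 = 3 / 4 * 1 + 1 / 4 * 1); last by field.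
  apply: cvgD; apply: cvgM; try exact: cvg_cst.
    exact: cvg_ratio1.
  exact: cvg_ratio2.
apply: (eq_1o1_ratio c); near=> n.
have n2 : (2 < n)%N by near: n; exact: near_gt2.
have n0 : (0 < n)%N by rewrite (ltn_trans _ n2).
have r0 : 0 < Num.sqrt n%:R :> R by rewrite sqrtr_gt0 ltr0n.
have pE : p n = (Num.sqrt n%:R)^-1.
  by rewrite /edge_prob a2 powRN div1r powR12_sqrt.
have NE : n%:R = Num.sqrt n%:R ^+ 2 :> R by rewrite sqr_sqrtr.
rewrite sigma_sq_ratios // pE; move: (ratio1 _ _) (ratio2 _ _) => x y.
move: r0 NE; move: (Num.sqrt n%:R) => z z0 ->.
by field; rewrite gt_eqF.
Unshelve. all: by end_near. Qed.

End VarianceAsymptotics.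

(** * Central limit theorem for the average closure coefficient *)

Theorem corollary2p3 (R : realType) (alpha : R)
    (alpha_gt0 : 0 < alpha) (alpha_lt1 : alpha < 1) :
  (forall (d : nat -> measure_display) (T : forall n, measurableType (d n))
      (P : forall n, probability (T n) R)
      (A : forall n, 'I_n -> 'I_n -> {RV (P n) >-> bool}),
    (forall n, is_erdos_renyi (P n) (edge_prob alpha n) (A n)) ->
    cvg_in_distribution P
      (fun n => standardize (P n) (avg_closure_rv (P n) (A n))
                            (sigma n (edge_prob alpha n)))
      (normal_prob 0 1)) /\
  (forall n, (2 < n)%N -> 0 < sigma n (edge_prob alpha n)) /\
  (forall n, sigma n (edge_prob alpha n) ^+ 2 =
    sigma1_sq n (edge_prob alpha n) + sigma2_sq n (edge_prob alpha n)) /\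
  eq_1o1 (fun n => sigma1_sq n (edge_prob alpha n))
         (fun n => 6 / n%:R `^ (3 - alpha)) /\
  eq_1o1 (fun n => sigma2_sq n (edge_prob alpha n))
         (fun n => 2 / n%:R `^ (2 + alpha)) /\
  (1 / 2 < alpha -> eq_1o1 (fun n => sigma n (edge_prob alpha n) ^+ 2)
                           (fun n => 6 / n%:R `^ (3 - alpha))) /\
  (alpha = 1 / 2 -> eq_1o1 (fun n => sigma n (edge_prob alpha n) ^+ 2)
                           (fun n => 8 / (n%:R ^+ 2 * Num.sqrt n%:R))) /\
  (alpha < 1 / 2 -> eq_1o1 (fun n => sigma n (edge_prob alpha n) ^+ 2)
                           (fun n => 2 / n%:R `^ (2 + alpha))).
Proof.
have p01 n := edge_prob01 alpha_gt0 n.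
split; first by move=> d T P A; exact: cvg_in_distribution_closure.
split.
  move=> n n2; apply: sigma_gt0 => //; rewrite ?edge_prob_gt0 ?edge_prob_lt1 //;
    by rewrite (ltn_trans _ n2).
split; first by move=> n; exact: sigma_sqE.
split; first exact: sigma1_asymp.
split; first exact: sigma2_asymp.
split; first exact: sigma_asymp_sparse.
split; first exact: sigma_asymp_critical.
exact: sigma_asymp_dense.
Qed.
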